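(* Let $\mathcal M$ be a timelike surface in $\mathbb R^4_1$ with parallel normalized mean curvature vector field, free of inflection points, and satisfying $K-H^2\neq0$ at every point. Then $\mathcal M$ locally admits canonical parameters; that is, every point of $\mathcal M$ has a neighbourhood which can be parametrized by canonical isotropic parameters.
   Context: $\mathbb R^4_1$ is $\mathbb R^4$ with the metric $\langle\cdot,\cdot\rangle=dx_1^2+dx_2^2+dx_3^2-dx_4^2$ and flat Levi-Civita connection $\widetilde\nabla$. A surface is given by a smooth immersion $z$ of a domain (open connected set) of $\mathbb R^2$ into $\mathbb R^4_1$; it is timelike if the induced metric is Lorentzian. $\sigma$ is the second fundamental tensor (normal part of $\widetilde\nabla_xy$ for tangent $x,y$), $D$ the normal connection (normal part of $\widetilde\nabla_x\xi$ for normal $\xi$), $H=\tfrac12\mathrm{tr}\,\sigma$ the mean curvature vector field, $K$ the Gauss curvature of the induced metric, and $H^2=\langle H,H\rangle$. A normal field $\xi$ is parallel if $D\xi=0$. $\mathcal M$ has parallel normalized mean curvature vector field if $H$ is nowhere zero, $H$ is not parallel, and there is a unit normal vector field in the direction of $H$ which is parallel. An inflection point is a point $p$ at which the first normal space $\mathrm{span}\{\sigma(x,y):x,y\in T_p\mathcal M\}$ has dimension at most one (equivalently, with $c_{ij}^k$ the components of $\sigma(z_u,z_u),\sigma(z_u,z_v),\sigma(z_v,z_v)$ in an orthonormal normal frame, all three $2\times2$ determinants formed from pairs of these vectors vanish). Parameters $(u,v)$ are isotropic if $\langle z_u,z_u\rangle=\langle z_v,z_v\rangle=0$ and $\langle z_u,z_v\rangle=-f^2$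 for a smooth function $f>0$ (the metric function). Put $x=z_u/f$, $y=z_v/f$, let $n_1$ be a unit normal field collinear with $H$, and let $n_2$ be a unit normal field orthogonal to $n_1$ ($n_2$ is determined up to sign). For a surface as in the claim, isotropic parameters $(u,v)$ are canonical if $$\sigma(x,x)=\lambda n_1+\mu n_2,\quad \sigma(x,y)=-\nu n_1,\quad \sigma(y,y)=-\varepsilon(\lambda n_1+\mu n_2)$$ for smooth functions $\lambda,\mu,\nu$, where $\varepsilon=1$ if $K-H^2>0$ and $\varepsilon=-1$ if $K-H^2<0$, $\mu\neq0$, and the metric function is $$f(u,v)=\frac{1}{\sqrt{|\mu|}}.$$ *)

(* Defs.v *)
From Stdlib Require Import Reals.
From Coquelicot Require Import Coquelicot.
Open Scope R_scope.

Definition R4 : Type := R * R * R * R.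

Definition comp1 (a : R4) : R := let '(a1, _, _, _) := a in a1.
Definition comp2 (a : R4) : R := let '(_, a2, _, _) := a in a2.
Definition comp3 (a : R4) : R := let '(_, _, a3, _) := a in a3.
Definition comp4 (a : R4) : R := let '(_, _, _, a4) := a in a4.

Definition vadd (a b : R4) : R4 := plus (a : R * R * R * R) b.
Definition vscal (k : R) (a : R4) : R4 := scal k (a : R * R * R * R).
Definition vzero : R4 := (0, 0, 0, 0).

Definition mink (a b : R4) : R :=
  comp1 a * comp1 b + comp2 a * comp2 b + comp3 a * comp3 b - comp4 a * comp4 b.

Definition connected (D : R * R -> Prop) : Prop :=
  forall A B : R * R -> Prop,
    open A -> open B ->
    (forall p, D p -> A p \/ B p) ->
    (exists p, D p /\ A p) -> (exists p, D p /\ B p) ->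
    exists p, D p /\ A p /\ B p.

Definition planar_domain (D : R * R -> Prop) : Prop := open D /\ connected D.

(** [ex_diff_n f n] at every point of an open set means that [f] is of class
    C^n on that set, so this is C^oo on [D] when [D] is open. *)
Definition smooth (D : R * R -> Prop) (f : R -> R -> R) : Prop :=
  forall (n : nat) (u v : R), D (u, v) -> ex_diff_n f n u v.

Definition smooth_vec (D : R * R -> Prop) (F : R -> R -> R4) : Prop :=
  smooth D (fun u v => comp1 (F u v)) /\ smooth D (fun u v => comp2 (F u v)) /\
  smooth D (fun u v => comp3 (F u v)) /\ smooth D (fun u v => comp4 (F u v)).

Definition smooth_map (D : R * R -> Prop) (phi : R -> R -> R * R) : Prop :=
  smooth D (fun u v => fst (phi u v)) /\ smooth D (fun u v => snd (phi u v)).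

Definition diffeo (W V : R * R -> Prop) (phi psi : R -> R -> R * R) : Prop :=
  smooth_map W phi /\ smooth_map V psi /\
  (forall s t, W (s, t) ->
     V (phi s t) /\ psi (fst (phi s t)) (snd (phi s t)) = (s, t)) /\
  (forall u v, V (u, v) ->
     W (psi u v) /\ phi (fst (psi u v)) (snd (psi u v)) = (u, v)).

Inductive coord : Set := cu | cv.

Definition csum (h : coord -> R) : R := h cu + h cv.

Definition pd (i : coord) (f : R -> R -> R) (u v : R) : R :=
  match i with
  | cu => Derive (fun t => f t v) u
  | cv => Derive (fun t => f u t) v
  end.

Definition pdv (i : coord) (F : R -> R -> R4) (u v : R) : R4 :=
  (pd i (fun s t => comp1 (F s t)) u v, pd i (fun s t => comp2 (F s t)) u v,
   pd i (fun s t => comp3 (F s t)) u v, pd i (fun s t => comp4 (F s t)) u v).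

(** A tangent vector is given by its components [X : R * R] in the basis
    [z_u, z_v]; a tangent vector field by [X : R -> R -> R * R]. *)

Definition push (z : R -> R -> R4) (u v : R) (X : R * R) : R4 :=
  vadd (vscal (fst X) (pdv cu z u v)) (vscal (snd X) (pdv cv z u v)).

Definition immersion (D : R * R -> Prop) (z : R -> R -> R4) : Prop :=
  smooth_vec D z /\
  forall u v, D (u, v) -> forall X : R * R, push z u v X = vzero -> X = (0, 0).

Definition metric (z : R -> R -> R4) (i j : coord) (u v : R) : R :=
  mink (pdv i z u v) (pdv j z u v).

(** The induced metric has signature (1,1). *)
Definition lorentzian_at (z : R -> R -> R4) (u v : R) : Prop :=
  exists X Y : R * R,
    mink (push z u v X) (push z u v X) = 1 /\
    mink (push z u v Y) (push z u v Y) = -1 /\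
    mink (push z u v X) (push z u v Y) = 0.

Definition timelike_surface (D : R * R -> Prop) (z : R -> R -> R4) : Prop :=
  planar_domain D /\ immersion D z /\
  forall u v, D (u, v) -> lorentzian_at z u v.

Definition metric_det (z : R -> R -> R4) (u v : R) : R :=
  metric z cu cu u v * metric z cv cv u v - metric z cu cv u v ^ 2.

Definition metric_inv (z : R -> R -> R4) (i j : coord) (u v : R) : R :=
  match i, j with
  | cu, cu => metric z cv cv u v
  | cv, cv => metric z cu cu u v
  | _, _ => - metric z cu cv u v
  end / metric_det z u v.

(** [christoffel z k i j] is Gamma^k_{ij} of the induced metric. *)
Definition christoffel (z : R -> R -> R4) (k i j : coord) (u v : R) : R :=
  / 2 * csum (fun l => metric_inv z k l u v *
    (pd i (metric z j l) u v + pd j (metric z i l) u v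
     - pd l (metric z i j) u v)).

(** The component of R(d_u, d_v) d_v along d_l, with
    R(X,Y) = [nabla_X, nabla_Y] - nabla_[X,Y]. *)
Definition curvature_uvv (z : R -> R -> R4) (l : coord) (u v : R) : R :=
  pd cu (christoffel z l cv cv) u v - pd cv (christoffel z l cu cv) u v
  + csum (fun m => christoffel z m cv cv u v * christoffel z l cu m u v)
  - csum (fun m => christoffel z m cu cv u v * christoffel z l cv m u v).

Definition gauss_curvature (z : R -> R -> R4) (u v : R) : R :=
  csum (fun l => metric z cu l u v * curvature_uvv z l u v) / metric_det z u v.

Definition tangent_part (z : R -> R -> R4) (u v : R) (a : R4) : R4 :=
  push z u v
    (csum (fun j => metric_inv z cu j u v * mink a (pdv j z u v)),
     csum (fun j => metric_inv z cv j u v * mink a (pdv j z u v))).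

Definition normal_part (z : R -> R -> R4) (u v : R) (a : R4) : R4 :=
  vadd a (vscal (-1) (tangent_part z u v a)).

(** The flat Levi-Civita connection, for a field [F] along the surface. *)
Definition flat_conn (X : R * R) (F : R -> R -> R4) (u v : R) : R4 :=
  vadd (vscal (fst X) (pdv cu F u v)) (vscal (snd X) (pdv cv F u v)).

Definition sff (z : R -> R -> R4) (X Y : R -> R -> R * R) (u v : R) : R4 :=
  normal_part z u v
    (flat_conn (X u v) (fun s t => push z s t (Y s t)) u v).

(** sigma is tensorial, so its value on tangent vectors at a point is computed
    by extending them to fields with constant components. *)
Definition sff_at (z : R -> R -> R4) (u v : R) (X Y : R * R) : R4 :=
  sff z (fun _ _ => X) (fun _ _ => Y) u v.

Definition normal_conn (z : R -> R -> R4) (X : R * R) (xi : R -> R -> R4)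
    (u v : R) : R4 :=
  normal_part z u v (flat_conn X xi u v).

Definition basis_vec (i : coord) : R * R :=
  match i with cu => (1, 0) | cv => (0, 1) end.

(** H = (1/2) g^{ij} sigma(z_i, z_j). *)
Definition mean_curvature (z : R -> R -> R4) (u v : R) : R4 :=
  let term i j :=
    vscal (metric_inv z i j u v) (sff_at z u v (basis_vec i) (basis_vec j)) in
  vscal (/ 2) (vadd (vadd (term cu cu) (term cu cv))
                    (vadd (term cv cu) (term cv cv))).

Definition K_minus_H2 (z : R -> R -> R4) (u v : R) : R :=
  gauss_curvature z u v - mink (mean_curvature z u v) (mean_curvature z u v).

Definition parallel (D : R * R -> Prop) (z xi : R -> R -> R4) : Prop :=
  forall u v, D (u, v) -> forall X : R * R, normal_conn z X xi u v = vzero.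

Definition normal_field (D : R * R -> Prop) (z n : R -> R -> R4) : Prop :=
  smooth_vec D n /\
  forall u v, D (u, v) -> forall X : R * R, mink (n u v) (push z u v X) = 0.

Definition unit_normal_field (D : R * R -> Prop) (z n : R -> R -> R4) : Prop :=
  normal_field D z n /\ forall u v, D (u, v) -> mink (n u v) (n u v) = 1.

Definition collinear_with_H (D : R * R -> Prop) (z n : R -> R -> R4) : Prop :=
  forall u v, D (u, v) -> exists k : R, mean_curvature z u v = vscal k (n u v).

Definition parallel_normalized_mean_curvature (D : R * R -> Prop)
    (z : R -> R -> R4) : Prop :=
  (forall u v, D (u, v) -> mean_curvature z u v <> vzero) /\
  ~ parallel D z (mean_curvature z) /\
  exists n : R -> R -> R4,
    unit_normal_field D z n /\ collinear_with_H D z n /\ parallel D z n.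

Inductive first_normal_space (z : R -> R -> R4) (u v : R) : R4 -> Prop :=
| fns_sigma (X Y : R * R) : first_normal_space z u v (sff_at z u v X Y)
| fns_add (a b : R4) :
    first_normal_space z u v a -> first_normal_space z u v b ->
    first_normal_space z u v (vadd a b)
| fns_scal (k : R) (a : R4) :
    first_normal_space z u v a -> first_normal_space z u v (vscal k a).

Definition inflection_point (z : R -> R -> R4) (u v : R) : Prop :=
  exists n : R4, forall a : R4,
    first_normal_space z u v a -> exists k : R, a = vscal k n.

Definition isotropic (D : R * R -> Prop) (z : R -> R -> R4)
    (f : R -> R -> R) : Prop :=
  smooth D f /\
  forall u v, D (u, v) ->
    0 < f u v /\
    metric z cu cu u v = 0 /\ metric z cv cv u v = 0 /\
    metric z cu cv u v = - (f u v) ^ 2.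

(** With [x = z_u / f] and [y = z_v / f]; [eps] is the sign of K - H^2. *)
Definition canonical (D : R * R -> Prop) (z : R -> R -> R4) : Prop :=
  exists f : R -> R -> R, isotropic D z f /\
  exists n1 n2 : R -> R -> R4,
    unit_normal_field D z n1 /\ collinear_with_H D z n1 /\
    unit_normal_field D z n2 /\
    (forall u v, D (u, v) -> mink (n1 u v) (n2 u v) = 0) /\
  exists lambda mu nu : R -> R -> R,
    smooth D lambda /\ smooth D mu /\ smooth D nu /\
    let x := fun u v => (/ f u v, 0) in
    let y := fun u v => (0, / f u v) in
    forall u v, D (u, v) ->
      let eps := sign (K_minus_H2 z u v) in
      let w := vadd (vscal (lambda u v) (n1 u v)) (vscal (mu u v) (n2 u v)) in
      sff z x x u v = w /\
      sff z x y u v = vscal (- nu u v) (n1 u v) /\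
      sff z y y u v = vscal (- eps) w /\
      mu u v <> 0 /\
      f u v = 1 / sqrt (Rabs (mu u v)).

Definition reparam (z : R -> R -> R4) (phi : R -> R -> R * R) (s t : R) : R4 :=
  z (fst (phi s t)) (snd (phi s t)).

(* Main.v *)
Require Import Defs.
From Stdlib Require Import Reals Lra Lia ClassicalEpsilon.
From Coquelicot Require Import Coquelicot.
Open Scope R_scope.

(** A canonical chart is recovered from its coordinate differentials, and these
    can be written down on the surface without integrating the null directions.

    Let [n1] be the parallel unit normal along H and [n2] the unit normal
    orthogonal to it; since the normal planes are two-dimensional, [n2] is
    parallel as well.  Write h1, h2 for the components of sigma along [n1],
    [n2], and factor the metric as g = 2 m alpha beta with null 1-forms alpha,
    beta and m < 0 ([null_coframe_exists]).  H being collinear with [n1], h2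
    has no trace, so h2 = p alpha^2 + q beta^2 ([coframe_n2_diagonal]).  If
    l, r are the coefficients of alpha^2, beta^2 in h1, the Ricci equation
    ([ricci_equation]) reads l q = r p, and the Gauss equation
    ([gauss_equation]) reads K - H^2 = - (l r + p q) / m^2.  When p or q
    vanishes, these relations and K - H^2 <> 0 force h2 = 0, that is, an
    inflection point; hence p and q have no zeros ([coframe_n2_nonzero]).

    Rescaling alpha by sqrt |p| and beta by sqrt |q| therefore gives a null
    coframe with h2 = eps1 alpha^2 + eps2 beta^2, where eps1 and eps2 are signs.
    The Codazzi equation for h2 says exactly that these two forms are closed
    ([coframe_closed]).  By the Poincare lemma ([poincare]) they are dP and dQ,
    and by the inverse function theorem ([local_inverse]) (P, Q) is a chart.

    In this chart the coordinate vectors are null and h2 = eps1 ds^2 +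
    eps2 dt^2.  With f^2 = - <z_s, z_t>, the component of sigma(x, x) along
    [n2] is eps1 / f^2, which is the condition f = 1 / sqrt |mu|; the Ricci
    equation makes sigma(y, y) equal to eps1 eps2 sigma(x, x), and the Gauss
    equation identifies - eps1 eps2 with the sign of K - H^2
    ([canonical_of_adapted_frame]). *)

(** * Functions of class C^n in the plane *)

Definition Cn (D : R * R -> Prop) (n : nat) (f : R -> R -> R) : Prop :=
  forall u v, D (u, v) -> ex_diff_n f n u v.

Definition part_derivable (f : R -> R -> R) (u v : R) : Prop :=
  ex_derive (fun t => f t v) u /\ ex_derive (fun t => f u t) v.

Lemma open_locally_2d (D : R * R -> Prop) u v :
  open D -> D (u, v) -> locally_2d (fun s t => D (s, t)) u v.
Proof.
  intros HD Huv. apply locally_2d_locally.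
  generalize (HD _ Huv). apply filter_imp. intros [s t]; exact (fun h => h).
Qed.

Lemma open_of_locally_2d (D : R * R -> Prop) :
  (forall u v, D (u, v) -> locally_2d (fun s t => D (s, t)) u v) -> open D.
Proof.
  intros H [u v] Huv. generalize (proj1 (locally_2d_locally _ _ _) (H u v Huv)).
  apply filter_imp. intros [s t]; exact (fun h => h).
Qed.

(** The recursion on the order by which all closure properties of [Cn] are
    proved. *)
Lemma Cn_S D n f :
  Cn D (S n) f <->
  (forall u v, D (u, v) -> continuity_2d_pt f u v /\ part_derivable f u v) /\
  Cn D n (pd cu f) /\ Cn D n (pd cv f).
Proof.
  split.
  - intros H. split; [|split]; intros u v Huv; destruct (H u v Huv) as (H1 & H2 & H3 & H4 & H5);
      repeat split; assumption.
  - intros (H1 & H2 & H3) u v Huv.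
    destruct (H1 u v Huv) as [H4 [H5 H6]].
    repeat split; [assumption | assumption | assumption | apply H2, Huv | apply H3, Huv].
Qed.

Lemma Cn_0 D f : Cn D 0 f <-> (forall u v, D (u, v) -> continuity_2d_pt f u v).
Proof.
  split; intros H u v Huv; [exact (proj1 (H u v Huv)) | split; [exact (H u v Huv) | exact I]].
Qed.

Lemma Cn_le D n m f : (m <= n)%nat -> Cn D n f -> Cn D m f.
Proof. intros Hm H u v Huv. apply (ex_diff_n_m n m Hm). apply H, Huv. Qed.

Lemma Cn_cont D n f : Cn D n f -> forall u v, D (u, v) -> continuity_2d_pt f u v.
Proof. intros H. apply Cn_0. apply (Cn_le D n 0); [lia | exact H]. Qed.

Lemma Cn_ext (D : R * R -> Prop) n f g :
  open D -> (forall u v, D (u, v) -> f u v = g u v) -> Cn D n f -> Cn D n g.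
Proof.
  intros HD Hfg Hf u v Huv. apply ex_diff_n_ext_loc with f; [|exact (Hf u v Huv)].
  destruct (open_locally_2d D u v HD Huv) as [d Hd]. exists d. intros. apply Hfg, Hd; assumption.
Qed.

Lemma pd_plus i f g u v : part_derivable f u v -> part_derivable g u v ->
  pd i (fun s t => f s t + g s t) u v = pd i f u v + pd i g u v.
Proof.
  intros [] []; destruct i; simpl.
  - apply (Derive_plus (fun t => f t v) (fun t => g t v)); assumption.
  - apply (Derive_plus (fun t => f u t) (fun t => g u t)); assumption.
Qed.

Lemma pd_minus i f g u v : part_derivable f u v -> part_derivable g u v ->
  pd i (fun s t => f s t - g s t) u v = pd i f u v - pd i g u v.
Proof.
  intros [] []; destruct i; simpl.
  - apply (Derive_minus (fun t => f t v) (fun t => g t v)); assumption.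
  - apply (Derive_minus (fun t => f u t) (fun t => g u t)); assumption.
Qed.

Lemma pd_mult i f g u v : part_derivable f u v -> part_derivable g u v ->
  pd i (fun s t => f s t * g s t) u v = pd i f u v * g u v + f u v * pd i g u v.
Proof.
  intros [] []; destruct i; simpl.
  - apply (Derive_mult (fun t => f t v) (fun t => g t v)); assumption.
  - apply (Derive_mult (fun t => f u t) (fun t => g u t)); assumption.
Qed.

Lemma pd_const i (c : R) u v : pd i (fun _ _ => c) u v = 0.
Proof. destruct i; simpl; apply Derive_const. Qed.

Lemma pd_inv i f u v : part_derivable f u v -> f u v <> 0 ->
  pd i (fun s t => / f s t) u v = - (pd i f u v * (/ f u v * / f u v)).
Proof.
  intros [] Hn; destruct i; simpl.
  - rewrite (Derive_inv (fun t => f t v)); [field|..]; assumption.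
  - rewrite (Derive_inv (fun t => f u t)); [field|..]; assumption.
Qed.

Lemma pd_sqrt i f u v : part_derivable f u v -> 0 < f u v ->
  pd i (fun s t => sqrt (f s t)) u v = pd i f u v * / (2 * sqrt (f u v)).
Proof.
  intros [[a Ha] [b Hb]] Hp; destruct i; simpl; apply is_derive_unique.
  - replace (Derive (fun t => f t v) u) with a by (symmetry; apply is_derive_unique; exact Ha). apply (is_derive_sqrt (fun t => f t v)); assumption.
  - replace (Derive (fun t => f u t) v) with b by (symmetry; apply is_derive_unique; exact Hb). apply (is_derive_sqrt (fun t => f u t)); assumption.
Qed.

Lemma pd_ext (D : R * R -> Prop) i f g u v :
  open D -> D (u, v) -> (forall s t, D (s, t) -> f s t = g s t) -> pd i f u v = pd i g u v.
Proof.
  intros HD Huv H. generalize (open_locally_2d D u v HD Huv). intros HL.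
  destruct i; simpl; apply Derive_ext_loc.
  - generalize (locally_2d_1d_const_y _ _ _ HL). apply filter_imp. intros t. apply H.
  - generalize (locally_2d_1d_const_x _ _ _ HL). apply filter_imp. intros t. apply H.
Qed.

Lemma part_derivable_plus f g u v : part_derivable f u v -> part_derivable g u v -> part_derivable (fun s t => f s t + g s t) u v.
Proof.
  intros [] []; split.
  - apply (ex_derive_plus (fun t => f t v) (fun t => g t v)); assumption.
  - apply (ex_derive_plus (fun t => f u t) (fun t => g u t)); assumption.
Qed.

Lemma part_derivable_mult f g u v : part_derivable f u v -> part_derivable g u v -> part_derivable (fun s t => f s t * g s t) u v.
Proof.
  intros [] []; split.
  - apply (ex_derive_mult (fun t => f t v) (fun t => g t v)); assumption.
  - apply (ex_derive_mult (fun t => f u t) (fun t => g u t)); assumption.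
Qed.

Lemma pd_scal i k f u v : part_derivable f u v -> pd i (fun s t => k * f s t) u v = k * pd i f u v.
Proof.
  intros Hf. rewrite (pd_mult i (fun _ _ => k) f u v); [|split; apply ex_derive_const|assumption].
  rewrite pd_const. ring.
Qed.

Lemma Cn_const D n c : Cn D n (fun _ _ => c).
Proof.
  revert c. induction n as [|n IH]; intros c.
  - apply Cn_0. intros. apply continuity_2d_pt_const.
  - apply Cn_S. split; [|split].
    + intros. split; [apply continuity_2d_pt_const | split; apply ex_derive_const].
    + intros u v Huv. apply ex_diff_n_ext_loc with (fun _ _ => 0); [|exact (IH 0 u v Huv)].
      exists posreal_one. intros. symmetry. apply (pd_const cu).
    + intros u v Huv. apply ex_diff_n_ext_loc with (fun _ _ => 0); [|exact (IH 0 u v Huv)].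
      exists posreal_one. intros. symmetry. apply (pd_const cv).
Qed.

Lemma Cn_plus D n f g : open D -> Cn D n f -> Cn D n g -> Cn D n (fun s t => f s t + g s t).
Proof.
  intros HD. revert f g. induction n as [|n IH]; intros f g Hf Hg.
  - apply Cn_0. intros u v Huv.
    apply continuity_2d_pt_plus; [apply (proj1 (Cn_0 D f)) | apply (proj1 (Cn_0 D g))]; assumption.
  - apply Cn_S in Hf. apply Cn_S in Hg. destruct Hf as (F1 & F2 & F3), Hg as (G1 & G2 & G3).
    apply Cn_S. split; [|split].
    + intros u v Huv. destruct (F1 u v Huv), (G1 u v Huv).
      split; [apply continuity_2d_pt_plus | apply part_derivable_plus]; assumption.
    + apply Cn_ext with (fun s t => pd cu f s t + pd cu g s t); [assumption| |apply IH; assumption].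
      intros u v Huv. symmetry. apply (pd_plus cu); [apply F1 | apply G1]; assumption.
    + apply Cn_ext with (fun s t => pd cv f s t + pd cv g s t); [assumption| |apply IH; assumption].
      intros u v Huv. symmetry. apply (pd_plus cv); [apply F1 | apply G1]; assumption.
Qed.

Lemma Cn_mult D n f g : open D -> Cn D n f -> Cn D n g -> Cn D n (fun s t => f s t * g s t).
Proof.
  intros HD. revert f g. induction n as [|n IH]; intros f g Hf Hg.
  - apply Cn_0. intros u v Huv.
    apply continuity_2d_pt_mult; [apply (proj1 (Cn_0 D f)) | apply (proj1 (Cn_0 D g))]; assumption.
  - assert (Hf' : Cn D n f) by (apply (Cn_le D (S n)); [lia | assumption]).
    assert (Hg' : Cn D n g) by (apply (Cn_le D (S n)); [lia | assumption]).
    apply Cn_S in Hf. apply Cn_S in Hg. destruct Hf as (F1 & F2 & F3), Hg as (G1 & G2 & G3).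
    apply Cn_S. split; [|split].
    + intros u v Huv. destruct (F1 u v Huv), (G1 u v Huv).
      split; [apply continuity_2d_pt_mult | apply part_derivable_mult]; assumption.
    + apply Cn_ext with (fun s t => pd cu f s t * g s t + f s t * pd cu g s t); [assumption| |].
      * intros u v Huv. symmetry. apply (pd_mult cu); [apply F1 | apply G1]; assumption.
      * apply Cn_plus; [assumption|..]; apply IH; assumption.
    + apply Cn_ext with (fun s t => pd cv f s t * g s t + f s t * pd cv g s t); [assumption| |].
      * intros u v Huv. symmetry. apply (pd_mult cv); [apply F1 | apply G1]; assumption.
      * apply Cn_plus; [assumption|..]; apply IH; assumption.
Qed.

Lemma Cn_opp D n f : open D -> Cn D n f -> Cn D n (fun s t => - f s t).
Proof.
  intros HD Hf. apply Cn_ext with (fun s t => (-1) * f s t); [assumption | intros; ring |].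
  apply (Cn_mult D n (fun _ _ => -1)); [assumption | apply Cn_const | assumption].
Qed.

(** The derivative of 1/f is - f' (1/f)^2, so that regularity of order n of 1/f
    gives order n + 1. *)
Lemma Cn_inv D n f : open D -> (forall u v, D (u, v) -> f u v <> 0) ->
  Cn D n f -> Cn D n (fun s t => / f s t).
Proof.
  intros HD Hn. induction n as [|n IH]; intros Hf.
  - apply Cn_0. intros u v Huv.
    apply continuity_2d_pt_inv; [apply (proj1 (Cn_0 D f)) | apply Hn]; assumption.
  - assert (Hf' : Cn D n f) by (apply (Cn_le D (S n)); [lia | assumption]).
    specialize (IH Hf'). apply Cn_S in Hf. destruct Hf as (F1 & F2 & F3).
    apply Cn_S. split; [|split].
    + intros u v Huv. destruct (F1 u v Huv) as [C [E1 E2]]. split.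
      * apply continuity_2d_pt_inv; [assumption | apply Hn; assumption].
      * split; [apply (ex_derive_inv (fun t => f t v)) | apply (ex_derive_inv (fun t => f u t))];
          try assumption; apply Hn; assumption.
    + apply Cn_ext with (fun s t => - (pd cu f s t * (/ f s t * / f s t))); [assumption| |].
      * intros u v Huv. symmetry. apply (pd_inv cu); [apply F1 | apply Hn]; assumption.
      * apply Cn_opp; [assumption|]. apply Cn_mult; [assumption|assumption|].
        apply Cn_mult; assumption.
    + apply Cn_ext with (fun s t => - (pd cv f s t * (/ f s t * / f s t))); [assumption| |].
      * intros u v Huv. symmetry. apply (pd_inv cv); [apply F1 | apply Hn]; assumption.
      * apply Cn_opp; [assumption|]. apply Cn_mult; [assumption|assumption|].
        apply Cn_mult; assumption.
Qed.

(** Same induction as for the inverse, from the derivative f' / (2 sqrt f). *)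
Lemma Cn_sqrt D n f : open D -> (forall u v, D (u, v) -> 0 < f u v) ->
  Cn D n f -> Cn D n (fun s t => sqrt (f s t)).
Proof.
  intros HD Hn. induction n as [|n IH]; intros Hf.
  - apply Cn_0. intros u v Huv.
    apply continuity_1d_2d_pt_comp; [|apply (proj1 (Cn_0 D f)); assumption].
    apply continuity_pt_sqrt. left; apply Hn; assumption.
  - assert (Hf' : Cn D n f) by (apply (Cn_le D (S n)); [lia | assumption]).
    specialize (IH Hf'). apply Cn_S in Hf. destruct Hf as (F1 & F2 & F3).
    assert (Hi : Cn D n (fun s t => / (2 * sqrt (f s t)))).
    { apply Cn_inv; [assumption| |].
      - intros u v Huv. generalize (sqrt_lt_R0 _ (Hn u v Huv)). lra.
      - apply Cn_mult; [assumption| apply Cn_const | assumption]. }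
    apply Cn_S. split; [|split].
    + intros u v Huv. destruct (F1 u v Huv) as [C [[a Ea] [b Eb]]]. split.
      * apply continuity_1d_2d_pt_comp; [|assumption].
        apply continuity_pt_sqrt. left; apply Hn; assumption.
      * split; eexists; [apply (is_derive_sqrt (fun t => f t v)) | apply (is_derive_sqrt (fun t => f u t))];
          try eassumption; apply Hn; assumption.
    + apply Cn_ext with (fun s t => pd cu f s t * / (2 * sqrt (f s t))); [assumption| |].
      * intros u v Huv. symmetry. apply (pd_sqrt cu); [apply F1 | apply Hn]; assumption.
      * apply Cn_mult; assumption.
    + apply Cn_ext with (fun s t => pd cv f s t * / (2 * sqrt (f s t))); [assumption| |].
      * intros u v Huv. symmetry. apply (pd_sqrt cv); [apply F1 | apply Hn]; assumption.
      * apply Cn_mult; assumption.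
Qed.

Lemma mean_value (g : R -> R) (a b : R) :
  (forall x, Rmin a b <= x <= Rmax a b -> ex_derive g x) ->
  exists c, Rmin a b <= c <= Rmax a b /\ g b - g a = Derive g c * (b - a).
Proof.
  intros H. apply MVT_gen.
  - intros x Hx. apply Derive_correct. apply H. lra.
  - intros x Hx. apply derivable_continuous_pt. apply ex_derive_Reals_0. apply H. exact Hx.
Qed.

Lemma between_Rabs a b c : Rmin a b <= c <= Rmax a b -> Rabs (c - a) <= Rabs (b - a).
Proof. unfold Rmin, Rmax, Rabs. repeat destruct Rle_dec; repeat destruct Rcase_abs; lra. Qed.

(** The increment is split along a horizontal and a vertical segment; each part
    is a value of a partial derivative at a point near (u, v), by the mean value
    theorem. *)
Lemma C1_differentiable f u v :
  locally_2d (fun s t => part_derivable f s t) u v ->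
  continuity_2d_pt (pd cu f) u v -> continuity_2d_pt (pd cv f) u v ->
  differentiable_pt_lim f u v (pd cu f u v) (pd cv f u v).
Proof.
  intros [d0 H0] H1 H2 eps.
  destruct (H1 (pos_div_2 eps)) as [d1 Hd1]. destruct (H2 (pos_div_2 eps)) as [d2 Hd2].
  assert (Hd : 0 < Rmin d0 (Rmin d1 d2)).
  { repeat apply Rmin_pos; apply cond_pos. }
  exists (mkposreal _ Hd). simpl. intros s t Hs Ht.
  assert (Hs' : Rabs (s - u) < d0 /\ Rabs (s - u) < d1 /\ Rabs (s - u) < d2).
  { generalize (Rmin_l d0 (Rmin d1 d2)) (Rmin_r d0 (Rmin d1 d2)) (Rmin_l d1 d2) (Rmin_r d1 d2). lra. }
  assert (Ht' : Rabs (t - v) < d0 /\ Rabs (t - v) < d1 /\ Rabs (t - v) < d2).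
  { generalize (Rmin_l d0 (Rmin d1 d2)) (Rmin_r d0 (Rmin d1 d2)) (Rmin_l d1 d2) (Rmin_r d1 d2). lra. }
  destruct (mean_value (fun x => f x t) u s) as [c [Hc Ec]].
  { intros x Hx. apply (proj1 (H0 x t ltac:(generalize (between_Rabs _ _ _ Hx); lra) (proj1 Ht'))). }
  destruct (mean_value (fun x => f u x) v t) as [e [He Ee]].
  { intros x Hx. refine (proj2 (H0 u x _ _)); [rewrite Rminus_diag, Rabs_R0; apply cond_pos|].
    generalize (between_Rabs _ _ _ Hx). lra. }
  apply between_Rabs in Hc. apply between_Rabs in He.
  match goal with |- Rabs ?X <= _ => replace X with ((pd cu f c t - pd cu f u v) * (s - u) + (pd cv f u e - pd cv f u v) * (t - v)) end.
  2:{ simpl in *. lra. }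
  assert (A1 : Rabs (pd cu f c t - pd cu f u v) < eps / 2) by (apply Hd1; lra).
  assert (A2 : Rabs (pd cv f u e - pd cv f u v) < eps / 2).
  { apply Hd2; [rewrite Rminus_diag, Rabs_R0; apply cond_pos | lra]. }
  eapply Rle_trans; [apply Rabs_triang|]. rewrite !Rabs_mult.
  generalize (Rmax_l (Rabs (s - u)) (Rabs (t - v))) (Rmax_r (Rabs (s - u)) (Rabs (t - v))).
  set (M := Rmax _ _). intros M1 M2.
  generalize (Rabs_pos (s - u)) (Rabs_pos (t - v)) (Rabs_pos (pd cu f c t - pd cu f u v))
     (Rabs_pos (pd cv f u e - pd cv f u v)) (cond_pos eps). intros.
  assert (Rabs (pd cu f c t - pd cu f u v) * Rabs (s - u) <= eps / 2 * M) by (apply Rmult_le_compat; lra).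
  assert (Rabs (pd cv f u e - pd cv f u v) * Rabs (t - v) <= eps / 2 * M) by (apply Rmult_le_compat; lra).
  lra.
Qed.

Lemma Cn_differentiable D n f u v : open D -> Cn D (S n) f -> D (u, v) ->
  differentiable_pt_lim f u v (pd cu f u v) (pd cv f u v).
Proof.
  intros HD Hf Huv. apply Cn_S in Hf. destruct Hf as (F1 & F2 & F3).
  apply C1_differentiable.
  - destruct (open_locally_2d D u v HD Huv) as [d Hd]. exists d. intros. apply F1, Hd; assumption.
  - apply (Cn_cont D n); assumption.
  - apply (Cn_cont D n); assumption.
Qed.

Lemma continuity_2d_comp f g h u v :
  continuity_2d_pt f (g u v) (h u v) -> continuity_2d_pt g u v -> continuity_2d_pt h u v ->
  continuity_2d_pt (fun s t => f (g s t) (h s t)) u v.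
Proof.
  intros Hf Hg Hh eps. destruct (Hf eps) as [d Hd].
  destruct (Hg d) as [d1 H1], (Hh d) as [d2 H2].
  exists (mkposreal _ (Rmin_pos d1 d2 (cond_pos d1) (cond_pos d2))). simpl. intros s t Hs Ht.
  generalize (Rmin_l d1 d2) (Rmin_r d1 d2). intros. apply Hd; [apply H1 | apply H2]; lra.
Qed.

Lemma comp_derive f (g h : R -> R) x lx ly :
  differentiable_pt_lim f (g x) (h x) lx ly -> ex_derive g x -> ex_derive h x ->
  is_derive (fun t => f (g t) (h t)) x (lx * Derive g x + ly * Derive h x).
Proof.
  intros Hf Hg Hh. apply is_derive_Reals. apply derivable_pt_lim_comp_2d; [assumption|..];
  apply is_derive_Reals, Derive_correct; assumption.
Qed.

Lemma part_derivable_of_differentiable f u v lx ly : differentiable_pt_lim f u v lx ly -> part_derivable f u v.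
Proof.
  intros Hf. split; eexists.
  - exact (comp_derive f (fun t => t) (fun _ => v) u lx ly Hf (ex_derive_id u) (ex_derive_const v u)).
  - exact (comp_derive f (fun _ => u) (fun t => t) v lx ly Hf (ex_derive_const u v) (ex_derive_id v)).
Qed.

Lemma part_derivable_comp f g h u v lx ly :
  differentiable_pt_lim f (g u v) (h u v) lx ly -> part_derivable g u v -> part_derivable h u v ->
  part_derivable (fun s t => f (g s t) (h s t)) u v.
Proof.
  intros Hf [G1 G2] [H1 H2]. split; eexists.
  - apply (comp_derive f (fun t => g t v) (fun t => h t v)); eassumption.
  - apply (comp_derive f (fun t => g u t) (fun t => h u t)); eassumption.
Qed.

Lemma pd_comp i f g h u v lx ly :
  differentiable_pt_lim f (g u v) (h u v) lx ly -> part_derivable g u v -> part_derivable h u v ->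
  pd i (fun s t => f (g s t) (h s t)) u v = lx * pd i g u v + ly * pd i h u v.
Proof.
  intros Hf [G1 G2] [H1 H2]. destruct i; simpl; apply is_derive_unique.
  - apply (comp_derive f (fun t => g t v) (fun t => h t v)); assumption.
  - apply (comp_derive f (fun t => g u t) (fun t => h u t)); assumption.
Qed.

(** By the chain rule, the partial derivatives of the composite are sums of
    products of functions of the same kind, one order below. *)
Lemma Cn_comp (V W : R * R -> Prop) n f g h : open V -> open W ->
  (forall s t, W (s, t) -> V (g s t, h s t)) ->
  Cn V n f -> Cn W n g -> Cn W n h -> Cn W n (fun s t => f (g s t) (h s t)).
Proof.
  intros HV HW. revert f g h. induction n as [|n IH]; intros f g h HVW Hf Hg Hh.
  - apply Cn_0. intros u v Huv. apply continuity_2d_comp.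
    + apply (Cn_cont V 0); [assumption | apply HVW; assumption].
    + apply (Cn_cont W 0); assumption.
    + apply (Cn_cont W 0); assumption.
  - assert (Hg' : Cn W n g) by (apply (Cn_le W (S n)); [lia | assumption]).
    assert (Hh' : Cn W n h) by (apply (Cn_le W (S n)); [lia | assumption]).
    assert (Hdf : forall u v, W (u, v) -> differentiable_pt_lim f (g u v) (h u v)
       (pd cu f (g u v) (h u v)) (pd cv f (g u v) (h u v))).
    { intros u v Huv. apply (Cn_differentiable V n); [assumption|assumption|apply HVW; assumption]. }
    apply Cn_S in Hf. apply Cn_S in Hg. apply Cn_S in Hh.
    destruct Hf as (F1 & F2 & F3), Hg as (G1 & G2 & G3), Hh as (H1 & H2 & H3).
    apply Cn_S. split; [|split].
    + intros u v Huv. destruct (G1 u v Huv), (H1 u v Huv). split.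
      * apply continuity_2d_comp; [apply F1, HVW | |]; assumption.
      * eapply part_derivable_comp; [apply Hdf| |]; assumption.
    + apply Cn_ext with (fun s t => pd cu f (g s t) (h s t) * pd cu g s t
                                 + pd cv f (g s t) (h s t) * pd cu h s t); [assumption| |].
      * intros u v Huv. symmetry. apply (pd_comp cu); [apply Hdf|apply G1|apply H1]; assumption.
      * apply Cn_plus; [assumption|..]; (apply Cn_mult; [assumption| |assumption]); apply IH; assumption.
    + apply Cn_ext with (fun s t => pd cu f (g s t) (h s t) * pd cv g s t
                                 + pd cv f (g s t) (h s t) * pd cv h s t); [assumption| |].
      * intros u v Huv. symmetry. apply (pd_comp cv); [apply Hdf|apply G1|apply H1]; assumption.
      * apply Cn_plus; [assumption|..]; (apply Cn_mult; [assumption| |assumption]); apply IH; assumption.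
Qed.

(** * Smooth functions *)

Lemma smooth_ext (D : R * R -> Prop) f g : open D ->
  (forall u v, D (u, v) -> f u v = g u v) -> smooth D f -> smooth D g.
Proof. intros HD H Hf n. apply (Cn_ext D n f g HD H). exact (Hf n). Qed.

Lemma smooth_sub (D D' : R * R -> Prop) f : (forall q, D' q -> D q) -> smooth D f -> smooth D' f.
Proof. intros H Hf n u v Huv. apply Hf, H, Huv. Qed.

Lemma smooth_const D c : smooth D (fun _ _ => c).
Proof. intros n. apply Cn_const. Qed.

Lemma smooth_plus D f g : open D -> smooth D f -> smooth D g -> smooth D (fun s t => f s t + g s t).
Proof. intros HD Hf Hg n. apply Cn_plus; [assumption | exact (Hf n) | exact (Hg n)]. Qed.

Lemma smooth_mult D f g : open D -> smooth D f -> smooth D g -> smooth D (fun s t => f s t * g s t).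
Proof. intros HD Hf Hg n. apply Cn_mult; [assumption | exact (Hf n) | exact (Hg n)]. Qed.

Lemma smooth_opp D f : open D -> smooth D f -> smooth D (fun s t => - f s t).
Proof. intros HD Hf n. apply Cn_opp; [assumption | exact (Hf n)]. Qed.

Lemma smooth_minus D f g : open D -> smooth D f -> smooth D g -> smooth D (fun s t => f s t - g s t).
Proof. intros HD Hf Hg. apply smooth_plus; [| |apply smooth_opp]; assumption. Qed.

Lemma smooth_inv D f : open D -> (forall u v, D (u, v) -> f u v <> 0) ->
  smooth D f -> smooth D (fun s t => / f s t).
Proof. intros HD Hn Hf n. apply Cn_inv; [assumption | assumption | exact (Hf n)]. Qed.

Lemma smooth_div D f g : open D -> (forall u v, D (u, v) -> g u v <> 0) ->
  smooth D f -> smooth D g -> smooth D (fun s t => f s t / g s t).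
Proof. intros HD Hn Hf Hg. apply smooth_mult; [| |apply smooth_inv]; assumption. Qed.

Lemma smooth_sqrt D f : open D -> (forall u v, D (u, v) -> 0 < f u v) ->
  smooth D f -> smooth D (fun s t => sqrt (f s t)).
Proof. intros HD Hn Hf n. apply Cn_sqrt; [assumption | assumption | exact (Hf n)]. Qed.

Lemma smooth_pow D f n : open D -> smooth D f -> smooth D (fun s t => f s t ^ n).
Proof.
  intros HO Hf. induction n as [|n IH]; simpl; [apply smooth_const|].
  apply (smooth_mult D f (fun s t => f s t ^ n)); assumption.
Qed.

Lemma smooth_comp (V W : R * R -> Prop) f g h : open V -> open W ->
  (forall s t, W (s, t) -> V (g s t, h s t)) ->
  smooth V f -> smooth W g -> smooth W h -> smooth W (fun s t => f (g s t) (h s t)).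
Proof. intros HV HW H Hf Hg Hh n. apply (Cn_comp V W); [..|exact (Hf n)|exact (Hg n)|exact (Hh n)]; assumption. Qed.

Lemma smooth_pd D i f : smooth D f -> smooth D (pd i f).
Proof.
  intros Hf n. generalize (proj1 (Cn_S D n f) (Hf (S n))). destruct i; intros (_ & H1 & H2); assumption.
Qed.

Lemma smooth_cont D f u v : smooth D f -> D (u, v) -> continuity_2d_pt f u v.
Proof. intros Hf Huv. exact (Cn_cont D 0 f (Hf 0%nat) u v Huv). Qed.

Lemma smooth_pdble D f u v : smooth D f -> D (u, v) -> part_derivable f u v.
Proof.
  intros Hf Huv. destruct (proj1 (Cn_S D 0 f) (Hf 1%nat)) as (H & _).
  exact (proj2 (H u v Huv)).
Qed.

Lemma smooth_differentiable D f u v : open D -> smooth D f -> D (u, v) ->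
  differentiable_pt_lim f u v (pd cu f u v) (pd cv f u v).
Proof. intros HD Hf Huv. exact (Cn_differentiable D 0 f u v HD (Hf 1%nat) Huv). Qed.

(** The converse of [smooth_pd]: it gives smoothness to functions that are known
    only through their differential, such as potentials. *)
Lemma smooth_of_pd D f :
  (forall u v, D (u, v) -> continuity_2d_pt f u v /\ part_derivable f u v) ->
  smooth D (pd cu f) -> smooth D (pd cv f) -> smooth D f.
Proof.
  intros H H1 H2 n. destruct n as [|n].
  - apply Cn_0. intros; apply H; assumption.
  - apply Cn_S. split; [assumption | split; [exact (H1 n) | exact (H2 n)]].
Qed.

Lemma pd_comm D f u v : open D -> smooth D f -> D (u, v) ->
  pd cu (pd cv f) u v = pd cv (pd cu f) u v.
Proof.
  intros HD Hf Huv.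
  pose proof (smooth_pd D cu f Hf) as Hfu. pose proof (smooth_pd D cv f Hf) as Hfv.
  apply (Schwarz f).
  - destruct (open_locally_2d D u v HD Huv) as [d Hd]. exists d. intros s t Hs Ht.
    specialize (Hd s t Hs Ht).
    exact (conj (proj1 (smooth_pdble D f s t Hf Hd)) (conj (proj2 (smooth_pdble D f s t Hf Hd))
      (conj (proj1 (smooth_pdble D _ s t Hfv Hd)) (proj2 (smooth_pdble D _ s t Hfu Hd))))).
  - apply (smooth_cont D (pd cu (pd cv f))); [apply smooth_pd|]; assumption.
  - apply (smooth_cont D (pd cv (pd cu f))); [apply smooth_pd|]; assumption.
Qed.

Lemma smooth_positive_locally D f u v : smooth D f -> D (u, v) -> 0 < f u v ->
  locally_2d (fun s t => 0 < f s t) u v.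
Proof.
  intros Hf Huv Hp. destruct (smooth_cont D f u v Hf Huv (mkposreal _ Hp)) as [r Hr]. simpl in Hr.
  exists r. intros s t Hs Ht. specialize (Hr s t Hs Ht). apply Rabs_def2 in Hr. lra.
Qed.

Lemma smooth_near D f u v e : smooth D f -> D (u, v) -> 0 < e ->
  locally_2d (fun s t => Rabs (f s t - f u v) <= e) u v.
Proof.
  intros Hf Huv He. destruct (smooth_cont D f u v Hf Huv (mkposreal _ He)) as [r Hr].
  exists r. intros s t Hs Ht. left. exact (Hr s t Hs Ht).
Qed.

Lemma smooth_continuous D f u v : smooth D f -> D (u, v) ->
  continuous (fun s => f s v) u /\ continuous (fun t => f u t) v.
Proof.
  intros Hf Huv. destruct (smooth_pdble D f u v Hf Huv) as [H1 H2].
  split; [exact (ex_derive_continuous _ _ H1)|exact (ex_derive_continuous _ _ H2)].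
Qed.

(** Follows the shape of the expression; what is left to prove is that
    denominators do not vanish and that radicands are positive. *)
Ltac smooth_tac :=
  lazymatch goal with
  | |- smooth _ (fun _ _ => ?c) => apply smooth_const
  | |- smooth ?D (fun s t => @?f s t + @?g s t) =>
      apply (smooth_plus D f g); [assumption|cbv beta; smooth_tac|cbv beta; smooth_tac]
  | |- smooth ?D (fun s t => @?f s t - @?g s t) =>
      apply (smooth_minus D f g); [assumption|cbv beta; smooth_tac|cbv beta; smooth_tac]
  | |- smooth ?D (fun s t => @?f s t * @?g s t) =>
      apply (smooth_mult D f g); [assumption|cbv beta; smooth_tac|cbv beta; smooth_tac]
  | |- smooth ?D (fun s t => @?f s t / @?g s t) =>
      apply (smooth_div D f g); [assumption| |cbv beta; smooth_tac|cbv beta; smooth_tac]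
  | |- smooth ?D (fun s t => - @?f s t) =>
      apply (smooth_opp D f); [assumption|cbv beta; smooth_tac]
  | |- smooth ?D (fun s t => (@?f s t) ^ ?n) =>
      apply (smooth_pow D f n); [assumption|cbv beta; smooth_tac]
  | |- smooth ?D (fun s t => sqrt (@?f s t)) =>
      apply (smooth_sqrt D f); [assumption| |cbv beta; smooth_tac]
  | |- _ => try assumption
  end.

(** * Boxes *)

Definition box (u0 v0 r : R) (q : R * R) : Prop :=
  Rabs (fst q - u0) < r /\ Rabs (snd q - v0) < r.

Lemma box_open u0 v0 r : open (box u0 v0 r).
Proof.
  apply open_of_locally_2d. intros u v [Hu Hv]. simpl in *.
  assert (Hd : 0 < Rmin (r - Rabs (u - u0)) (r - Rabs (v - v0))) by (apply Rmin_pos; lra).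
  exists (mkposreal _ Hd). simpl. intros s t Hs Ht.
  generalize (Rmin_l (r - Rabs (u - u0)) (r - Rabs (v - v0)))
    (Rmin_r (r - Rabs (u - u0)) (r - Rabs (v - v0))). intros.
  split; simpl.
  - replace (s - u0) with ((s - u) + (u - u0)) by ring. generalize (Rabs_triang (s - u) (u - u0)). lra.
  - replace (t - v0) with ((t - v) + (v - v0)) by ring. generalize (Rabs_triang (t - v) (v - v0)). lra.
Qed.

Lemma box_center u0 v0 r : 0 < r -> box u0 v0 r (u0, v0).
Proof. intros Hr. split; simpl; rewrite Rminus_diag, Rabs_R0; assumption. Qed.

Lemma locally_2d_box P u0 v0 :
  locally_2d P u0 v0 -> exists r, 0 < r /\ forall u v, box u0 v0 r (u, v) -> P u v.
Proof. intros [r Hr]. exists r. split; [apply cond_pos|]. intros u v [H1 H2]. apply Hr; assumption. Qed.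

Lemma box_horizontal u0 v0 r u v t : box u0 v0 r (u, v) -> Rmin v0 v <= t <= Rmax v0 v ->
  box u0 v0 r (u, t).
Proof. intros [H1 H2] Ht. apply between_Rabs in Ht. simpl in *. split; simpl; lra. Qed.

Lemma box_vertical u0 v0 r u s : box u0 v0 r (u, v0) -> Rmin u0 u <= s <= Rmax u0 u ->
  box u0 v0 r (s, v0).
Proof. intros [H1 H2] Ht. apply between_Rabs in Ht. simpl in *. split; simpl; lra. Qed.

(** If two disjoint open sets covered the box, the indicator function of one of
    them along the segment joining a point of each would have zero derivative,
    hence equal values at both ends. *)
Lemma box_connected u0 v0 r : connected (box u0 v0 r).
Proof.
  intros A B HA HB HAB [[u1 v1] [D1 A1]] [[u2 v2] [D2 B2]].
  apply NNPP. intros Hno.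
  assert (Hdis : forall q, box u0 v0 r q -> A q -> B q -> False) by (intros q Hq Ha Hb; apply Hno; exists q; auto).
  set (g := fun t => if excluded_middle_informative (A (u1 + t * (u2 - u1), v1 + t * (v2 - v1))) then 1 else 0).
  assert (Hseg : forall t, 0 <= t <= 1 -> box u0 v0 r (u1 + t * (u2 - u1), v1 + t * (v2 - v1))).
  { assert (Hconv : forall x y t c, Rabs (x - c) < r -> Rabs (y - c) < r -> 0 <= t <= 1 ->
      Rabs (x + t * (y - x) - c) < r).
    { intros x y t c Hx Hy Ht.
      replace (x + t * (y - x) - c) with ((1 - t) * (x - c) + t * (y - c)) by ring.
      eapply Rle_lt_trans; [apply Rabs_triang|]. rewrite !Rabs_mult, (Rabs_right t), (Rabs_right (1 - t)) by lra.
      destruct (Rle_or_lt t (/ 2)); nra. }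
    destruct D1, D2. intros t Ht. split; apply Hconv; assumption. }
  assert (Hcont : forall t (S : R * R -> Prop), open S ->
     S (u1 + t * (u2 - u1), v1 + t * (v2 - v1)) ->
     locally t (fun x => S (u1 + x * (u2 - u1), v1 + x * (v2 - v1)))).
  { intros t S HS Ht.
    destruct (open_locally_2d S _ _ HS Ht) as [e He].
    (* The segment is Lipschitz with constant K. *)
    set (K := 1 + Rabs (u2 - u1) + Rabs (v2 - v1)).
    assert (HK : 1 <= K) by (unfold K; generalize (Rabs_pos (u2 - u1)) (Rabs_pos (v2 - v1)); lra).
    assert (Hd : 0 < e / K) by (apply Rdiv_lt_0_compat; [apply cond_pos|lra]).
    exists (mkposreal _ Hd). intros x Hx. change (Rabs (x - t) < e / K) in Hx.
    assert (Hx' : Rabs (x - t) * K < e).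
    { apply (Rmult_lt_compat_r K) in Hx; [|lra]. replace (e / K * K) with (pos e) in Hx by (field; lra). assumption. }
    generalize (Rabs_pos (u2 - u1)) (Rabs_pos (v2 - v1)) (Rabs_pos (x - t)); intros.
    apply He.
    - replace (u1 + x * (u2 - u1) - (u1 + t * (u2 - u1))) with ((x - t) * (u2 - u1)) by ring.
      rewrite Rabs_mult. unfold K in *. nra.
    - replace (v1 + x * (v2 - v1) - (v1 + t * (v2 - v1))) with ((x - t) * (v2 - v1)) by ring.
      rewrite Rabs_mult. unfold K in *. nra. }
  assert (Hder : forall t, 0 <= t <= 1 -> is_derive g t zero).
  { intros t Ht. destruct (HAB _ (Hseg t Ht)) as [Hin|Hin].
    - apply is_derive_ext_loc with (fun _ => 1); [|apply (is_derive_const (K := R_AbsRing) (V := R_NormedModule))].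
      generalize (Hcont t A HA Hin). apply filter_imp. intros x Hx. unfold g.
      destruct excluded_middle_informative; [reflexivity|contradiction].
    - apply is_derive_ext_loc with (fun _ => 0); [|apply (is_derive_const (K := R_AbsRing) (V := R_NormedModule))].
      generalize (filter_and _ _ (Hcont t B HB Hin) (Hcont t _ (box_open u0 v0 r) (Hseg t Ht))).
      apply filter_imp. intros x [Hx Hx']. unfold g.
      destruct excluded_middle_informative; [exfalso; eapply Hdis; eassumption|reflexivity]. }
  pose proof (eq_is_derive (V := R_NormedModule) g 0 1 Hder Rlt_0_1) as E.
  unfold g in E. replace (u1 + 0 * (u2 - u1)) with u1 in E by ring. replace (v1 + 0 * (v2 - v1)) with v1 in E by ring.
  replace (u1 + 1 * (u2 - u1)) with u2 in E by ring. replace (v1 + 1 * (v2 - v1)) with v2 in E by ring.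
  destruct excluded_middle_informative; [|contradiction].
  destruct excluded_middle_informative; [eapply Hdis; eassumption|]. lra.
Qed.

(** * The Poincare lemma on a box *)

(** The potential is the integral of a du + b dv along the path that is first
    horizontal, then vertical.  Its derivative in v is clear; in its derivative
    in u, closedness turns the integral of b_u into that of a_v, an increment
    of a. *)
Lemma poincare u0 v0 r a b : smooth (box u0 v0 r) a -> smooth (box u0 v0 r) b ->
  (forall u v, box u0 v0 r (u, v) -> pd cv a u v = pd cu b u v) ->
  exists P, smooth (box u0 v0 r) P /\
    forall u v, box u0 v0 r (u, v) -> pd cu P u v = a u v /\ pd cv P u v = b u v.
Proof.
  set (B := box u0 v0 r). intros Sa Sb Hab. pose proof (box_open u0 v0 r) as HO. fold B in HO.
  set (P := fun u v => RInt (fun s => a s v0) u0 u + RInt (fun t => b u t) v0 v).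
  assert (Hflat : forall u v, B (u, v) -> B (u, v0)).
  { intros u v Huv. apply (box_horizontal u0 v0 r u v); [assumption|]. split; [apply Rmin_l|apply Rmax_l]. }
  assert (Ia : forall u v, B (u, v) -> ex_RInt (fun s => a s v0) u0 u).
  { intros u v Huv. apply (ex_RInt_continuous (V := R_CompleteNormedModule)). intros s Hs.
    apply (smooth_continuous B a s v0 Sa). apply (box_vertical u0 v0 r u); [apply (Hflat u v)|]; assumption. }
  assert (Ib : forall u v, B (u, v) -> ex_RInt (fun t => b u t) v0 v).
  { intros u v Huv. apply (ex_RInt_continuous (V := R_CompleteNormedModule)). intros s Hs.
    apply (smooth_continuous B b u s Sb). apply (box_horizontal u0 v0 r u v); assumption. }
  assert (Lu : forall u v, B (u, v) -> locally u (fun s => B (s, v))).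
  { intros u v Huv. exact (locally_2d_1d_const_y _ _ _ (open_locally_2d B u v HO Huv)). }
  assert (Lv : forall u v, B (u, v) -> locally v (fun t => B (u, t))).
  { intros u v Huv. exact (locally_2d_1d_const_x _ _ _ (open_locally_2d B u v HO Huv)). }
  assert (Dv : forall u v, B (u, v) -> is_derive (fun t => P u t) v (b u v)).
  { intros u v Huv. unfold P.
    replace (b u v) with (plus 0 (b u v)) by (unfold plus; simpl; ring).
    apply (is_derive_plus (fun _ => RInt (fun s => a s v0) u0 u) (fun t => RInt (fun x => b u x) v0 t)).
    - apply (is_derive_const (K := R_AbsRing) (V := R_NormedModule)).
    - apply (is_derive_RInt (fun t => b u t) _ v0).
      + generalize (Lv u v Huv). apply filter_imp. intros t Ht. apply (RInt_correct (V := R_CompleteNormedModule)).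
        apply (Ib u t Ht).
      + apply (smooth_continuous B b u v Sb Huv). }
  assert (Du : forall u v, B (u, v) -> is_derive (fun s => P s v) u (a u v)).
  { intros u v Huv. unfold P.
    assert (E : RInt (fun t => Derive (fun s => b s t) u) v0 v = a u v - a u v0).
    { rewrite (RInt_ext _ (Derive (fun t => a u t))).
      - apply RInt_Derive.
        + intros t Ht. apply (smooth_pdble B a u t Sa). apply (box_horizontal u0 v0 r u v); assumption.
        + intros t Ht. apply (smooth_continuous B (pd cv a) u t (smooth_pd B cv a Sa)).
          apply (box_horizontal u0 v0 r u v); assumption.
      - intros t Ht. symmetry. apply Hab. apply (box_horizontal u0 v0 r u v); [assumption|]. 
        split; apply Rlt_le, Ht. }
    replace (a u v) with (plus (a u v0) (RInt (fun t => Derive (fun s => b s t) u) v0 v))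
      by (rewrite E; unfold plus; simpl; ring).
    apply (is_derive_plus (fun x => RInt (fun s => a s v0) u0 x) (fun x => RInt (fun t => b x t) v0 v)).
    - apply (is_derive_RInt (fun s => a s v0) _ u0).
      + generalize (Lu u v Huv). apply filter_imp. intros s Hs. apply (RInt_correct (V := R_CompleteNormedModule)).
        apply (Ia s v Hs).
      + apply (smooth_continuous B a u v0 Sa). apply (Hflat u v Huv).
    - apply (is_derive_RInt_param (fun x t => b x t) v0 v u).
      + generalize (Lu u v Huv). apply filter_imp. intros s Hs t Ht.
        apply (smooth_pdble B b s t Sb). apply (box_horizontal u0 v0 r s v); assumption.
      + intros t Ht. apply (smooth_cont B (pd cu b) u t (smooth_pd B cu b Sb)).
        apply (box_horizontal u0 v0 r u v); assumption.
      + generalize (Lu u v Huv). apply filter_imp. intros s Hs. apply (Ib s v Hs). }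
  assert (PP : forall u v, B (u, v) -> part_derivable P u v).
  { intros u v Huv. split; [exists (a u v); apply Du|exists (b u v); apply Dv]; assumption. }
  assert (PE : forall u v, B (u, v) -> pd cu P u v = a u v /\ pd cv P u v = b u v).
  { intros u v Huv. split; apply is_derive_unique; [apply Du|apply Dv]; assumption. }
  exists P. split; [|exact PE].
  assert (SPu : smooth B (pd cu P)) by exact (smooth_ext B a _ HO (fun u v Huv => eq_sym (proj1 (PE u v Huv))) Sa).
  assert (SPv : smooth B (pd cv P)) by exact (smooth_ext B b _ HO (fun u v Huv => eq_sym (proj2 (PE u v Huv))) Sb).
  apply smooth_of_pd; [|assumption|assumption].
  intros u v Huv. split; [|exact (PP u v Huv)].
  apply differentiable_continuity_pt. eexists _, _. apply C1_differentiable.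
  - destruct (open_locally_2d B u v HO Huv) as [e He]. exists e. intros s t Hs Ht. exact (PP s t (He s t Hs Ht)).
  - exact (smooth_cont B _ u v SPu Huv).
  - exact (smooth_cont B _ u v SPv Huv).
Qed.

(** * The inverse function theorem in the plane *)

Lemma geometric_limit (x : nat -> R) (C : R) :
  (forall k, Rabs (x (S k) - x k) <= C * (/ 2) ^ k) -> exists l : R, is_lim_seq x l.
Proof.
  intros H.
  assert (Hs : ex_series (fun k => x (S k) - x k)).
  { apply (ex_series_le (K := R_AbsRing) (V := R_CompleteNormedModule) _ (fun k => C * (/ 2) ^ k)); [exact H|].
    apply (ex_series_scal (K := R_AbsRing) (V := R_NormedModule) C (fun k => (/ 2) ^ k)).
    apply ex_series_geom. rewrite Rabs_right; lra. }
  destruct Hs as [l Hl]. exists (l + x 0%nat). apply is_lim_seq_incr_1.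
  apply is_lim_seq_ext with (fun n => sum_n (fun k => x (S k) - x k) n + x 0%nat).
  - intros n. induction n as [|n IH]; [rewrite sum_O; ring|].
    rewrite sum_Sn. unfold plus; simpl. lra.
  - apply (is_lim_seq_plus' _ _ l (x 0%nat)); [exact Hl|apply is_lim_seq_const].
Qed.

(** Going from (u, v) to (s, t) along two segments, each contributes at most a
    quarter of the sup-norm distance.  The sum of the identity and of such a
    perturbation (g, h) is therefore injective. *)
Lemma small_gradient u0 v0 r g : smooth (box u0 v0 r) g ->
  (forall u v, box u0 v0 r (u, v) -> Rabs (pd cu g u v) <= / 4 /\ Rabs (pd cv g u v) <= / 4) ->
  forall u v s t, box u0 v0 r (u, v) -> box u0 v0 r (s, t) ->
  Rabs (g s t - g u v) <= / 2 * Rmax (Rabs (s - u)) (Rabs (t - v)).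
Proof.
  intros Sg Hg u v s t Huv Hst.
  assert (Hseg : forall a b x c, Rabs (a - c) < r -> Rabs (b - c) < r -> Rmin a b <= x <= Rmax a b -> Rabs (x - c) < r).
  { intros a b x c Ha Hb Hx. apply Rabs_def2 in Ha. apply Rabs_def2 in Hb. unfold Rmin, Rmax in Hx.
    apply Rabs_def1; destruct Rle_dec; lra. }
  destruct Huv as [U1 U2], Hst as [S1 S2]. simpl in *.
  destruct (mean_value (fun x => g x t) u s) as [c [Hc Ec]].
  { intros x Hx. apply (smooth_pdble _ g x t Sg). split; simpl; [apply (Hseg u s)|]; assumption. }
  destruct (mean_value (fun x => g u x) v t) as [e [He Ee]].
  { intros x Hx. apply (smooth_pdble _ g u x Sg). split; simpl; [|apply (Hseg v t)]; assumption. }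
  assert (B1 : Rabs (pd cu g c t) <= / 4) by (apply Hg; split; simpl; [apply (Hseg u s)|]; assumption).
  assert (B2 : Rabs (pd cv g u e) <= / 4) by (apply Hg; split; simpl; [|apply (Hseg v t)]; assumption).
  replace (g s t - g u v) with (pd cu g c t * (s - u) + pd cv g u e * (t - v)) by (simpl in *; lra).
  eapply Rle_trans; [apply Rabs_triang|]. rewrite !Rabs_mult.
  generalize (Rmax_l (Rabs (s - u)) (Rabs (t - v))) (Rmax_r (Rabs (s - u)) (Rabs (t - v))).
  generalize (Rabs_pos (s - u)) (Rabs_pos (t - v)) (Rabs_pos (pd cu g c t)) (Rabs_pos (pd cv g u e)).
  set (M := Rmax _ _). intros. 
  assert (Rabs (pd cu g c t) * Rabs (s - u) <= / 4 * M) by (apply Rmult_le_compat; lra).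
  assert (Rabs (pd cv g u e) * Rabs (t - v) <= / 4 * M) by (apply Rmult_le_compat; lra).
  lra.
Qed.

(** Picard iteration for (u, v) = (y1 - g, y2 - h), a contraction of ratio 1/2
    in the sup norm.  A first step smaller than r / 4 keeps all the iterates
    within r / 2 of the centre, so that the limit lies in the open box. *)
Lemma small_solution u0 v0 r g h y1 y2 : 0 < r ->
  smooth (box u0 v0 r) g -> smooth (box u0 v0 r) h ->
  (forall u v, box u0 v0 r (u, v) -> Rabs (pd cu g u v) <= / 4 /\ Rabs (pd cv g u v) <= / 4) ->
  (forall u v, box u0 v0 r (u, v) -> Rabs (pd cu h u v) <= / 4 /\ Rabs (pd cv h u v) <= / 4) ->
  Rabs (u0 + g u0 v0 - y1) < r / 4 -> Rabs (v0 + h u0 v0 - y2) < r / 4 ->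
  exists u v, box u0 v0 r (u, v) /\ u + g u v = y1 /\ v + h u v = y2.
Proof.
  intros Hr Sg Sh Hg Hh H1 H2.
  pose (F := fun q : R * R => (y1 - g (fst q) (snd q), y2 - h (fst q) (snd q))).
  pose (x := fix x (k : nat) : R * R := match k with O => (u0, v0) | S k => F (x k) end).
  set (B := box u0 v0 r) in *.
  assert (Hstep : forall k, B (x k) /\
     (Rabs (fst (x k) - u0) <= r / 2 * (1 - (/ 2) ^ k) /\ Rabs (snd (x k) - v0) <= r / 2 * (1 - (/ 2) ^ k)) /\
     (Rabs (fst (x (S k)) - fst (x k)) <= r / 4 * (/ 2) ^ k /\
      Rabs (snd (x (S k)) - snd (x k)) <= r / 4 * (/ 2) ^ k)).
  { induction k as [|k IH].
    - split; [apply box_center; assumption|]. simpl. rewrite !Rminus_diag, Rabs_R0.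
      split; [split; lra|]. split.
      + rewrite Rabs_minus_sym. replace (u0 - (y1 - g u0 v0)) with (u0 + g u0 v0 - y1) by ring. lra.
      + rewrite Rabs_minus_sym. replace (v0 - (y2 - h u0 v0)) with (v0 + h u0 v0 - y2) by ring. lra.
    - destruct IH as (B0 & (P1 & P2) & (Q1 & Q2)).
      assert (Hp : 0 < (/ 2) ^ k) by (apply pow_lt; lra).
      assert (R1 : Rabs (fst (x (S k)) - u0) <= r / 2 * (1 - (/ 2) ^ (S k))).
      { replace (fst (x (S k)) - u0) with ((fst (x (S k)) - fst (x k)) + (fst (x k) - u0)) by ring.
        eapply Rle_trans; [apply Rabs_triang|]. simpl ((/ 2) ^ S k). lra. }
      assert (R2 : Rabs (snd (x (S k)) - v0) <= r / 2 * (1 - (/ 2) ^ (S k))).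
      { replace (snd (x (S k)) - v0) with ((snd (x (S k)) - snd (x k)) + (snd (x k) - v0)) by ring.
        eapply Rle_trans; [apply Rabs_triang|]. simpl ((/ 2) ^ S k). lra. }
      assert (Hp' : 0 < (/ 2) ^ (S k)) by (apply pow_lt; lra).
      assert (B1 : B (x (S k))) by (split; nra).
      split; [assumption|split; [split; assumption|]].
      assert (Hmax : Rmax (Rabs (fst (x (S k)) - fst (x k))) (Rabs (snd (x (S k)) - snd (x k))) <= r / 4 * (/ 2) ^ k)
        by (apply Rmax_lub; assumption).
      pose proof (small_gradient u0 v0 r g Sg Hg (fst (x k)) (snd (x k)) (fst (x (S k))) (snd (x (S k)))) as G1.
      pose proof (small_gradient u0 v0 r h Sh Hh (fst (x k)) (snd (x k)) (fst (x (S k))) (snd (x (S k)))) as G2.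
      rewrite <- !surjective_pairing in G1, G2. specialize (G1 B0 B1). specialize (G2 B0 B1).
      change (x (S (S k))) with (F (x (S k))).
      replace (fst (F (x (S k))) - fst (x (S k))) with (- (g (fst (x (S k))) (snd (x (S k))) - g (fst (x k)) (snd (x k))))
        by (simpl; ring).
      replace (snd (F (x (S k))) - snd (x (S k))) with (- (h (fst (x (S k))) (snd (x (S k))) - h (fst (x k)) (snd (x k))))
        by (simpl; ring).
      rewrite !Rabs_Ropp. simpl ((/ 2) ^ S k). lra. }
  destruct (geometric_limit (fun k => fst (x k)) (r / 4) (fun k => proj1 (proj2 (proj2 (Hstep k))))) as [u Hu].
  destruct (geometric_limit (fun k => snd (x k)) (r / 4) (fun k => proj2 (proj2 (proj2 (Hstep k))))) as [v Hv].
  assert (Hbound : forall (w : nat -> R) (l c : R), is_lim_seq w l -> (forall k, Rabs (w k - c) <= r / 2) -> Rabs (l - c) <= r / 2).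
  { intros w l c Hw Hc.
    apply (is_lim_seq_le (fun k => Rabs (w k - c)) (fun _ => r / 2) (Rabs (l - c)) (r / 2)); [assumption| |apply is_lim_seq_const].
    apply (is_lim_seq_abs (fun k => w k - c) (l - c)). apply is_lim_seq_minus'; [assumption|apply is_lim_seq_const]. }
  assert (HB : B (u, v)).
  { assert (Rabs (u - u0) <= r / 2).
    { apply (Hbound (fun k => fst (x k))); [assumption|]. intros k. destruct (Hstep k) as (_ & (P1 & _) & _).
      assert (0 < (/ 2) ^ k) by (apply pow_lt; lra). nra. }
    assert (Rabs (v - v0) <= r / 2).
    { apply (Hbound (fun k => snd (x k))); [assumption|]. intros k. destruct (Hstep k) as (_ & (_ & P1) & _).
      assert (0 < (/ 2) ^ k) by (apply pow_lt; lra). nra. }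
    split; simpl; lra. }
  assert (Hlim : forall f, smooth B f -> is_lim_seq (fun k => f (fst (x k)) (snd (x k))) (f u v)).
  { intros f Sf.
    apply (filterlim_comp_2 (F := eventually) (G := locally u) (H := locally v) (I := locally (f u v)) (fun k => fst (x k)) (fun k => snd (x k)) f Hu Hv).
    intros S HS. 
    destruct HS as [e He]. destruct (smooth_cont B f u v Sf HB e) as [d Hd].
    exists (fun s => Rabs (s - u) < d) (fun t => Rabs (t - v) < d); [exists d; auto|exists d; auto|].
    intros s t Hs Ht. exact (He _ (Hd s t Hs Ht)). }
  exists u, v. split; [assumption|]. split.
  - pose proof (is_lim_seq_unique _ _ (proj1 (is_lim_seq_incr_1 _ _) Hu)) as E1.
    pose proof (is_lim_seq_unique _ _ (is_lim_seq_minus' (fun _ => y1) _ y1 _ (is_lim_seq_const y1) (Hlim g Sg))) as E2.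
    assert (E : Finite u = Finite (y1 - g u v)) by (rewrite <- E1, <- E2; reflexivity).
    injection E. lra.
  - pose proof (is_lim_seq_unique _ _ (proj1 (is_lim_seq_incr_1 _ _) Hv)) as E1.
    pose proof (is_lim_seq_unique _ _ (is_lim_seq_minus' (fun _ => y2) _ y2 _ (is_lim_seq_const y2) (Hlim h Sh))) as E2.
    assert (E : Finite v = Finite (y2 - h u v)) by (rewrite <- E1, <- E2; reflexivity).
    injection E. lra.
Qed.

(** When the differential of (g, h) is a smooth function of (g, h) itself, each
    order of regularity implies the next. *)
Lemma inverse_smooth (V W : R * R -> Prop) g h A1 A2 B1 B2 : open V -> open W ->
  (forall s t, W (s, t) -> V (g s t, h s t)) ->
  smooth V A1 -> smooth V A2 -> smooth V B1 -> smooth V B2 ->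
  (forall s t, W (s, t) -> differentiable_pt_lim g s t (A1 (g s t) (h s t)) (A2 (g s t) (h s t)) /\
    differentiable_pt_lim h s t (B1 (g s t) (h s t)) (B2 (g s t) (h s t))) ->
  smooth W g /\ smooth W h.
Proof.
  intros HV HW HVW SA1 SA2 SB1 SB2 Hd.
  assert (H : forall n, Cn W n g /\ Cn W n h).
  { induction n as [|n [IHg IHh]].
    - split; apply Cn_0; intros s t Hst; apply differentiable_continuity_pt; eexists _, _;
        [exact (proj1 (Hd s t Hst))|exact (proj2 (Hd s t Hst))].
    - assert (K : forall f, smooth V f -> Cn W n (fun s t => f (g s t) (h s t))).
      { intros f Hf. exact (Cn_comp V W n f g h HV HW HVW (Hf n) IHg IHh). }
      split; apply Cn_S; (split; [|split]).
      + intros s t Hst. destruct (Hd s t Hst) as [H1 _]. split.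
        * apply differentiable_continuity_pt; eexists _, _; exact H1.
        * exact (part_derivable_of_differentiable _ _ _ _ _ H1).
      + apply (Cn_ext W n _ _ HW) with (2 := K A1 SA1).
        intros s t Hst. symmetry. exact (proj1 (differentiable_pt_lim_unique _ _ _ _ _ (proj1 (Hd s t Hst)))).
      + apply (Cn_ext W n _ _ HW) with (2 := K A2 SA2).
        intros s t Hst. symmetry. exact (proj2 (differentiable_pt_lim_unique _ _ _ _ _ (proj1 (Hd s t Hst)))).
      + intros s t Hst. destruct (Hd s t Hst) as [_ H1]. split.
        * apply differentiable_continuity_pt; eexists _, _; exact H1.
        * exact (part_derivable_of_differentiable _ _ _ _ _ H1).
      + apply (Cn_ext W n _ _ HW) with (2 := K B1 SB1).
        intros s t Hst. symmetry. exact (proj1 (differentiable_pt_lim_unique _ _ _ _ _ (proj2 (Hd s t Hst)))).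
      + apply (Cn_ext W n _ _ HW) with (2 := K B2 SB2).
        intros s t Hst. symmetry. exact (proj2 (differentiable_pt_lim_unique _ _ _ _ _ (proj2 (Hd s t Hst)))). }
  split; intros n; apply H.
Qed.

(** By the Lipschitz bound, the remainders of P and Q are negligible with respect
    to the displacement of (s, t); it remains to solve the 2 x 2 linear system
    given by their differentials. *)
Lemma inverse_differentiable P Q g h s0 t0 a b c d K :
  differentiable_pt_lim P (g s0 t0) (h s0 t0) a b ->
  differentiable_pt_lim Q (g s0 t0) (h s0 t0) c d ->
  a * d - b * c <> 0 ->
  locally_2d (fun s t => P (g s t) (h s t) = s /\ Q (g s t) (h s t) = t /\
    Rabs (g s t - g s0 t0) <= K * Rmax (Rabs (s - s0)) (Rabs (t - t0)) /\
    Rabs (h s t - h s0 t0) <= K * Rmax (Rabs (s - s0)) (Rabs (t - t0))) s0 t0 ->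
  differentiable_pt_lim g s0 t0 (d / (a * d - b * c)) (- b / (a * d - b * c)) /\
  differentiable_pt_lim h s0 t0 (- c / (a * d - b * c)) (a / (a * d - b * c)).
Proof.
  intros HP HQ HJ Hloc.
  set (J := a * d - b * c) in *. set (u := g s0 t0) in *. set (v := h s0 t0) in *.
  pose proof (locally_2d_singleton _ _ _ Hloc) as (P0 & Q0 & _). fold u v in P0, Q0.
  (* Both errors are combinations of the remainders of P and Q, with the entries
     of the inverse matrix as coefficients al and be. *)
  assert (Main : forall (f : R -> R -> R) al be w,
    (forall s t, f s t - w =
       al * (P (g s t) (h s t) - P u v - (a * (g s t - u) + b * (h s t - v))) + be * (Q (g s t) (h s t) - Q u v - (c * (g s t - u) + d * (h s t - v)))) ->
    forall eps : posreal, locally_2d (fun s t => Rabs (f s t - w) <= eps * Rmax (Rabs (s - s0)) (Rabs (t - t0))) s0 t0).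
  { intros f al be w Hf eps.
    set (L := Rabs K + 1). set (M := (Rabs al + Rabs be + 1) * L).
    assert (HL : 0 < L) by (unfold L; generalize (Rabs_pos K); lra).
    assert (HM : 0 < M).
    { unfold M. apply Rmult_lt_0_compat; [|assumption]. generalize (Rabs_pos al) (Rabs_pos be). lra. }
    assert (He : 0 < eps / M) by (apply Rdiv_lt_0_compat; [apply cond_pos|assumption]).
    destruct (HP (mkposreal _ He)) as [d1 H1]. destruct (HQ (mkposreal _ He)) as [d2 H2].
    destruct Hloc as [d3 H3]. simpl in H1, H2.
    assert (Hd : 0 < Rmin d3 (Rmin d1 d2 / L)).
    { apply Rmin_pos; [apply cond_pos|]. apply Rdiv_lt_0_compat; [apply Rmin_pos; apply cond_pos|assumption]. }
    exists (mkposreal _ Hd). simpl. intros s t Hs Ht.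
    generalize (Rmin_l d3 (Rmin d1 d2 / L)) (Rmin_r d3 (Rmin d1 d2 / L)) (Rmin_l d1 d2) (Rmin_r d1 d2).
    intros M1 M2 M3 M4.
    destruct (H3 s t) as (_ & _ & G1 & G2); [lra|lra|].
    set (X := Rmax (Rabs (s - s0)) (Rabs (t - t0))) in *.
    assert (HX : 0 <= X) by (unfold X; apply Rle_trans with (Rabs (s - s0)); [apply Rabs_pos|apply Rmax_l]).
    assert (HX' : X < Rmin d1 d2 / L) by (unfold X; apply Rmax_lub_lt; lra).
    assert (HLX : L * X < Rmin d1 d2).
    { apply (Rmult_lt_compat_l L) in HX'; [|assumption].
      replace (L * (Rmin d1 d2 / L)) with (Rmin d1 d2) in HX' by (field; lra). assumption. }
    assert (HKX : K * X <= L * X).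
    { apply Rmult_le_compat_r; [assumption|]. unfold L. generalize (Rle_abs K). lra. }
    fold u in G1. fold v in G2.
    specialize (H1 (g s t) (h s t) ltac:(lra) ltac:(lra)).
    specialize (H2 (g s t) (h s t) ltac:(lra) ltac:(lra)).
    set (Y := Rmax (Rabs (g s t - u)) (Rabs (h s t - v))) in *.
    assert (HY : Y <= L * X) by (unfold Y; apply Rmax_lub; lra).
    rewrite Hf. eapply Rle_trans; [apply Rabs_triang|]. rewrite !Rabs_mult.
    set (R1 := Rabs (P _ _ - _ - _)) in *. set (R2 := Rabs (Q _ _ - _ - _)) in *.
    assert (HR : eps / M * Y <= eps / M * (L * X)) by (apply Rmult_le_compat_l; lra).
    assert (A1 : Rabs al * R1 <= Rabs al * (eps / M * (L * X))) by (apply Rmult_le_compat_l; [apply Rabs_pos|lra]).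
    assert (A2 : Rabs be * R2 <= Rabs be * (eps / M * (L * X))) by (apply Rmult_le_compat_l; [apply Rabs_pos|lra]).
    assert (A3 : 0 <= eps / M * (L * X)).
    { apply Rmult_le_pos; [lra|]. apply Rmult_le_pos; lra. }
    replace (eps * X) with ((Rabs al + Rabs be + 1) * (eps / M * (L * X))).
    - lra.
    - unfold M. field. split; [lra|]. generalize (Rabs_pos al) (Rabs_pos be). lra. }
  split; intros eps.
  - destruct (Main (fun s t => d / J * (P (g s t) (h s t) - P u v - (a * (g s t - u) + b * (h s t - v)))
       + - b / J * (Q (g s t) (h s t) - Q u v - (c * (g s t - u) + d * (h s t - v)))) (d / J) (- b / J) 0
       ltac:(intros; cbv beta; ring) eps) as [d1 H1].
    destruct Hloc as [d2 H2]. exists (mkposreal _ (Rmin_pos d1 d2 (cond_pos d1) (cond_pos d2))). simpl.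
    intros s t Hs Ht. generalize (Rmin_l d1 d2) (Rmin_r d1 d2). intros.
    destruct (H2 s t) as (E1 & E2 & _); [lra|lra|].
    specialize (H1 s t ltac:(lra) ltac:(lra)). simpl in H1. rewrite E1, E2, P0, Q0 in H1.
    rewrite <- Rabs_Ropp. fold u.
    match type of H1 with Rabs ?x <= _ => match goal with |- Rabs ?y <= _ => replace y with x; [exact H1|] end end.
    unfold J. field. exact HJ.
  - destruct (Main (fun s t => - c / J * (P (g s t) (h s t) - P u v - (a * (g s t - u) + b * (h s t - v)))
       + a / J * (Q (g s t) (h s t) - Q u v - (c * (g s t - u) + d * (h s t - v)))) (- c / J) (a / J) 0
       ltac:(intros; cbv beta; ring) eps) as [d1 H1].
    destruct Hloc as [d2 H2]. exists (mkposreal _ (Rmin_pos d1 d2 (cond_pos d1) (cond_pos d2))). simpl.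
    intros s t Hs Ht. generalize (Rmin_l d1 d2) (Rmin_r d1 d2). intros.
    destruct (H2 s t) as (E1 & E2 & _); [lra|lra|].
    specialize (H1 s t ltac:(lra) ltac:(lra)). simpl in H1. rewrite E1, E2, P0, Q0 in H1.
    rewrite <- Rabs_Ropp. fold v.
    match type of H1 with Rabs ?x <= _ => match goal with |- Rabs ?y <= _ => replace y with x; [exact H1|] end end.
    unfold J. field. exact HJ.
Qed.

(** Inverse function theorem.  Composed with the inverse of its differential at
    the centre, (P, Q) becomes the identity plus a map (g, h) whose differential
    vanishes there: [small_solution] gives surjectivity onto a box, and
    [small_gradient] injectivity with a Lipschitz inverse. *)
Theorem local_inverse (D : R * R -> Prop) (P Q : R -> R -> R) (u0 v0 : R) : open D -> D (u0, v0) -> smooth D P -> smooth D Q ->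
  (forall u v, D (u, v) -> pd cu P u v * pd cv Q u v - pd cv P u v * pd cu Q u v <> 0) ->
  exists (W V : R * R -> Prop) (phi : R -> R -> R * R),
    planar_domain W /\ open V /\ V (u0, v0) /\ (forall q, V q -> D q) /\
    diffeo W V phi (fun u v => (P u v, Q u v)).
Proof.
  intros HO H0 SP SQ HJ.
  pose (a := pd cu P u0 v0). pose (b := pd cv P u0 v0). pose (c := pd cu Q u0 v0). pose (d := pd cv Q u0 v0).
  pose (J := a * d - b * c). assert (HJ0 : J <> 0) by exact (HJ u0 v0 H0).
  (* The deviation from the identity of (P, Q) composed with the inverse of its
     differential at (u0, v0). *)
  pose (g := fun u v => d / J * P u v + - b / J * Q u v + -1 * u).
  pose (h := fun u v => - c / J * P u v + a / J * Q u v + -1 * v).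
  assert (Sid1 : smooth D (fun u _ => u)).
  { apply smooth_of_pd.
    - intros u v _. split; [apply continuity_2d_pt_id1|split; [apply ex_derive_id|apply ex_derive_const]].
    - apply (smooth_ext D (fun _ _ => 1)); [assumption| |apply smooth_const].
      intros u v _. simpl. symmetry. apply (Derive_id u).
    - apply (smooth_ext D (fun _ _ => 0)); [assumption| |apply smooth_const].
      intros u v _. simpl. symmetry. apply Derive_const. }
  assert (Sid2 : smooth D (fun _ v => v)).
  { apply smooth_of_pd.
    - intros u v _. split; [apply continuity_2d_pt_id2|split; [apply ex_derive_const|apply ex_derive_id]].
    - apply (smooth_ext D (fun _ _ => 0)); [assumption| |apply smooth_const].
      intros u v _. simpl. symmetry. apply Derive_const.
    - apply (smooth_ext D (fun _ _ => 1)); [assumption| |apply smooth_const].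
      intros u v _. simpl. symmetry. apply (Derive_id v). }
  assert (Sg : smooth D g) by (unfold g; smooth_tac).
  assert (Sh : smooth D h) by (unfold h; smooth_tac).
  assert (Hlin : forall i k l m F u v, smooth D F -> D (u, v) ->
    pd i (fun s t => k * P s t + l * Q s t + m * F s t) u v = k * pd i P u v + l * pd i Q u v + m * pd i F u v).
  { intros i k l m F u v SF Huv.
    pose proof (smooth_pdble D P u v SP Huv) as DP. pose proof (smooth_pdble D Q u v SQ Huv) as DQ.
    pose proof (smooth_pdble D F u v SF Huv) as DF.
    assert (Dk : forall x, part_derivable (fun _ _ => x) u v) by (intros; split; apply ex_derive_const).
    pose proof (part_derivable_mult _ _ u v (Dk k) DP) as X1. pose proof (part_derivable_mult _ _ u v (Dk l) DQ) as X2.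
    pose proof (part_derivable_mult _ _ u v (Dk m) DF) as X3.
    rewrite (pd_plus i _ _ u v (part_derivable_plus _ _ u v X1 X2) X3), (pd_plus i _ _ u v X1 X2).
    rewrite (pd_scal i k P u v DP), (pd_scal i l Q u v DQ), (pd_scal i m F u v DF). reflexivity. }
  assert (Z : pd cu g u0 v0 = 0 /\ pd cv g u0 v0 = 0 /\ pd cu h u0 v0 = 0 /\ pd cv h u0 v0 = 0).
  { unfold g, h. rewrite !(fun i k l m => Hlin i k l m (fun u _ => u)), !(fun i k l m => Hlin i k l m (fun _ v => v)) by assumption.
    fold a b c d. simpl pd. rewrite !Derive_id, !Derive_const. unfold J.
    repeat split; field; exact HJ0. }
  destruct Z as (Z1 & Z2 & Z3 & Z4).
  assert (Hloc : locally_2d (fun u v => D (u, v) /\ (Rabs (pd cu g u v) <= / 4 /\ Rabs (pd cv g u v) <= / 4) /\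
     (Rabs (pd cu h u v) <= / 4 /\ Rabs (pd cv h u v) <= / 4)) u0 v0).
  { assert (K : forall i f, smooth D f -> pd i f u0 v0 = 0 -> locally_2d (fun u v => Rabs (pd i f u v) <= / 4) u0 v0).
    { intros i f Hf Hz. destruct (smooth_near D (pd i f) u0 v0 (/ 4) (smooth_pd D i f Hf) H0 ltac:(lra)) as [r Hr].
      exists r. intros s t Hs Ht. specialize (Hr s t Hs Ht). rewrite Hz, Rminus_0_r in Hr. exact Hr. }
    repeat apply locally_2d_and; try (apply K; assumption). apply open_locally_2d; assumption. }
  apply locally_2d_box in Hloc. destruct Hloc as (r & Hr & Hbox).
  set (B := box u0 v0 r) in *.
  assert (HB : forall q, B q -> D q) by (intros [u v] Hq; apply (Hbox u v Hq)).
  pose proof (box_open u0 v0 r) as HBo. fold B in HBo.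
  assert (Sg' := smooth_sub _ _ _ HB Sg). assert (Sh' := smooth_sub _ _ _ HB Sh).
  assert (Gg : forall u v, B (u, v) -> Rabs (pd cu g u v) <= / 4 /\ Rabs (pd cv g u v) <= / 4) by (intros u v Huv; apply (Hbox u v Huv)).
  assert (Gh : forall u v, B (u, v) -> Rabs (pd cu h u v) <= / 4 /\ Rabs (pd cv h u v) <= / 4) by (intros u v Huv; apply (Hbox u v Huv)).
  set (N := Rabs (d / J) + Rabs (- b / J) + Rabs (- c / J) + Rabs (a / J)).
  assert (HN : 0 <= N) by (unfold N; generalize (Rabs_pos (d / J)) (Rabs_pos (- b / J)) (Rabs_pos (- c / J)) (Rabs_pos (a / J)); lra).
  assert (Hlip : forall x y M, Rabs x <= M -> Rabs y <= M ->
     Rabs (d / J * x + - b / J * y) <= N * M /\ Rabs (- c / J * x + a / J * y) <= N * M).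
  { intros x y M Hx Hy. unfold N. assert (0 <= M) by (generalize (Rabs_pos x); lra).
    generalize (Rabs_pos (d / J)) (Rabs_pos (- b / J)) (Rabs_pos (- c / J)) (Rabs_pos (a / J)) (Rabs_pos x) (Rabs_pos y); intros.
    split; (eapply Rle_trans; [apply Rabs_triang|]); rewrite !Rabs_mult; nra. }
  (* Injectivity, with a Lipschitz bound for the inverse. *)
  assert (Hinj : forall u v s t, B (u, v) -> B (s, t) ->
     Rmax (Rabs (s - u)) (Rabs (t - v)) <= 2 * N * Rmax (Rabs (P s t - P u v)) (Rabs (Q s t - Q u v))).
  { intros u v s t Huv Hst.
    pose proof (small_gradient u0 v0 r g Sg' Gg u v s t Huv Hst) as E1.
    pose proof (small_gradient u0 v0 r h Sh' Gh u v s t Huv Hst) as E2.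
    set (M := Rmax (Rabs (P s t - P u v)) (Rabs (Q s t - Q u v))).
    destruct (Hlip (P s t - P u v) (Q s t - Q u v) M (Rmax_l _ _) (Rmax_r _ _)) as [L1 L2].
    set (X := Rmax (Rabs (s - u)) (Rabs (t - v))) in *.
    assert (F1 : Rabs (s - u) <= N * M + / 2 * X).
    { replace (s - u) with ((d / J * (P s t - P u v) + - b / J * (Q s t - Q u v)) - (g s t - g u v)) by (unfold g; ring).
      unfold Rminus at 1. eapply Rle_trans; [apply Rabs_triang|]. rewrite Rabs_Ropp. lra. }
    assert (F2 : Rabs (t - v) <= N * M + / 2 * X).
    { replace (t - v) with ((- c / J * (P s t - P u v) + a / J * (Q s t - Q u v)) - (h s t - h u v)) by (unfold h; ring).
      unfold Rminus at 1. eapply Rle_trans; [apply Rabs_triang|]. rewrite Rabs_Ropp. lra. }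
    assert (X <= N * M + / 2 * X) by (unfold X; apply Rmax_lub; assumption). lra. }
  (* The radius for which the preconditioned target moves by less than r / 4. *)
  set (del := r / (4 * (N + 1))).
  assert (Hdel : 0 < del) by (unfold del; apply Rdiv_lt_0_compat; lra).
  set (W := box (P u0 v0) (Q u0 v0) del).
  assert (HW : open W) by apply box_open.
  assert (Hsurj : forall s t, W (s, t) -> exists q, B q /\ P (fst q) (snd q) = s /\ Q (fst q) (snd q) = t).
  { intros s t [Hs Ht]. simpl in Hs, Ht.
    destruct (Hlip (P u0 v0 - s) (Q u0 v0 - t) (Rmax (Rabs (P u0 v0 - s)) (Rabs (Q u0 v0 - t))) (Rmax_l _ _) (Rmax_r _ _)) as [L1 L2].
    set (M := Rmax _ _) in *.
    assert (HM : M < del) by (unfold M; apply Rmax_lub_lt; rewrite Rabs_minus_sym; assumption).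
    assert (HM0 : 0 <= M) by (unfold M; eapply Rle_trans; [apply Rabs_pos|apply Rmax_l]).
    assert (HNM : N * M < r / 4).
    { replace (r / 4) with ((N + 1) * del) by (unfold del; field; lra). nra. }
    destruct (small_solution u0 v0 r g h (d / J * s + - b / J * t) (- c / J * s + a / J * t)) as (u & v & Huv & E1 & E2);
      try assumption.
    - unfold g. replace (u0 + (d / J * P u0 v0 + - b / J * Q u0 v0 + -1 * u0) - (d / J * s + - b / J * t))
        with (d / J * (P u0 v0 - s) + - b / J * (Q u0 v0 - t)) by ring. lra.
    - unfold h. replace (v0 + (- c / J * P u0 v0 + a / J * Q u0 v0 + -1 * v0) - (- c / J * s + a / J * t))
        with (- c / J * (P u0 v0 - s) + a / J * (Q u0 v0 - t)) by ring. lra.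
    - exists (u, v). split; [assumption|]. simpl. unfold g in E1. unfold h in E2.
      assert (E1' : d / J * (P u v - s) + - b / J * (Q u v - t) = 0) by lra.
      assert (E2' : - c / J * (P u v - s) + a / J * (Q u v - t) = 0) by lra.
      split; apply Rminus_diag_uniq.
      + replace (P u v - s) with (a * (d / J * (P u v - s) + - b / J * (Q u v - t)) + b * (- c / J * (P u v - s) + a / J * (Q u v - t)))
          by (unfold J; field; exact HJ0). rewrite E1', E2'. ring.
      + replace (Q u v - t) with (c * (d / J * (P u v - s) + - b / J * (Q u v - t)) + d * (- c / J * (P u v - s) + a / J * (Q u v - t)))
          by (unfold J; field; exact HJ0). rewrite E1', E2'. ring. }
  set (phi := fun s t => epsilon (inhabits (u0, v0)) (fun q => B q /\ P (fst q) (snd q) = s /\ Q (fst q) (snd q) = t)).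
  assert (Hphi : forall s t, W (s, t) -> B (phi s t) /\ P (fst (phi s t)) (snd (phi s t)) = s /\ Q (fst (phi s t)) (snd (phi s t)) = t).
  { intros s t Hst. exact (epsilon_spec (inhabits (u0, v0)) _ (Hsurj s t Hst)). }
  set (V := fun q => B q /\ W (P (fst q) (snd q), Q (fst q) (snd q))).
  assert (SPB := smooth_sub _ _ _ HB SP). assert (SQB := smooth_sub _ _ _ HB SQ).
  assert (HV : open V).
  { apply open_of_locally_2d. intros u v [Huv HWuv]. simpl in HWuv.
    destruct (open_locally_2d W _ _ HW HWuv) as [e He].
    apply locally_2d_and; [apply open_locally_2d; assumption|].
    generalize (locally_2d_and _ _ _ _ (smooth_cont B P u v SPB Huv e) (smooth_cont B Q u v SQB Huv e)).
    intros [k Hk]. exists k. intros s t Hs Ht. simpl. apply He; apply (Hk s t Hs Ht). }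
  assert (HVB : forall q, V q -> B q) by (intros q Hq; apply Hq).
  assert (HphiV : forall s t, W (s, t) -> V (phi s t)).
  { intros s t Hst. destruct (Hphi s t Hst) as (P1 & P2 & P3). split; [assumption|].
    change (W (P (fst (phi s t)) (snd (phi s t)), Q (fst (phi s t)) (snd (phi s t)))).
    rewrite P2, P3. assumption. }
  set (jac := fun u v => pd cu P u v * pd cv Q u v - pd cv P u v * pd cu Q u v).
  assert (SPV := smooth_sub _ _ _ HVB SPB). assert (SQV := smooth_sub _ _ _ HVB SQB).
  pose proof (smooth_pd V cu P SPV) as SPu. pose proof (smooth_pd V cv P SPV) as SPv.
  pose proof (smooth_pd V cu Q SQV) as SQu. pose proof (smooth_pd V cv Q SQV) as SQv.
  assert (Sj : smooth V jac) by (unfold jac; smooth_tac).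
  assert (Hj : forall u v, V (u, v) -> jac u v <> 0) by (intros u v Huv; apply HJ; apply HB; apply HVB; exact Huv).
  assert (Sphi : smooth W (fun s t => fst (phi s t)) /\ smooth W (fun s t => snd (phi s t))).
  { apply (inverse_smooth V W (fun s t => fst (phi s t)) (fun s t => snd (phi s t))
      (fun u v => pd cv Q u v / jac u v) (fun u v => - pd cv P u v / jac u v)
      (fun u v => - pd cu Q u v / jac u v) (fun u v => pd cu P u v / jac u v)); try assumption;
     try (smooth_tac; exact Hj).
    - intros s t Hst. pose proof (HphiV s t Hst) as HVst. rewrite (surjective_pairing (phi s t)) in HVst.
      apply (inverse_differentiable P Q (fun s t => fst (phi s t)) (fun s t => snd (phi s t)) s t _ _ _ _ (2 * N)).
      + exact (smooth_differentiable V P _ _ HV SPV HVst).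
      + exact (smooth_differentiable V Q _ _ HV SQV HVst).
      + exact (Hj _ _ HVst).
      + destruct (open_locally_2d W s t HW Hst) as [k Hk]. exists k. intros s' t' Hs Ht.
        specialize (Hk s' t' Hs Ht). destruct (Hphi s' t' Hk) as (P1 & P2 & P3).
        split; [assumption|split; [assumption|]].
        rewrite (surjective_pairing (phi s' t')) in P1.
        destruct (Hphi s t Hst) as (_ & P2' & P3').
        pose proof (Hinj _ _ _ _ (HVB _ HVst) P1) as HI. rewrite P2, P3, P2', P3' in HI.
        split; (eapply Rle_trans; [|exact HI]); [apply Rmax_l|apply Rmax_r]. }
  exists W, V, phi. split; [split; [assumption|apply box_connected]|].
  split; [assumption|split].
  { split; [apply box_center; assumption|]. simpl. apply box_center. assumption. }
  split; [intros q Hq; apply HB, HVB, Hq|].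
  split; [exact Sphi|]. split; [split; assumption|]. split.
  - intros s t Hst. split; [apply HphiV; assumption|]. destruct (Hphi s t Hst) as (_ & P2 & P3). rewrite P2, P3. reflexivity.
  - intros u v [Huv HWuv]. simpl in HWuv. split; [assumption|]. cbn [fst snd].
    destruct (Hphi _ _ HWuv) as (P1 & P2 & P3). rewrite (surjective_pairing (phi _ _)) in P1.
    pose proof (Hinj _ _ _ _ Huv P1) as HI. rewrite P2, P3, !Rminus_diag, Rabs_R0, (Rmax_left 0 0), Rmult_0_r in HI by lra.
    assert (F1 : Rabs (fst (phi (P u v) (Q u v)) - u) = 0).
    { apply Rle_antisym; [eapply Rle_trans; [apply Rmax_l|exact HI]|apply Rabs_pos]. }
    assert (F2 : Rabs (snd (phi (P u v) (Q u v)) - v) = 0).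
    { apply Rle_antisym; [eapply Rle_trans; [apply Rmax_r|exact HI]|apply Rabs_pos]. }
    apply Rabs_eq_0 in F1. apply Rabs_eq_0 in F2. rewrite (surjective_pairing (phi _ _)). f_equal; lra.
Qed.

(** Differentiate P (g, h) = s and Q (g, h) = t and apply Cramer's rule. *)
Lemma inverse_derivatives (V W : R * R -> Prop) P Q g h i s t : open V -> open W ->
  (forall s t, W (s, t) -> V (g s t, h s t) /\ P (g s t) (h s t) = s /\ Q (g s t) (h s t) = t) ->
  smooth V P -> smooth V Q -> smooth W g -> smooth W h -> W (s, t) ->
  let a := pd cu P (g s t) (h s t) in let b := pd cv P (g s t) (h s t) in
  let c := pd cu Q (g s t) (h s t) in let d := pd cv Q (g s t) (h s t) in
  a * d - b * c <> 0 ->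
  pd i g s t = match i with cu => d | cv => - b end / (a * d - b * c) /\
  pd i h s t = match i with cu => - c | cv => a end / (a * d - b * c).
Proof.
  intros HV HW H SP SQ Sg Sh Hst a b c d HJ.
  pose proof (smooth_pdble W g s t Sg Hst) as Dg. pose proof (smooth_pdble W h s t Sh Hst) as Dh.
  assert (EP : a * pd i g s t + b * pd i h s t = match i with cu => 1 | cv => 0 end).
  { rewrite <- (pd_comp i P g h s t a b (smooth_differentiable V P _ _ HV SP (proj1 (H s t Hst))) Dg Dh).
    rewrite (pd_ext W i _ (fun x _ => x) s t HW Hst) by (intros x y Hxy; apply (H x y Hxy)).
    destruct i; simpl; [apply Derive_id|apply Derive_const]. }
  assert (EQ : c * pd i g s t + d * pd i h s t = match i with cu => 0 | cv => 1 end).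
  { rewrite <- (pd_comp i Q g h s t c d (smooth_differentiable V Q _ _ HV SQ (proj1 (H s t Hst))) Dg Dh).
    rewrite (pd_ext W i _ (fun _ y => y) s t HW Hst) by (intros x y Hxy; apply (H x y Hxy)).
    destruct i; simpl; [apply Derive_const|apply Derive_id]. }
  split; apply (Rmult_eq_reg_r (a * d - b * c)); try assumption.
  - replace (pd i g s t * (a * d - b * c)) with (d * (a * pd i g s t + b * pd i h s t) - b * (c * pd i g s t + d * pd i h s t)) by ring.
    rewrite EP, EQ. destruct i; field; assumption.
  - replace (pd i h s t * (a * d - b * c)) with (a * (c * pd i g s t + d * pd i h s t) - c * (a * pd i g s t + b * pd i h s t)) by ring.
    rewrite EP, EQ. destruct i; field; assumption.
Qed.

(** * Vectors of Minkowski space *)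

Lemma comp1_vadd a b : comp1 (vadd a b) = comp1 a + comp1 b.
Proof. destruct a as [[[a1 a2] a3] a4], b as [[[b1 b2] b3] b4]; reflexivity. Qed.

Lemma comp2_vadd a b : comp2 (vadd a b) = comp2 a + comp2 b.
Proof. destruct a as [[[a1 a2] a3] a4], b as [[[b1 b2] b3] b4]; reflexivity. Qed.

Lemma comp3_vadd a b : comp3 (vadd a b) = comp3 a + comp3 b.
Proof. destruct a as [[[a1 a2] a3] a4], b as [[[b1 b2] b3] b4]; reflexivity. Qed.

Lemma comp4_vadd a b : comp4 (vadd a b) = comp4 a + comp4 b.
Proof. destruct a as [[[a1 a2] a3] a4], b as [[[b1 b2] b3] b4]; reflexivity. Qed.

Lemma comp1_vscal k a : comp1 (vscal k a) = k * comp1 a.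
Proof. destruct a as [[[a1 a2] a3] a4]; reflexivity. Qed.

Lemma comp2_vscal k a : comp2 (vscal k a) = k * comp2 a.
Proof. destruct a as [[[a1 a2] a3] a4]; reflexivity. Qed.

Lemma comp3_vscal k a : comp3 (vscal k a) = k * comp3 a.
Proof. destruct a as [[[a1 a2] a3] a4]; reflexivity. Qed.

Lemma comp4_vscal k a : comp4 (vscal k a) = k * comp4 a.
Proof. destruct a as [[[a1 a2] a3] a4]; reflexivity. Qed.

Ltac comps := repeat progress rewrite ?comp1_vadd, ?comp2_vadd, ?comp3_vadd, ?comp4_vadd,
  ?comp1_vscal, ?comp2_vscal, ?comp3_vscal, ?comp4_vscal.

Lemma vec_eq a b : comp1 a = comp1 b -> comp2 a = comp2 b -> comp3 a = comp3 b ->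
  comp4 a = comp4 b -> a = b.
Proof.
  destruct a as [[[a1 a2] a3] a4], b as [[[b1 b2] b3] b4]; simpl. intros; subst; reflexivity.
Qed.

Lemma mink_sym a b : mink a b = mink b a.
Proof. unfold mink; ring. Qed.

Lemma mink_add_l a b c : mink (vadd a b) c = mink a c + mink b c.
Proof. unfold mink; comps; ring. Qed.

Lemma mink_add_r a b c : mink c (vadd a b) = mink c a + mink c b.
Proof. unfold mink; comps; ring. Qed.

Lemma mink_scal_l k a c : mink (vscal k a) c = k * mink a c.
Proof. unfold mink; comps; ring. Qed.

Lemma mink_scal_r k a c : mink c (vscal k a) = k * mink c a.
Proof. unfold mink; comps; ring. Qed.

Lemma mink_zero_l a : mink vzero a = 0.
Proof. unfold mink; simpl; ring. Qed.

Ltac mink_lin := repeat progress rewrite ?mink_add_l, ?mink_add_r, ?mink_scal_l, ?mink_scal_r.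

Definition det3 (a1 a2 a3 b1 b2 b3 c1 c2 c3 : R) : R :=
  a1 * (b2 * c3 - b3 * c2) - a2 * (b1 * c3 - b3 * c1) + a3 * (b1 * c2 - b2 * c1).

(** The vector whose product with d is the determinant with rows d, a, b, c;
    the negative fourth term of the metric accounts for the sign of the last
    component. *)
Definition cross (a b c : R4) : R4 :=
  (det3 (comp2 a) (comp3 a) (comp4 a) (comp2 b) (comp3 b) (comp4 b) (comp2 c) (comp3 c) (comp4 c),
   - det3 (comp1 a) (comp3 a) (comp4 a) (comp1 b) (comp3 b) (comp4 b) (comp1 c) (comp3 c) (comp4 c),
   det3 (comp1 a) (comp2 a) (comp4 a) (comp1 b) (comp2 b) (comp4 b) (comp1 c) (comp2 c) (comp4 c),
   det3 (comp1 a) (comp2 a) (comp3 a) (comp1 b) (comp2 b) (comp3 b) (comp1 c) (comp2 c) (comp3 c)).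

Lemma cross_orth a b c :
  mink (cross a b c) a = 0 /\ mink (cross a b c) b = 0 /\ mink (cross a b c) c = 0.
Proof. unfold mink, cross, det3; simpl; repeat split; ring. Qed.

Lemma cross_norm a b c :
  mink (cross a b c) (cross a b c) =
  - det3 (mink a a) (mink a b) (mink a c) (mink a b) (mink b b) (mink b c)
         (mink a c) (mink b c) (mink c c).
Proof.
  destruct a as [[[a1 a2] a3] a4], b as [[[b1 b2] b3] b4], c as [[[c1 c2] c3] c4].
  unfold mink, cross, det3; simpl. ring.
Qed.

(** Cramer's rule: the determinant times w is a combination of the four cross
    products of triples, with the products of w by a, b, c, d as coefficients. *)
Lemma cross_nondegenerate a b c d w :
  mink (cross a b c) d <> 0 ->
  mink w a = 0 -> mink w b = 0 -> mink w c = 0 -> mink w d = 0 -> w = vzero.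
Proof.
  intros Hd Ha Hb Hc Hw.
  assert (H : vscal (mink (cross a b c) d) w = vzero).
  { transitivity (vadd (vadd (vscal (mink w d) (cross a b c)) (vscal (- mink w c) (cross a b d)))
                  (vadd (vscal (mink w b) (cross a c d)) (vscal (- mink w a) (cross b c d)))).
    - clear. destruct a as [[[a1 a2] a3] a4], b as [[[b1 b2] b3] b4], c as [[[c1 c2] c3] c4],
        d as [[[d1 d2] d3] d4], w as [[[w1 w2] w3] w4].
      apply vec_eq; comps; unfold mink, cross, det3; simpl; ring.
    - rewrite Ha, Hb, Hc, Hw. apply vec_eq; comps; simpl; ring. }
  apply vec_eq; [assert (H' : comp1 (vscal (mink (cross a b c) d) w) = 0)
                |assert (H' : comp2 (vscal (mink (cross a b c) d) w) = 0)
                |assert (H' : comp3 (vscal (mink (cross a b c) d) w) = 0)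
                |assert (H' : comp4 (vscal (mink (cross a b c) d) w) = 0)];
    try (rewrite H; reflexivity); revert H'; comps; intros H';
    apply Rmult_integral in H'; destruct H'; simpl; tauto.
Qed.

(** * Vector fields along a planar domain *)

Lemma smooth_vec_sub (D D' : R * R -> Prop) F : (forall q, D' q -> D q) -> smooth_vec D F -> smooth_vec D' F.
Proof. intros H (H1 & H2 & H3 & H4); repeat split; apply (smooth_sub D D'); assumption. Qed.

Lemma smooth_vec_pdv D i F : smooth_vec D F -> smooth_vec D (pdv i F).
Proof.
  intros (H1 & H2 & H3 & H4). split; [|split; [|split]].
  - exact (smooth_pd D i _ H1).
  - exact (smooth_pd D i _ H2).
  - exact (smooth_pd D i _ H3).
  - exact (smooth_pd D i _ H4).
Qed.

Lemma smooth_vec_add D F G : open D -> smooth_vec D F -> smooth_vec D G ->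
  smooth_vec D (fun s t => vadd (F s t) (G s t)).
Proof.
  intros HD (F1 & F2 & F3 & F4) (G1 & G2 & G3 & G4). split; [|split; [|split]].
  - apply smooth_ext with (fun s t => comp1 (F s t) + comp1 (G s t)); [assumption| |apply smooth_plus; assumption].
    intros; rewrite comp1_vadd; reflexivity.
  - apply smooth_ext with (fun s t => comp2 (F s t) + comp2 (G s t)); [assumption| |apply smooth_plus; assumption].
    intros; rewrite comp2_vadd; reflexivity.
  - apply smooth_ext with (fun s t => comp3 (F s t) + comp3 (G s t)); [assumption| |apply smooth_plus; assumption].
    intros; rewrite comp3_vadd; reflexivity.
  - apply smooth_ext with (fun s t => comp4 (F s t) + comp4 (G s t)); [assumption| |apply smooth_plus; assumption].
    intros; rewrite comp4_vadd; reflexivity.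
Qed.

Lemma smooth_vec_scal D k F : open D -> smooth D k -> smooth_vec D F ->
  smooth_vec D (fun s t => vscal (k s t) (F s t)).
Proof.
  intros HD Hk (F1 & F2 & F3 & F4). split; [|split; [|split]].
  - apply smooth_ext with (fun s t => k s t * comp1 (F s t)); [assumption| |apply smooth_mult; assumption].
    intros; rewrite comp1_vscal; reflexivity.
  - apply smooth_ext with (fun s t => k s t * comp2 (F s t)); [assumption| |apply smooth_mult; assumption].
    intros; rewrite comp2_vscal; reflexivity.
  - apply smooth_ext with (fun s t => k s t * comp3 (F s t)); [assumption| |apply smooth_mult; assumption].
    intros; rewrite comp3_vscal; reflexivity.
  - apply smooth_ext with (fun s t => k s t * comp4 (F s t)); [assumption| |apply smooth_mult; assumption].
    intros; rewrite comp4_vscal; reflexivity.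
Qed.

Lemma smooth_mink D F G : open D -> smooth_vec D F -> smooth_vec D G ->
  smooth D (fun s t => mink (F s t) (G s t)).
Proof.
  intros HD (F1 & F2 & F3 & F4) (G1 & G2 & G3 & G4). unfold mink.
  apply smooth_minus; [assumption| |apply smooth_mult; assumption].
  apply smooth_plus; [assumption| |apply smooth_mult; assumption].
  apply smooth_plus; [assumption| |]; apply smooth_mult; assumption.
Qed.

Lemma smooth_cross D F G H : open D -> smooth_vec D F -> smooth_vec D G -> smooth_vec D H ->
  smooth_vec D (fun s t => cross (F s t) (G s t) (H s t)).
Proof.
  intros HD (F1 & F2 & F3 & F4) (G1 & G2 & G3 & G4) (H1 & H2 & H3 & H4).
  assert (Hdet : forall a1 a2 a3 b1 b2 b3 c1 c2 c3, smooth D a1 -> smooth D a2 -> smooth D a3 ->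
    smooth D b1 -> smooth D b2 -> smooth D b3 -> smooth D c1 -> smooth D c2 -> smooth D c3 ->
    smooth D (fun s t => det3 (a1 s t) (a2 s t) (a3 s t) (b1 s t) (b2 s t) (b3 s t) (c1 s t) (c2 s t) (c3 s t))).
  { intros. unfold det3.
    apply smooth_plus; [assumption|apply smooth_minus; [assumption|..]|];
    (apply smooth_mult; [assumption|assumption|apply smooth_minus; [assumption|..]; apply smooth_mult; assumption]). }
  split; [|split; [|split]].
  - apply (Hdet (fun s t => comp2 (F s t)) (fun s t => comp3 (F s t)) (fun s t => comp4 (F s t))
      (fun s t => comp2 (G s t)) (fun s t => comp3 (G s t)) (fun s t => comp4 (G s t))
      (fun s t => comp2 (H s t)) (fun s t => comp3 (H s t)) (fun s t => comp4 (H s t))); assumption.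
  - apply smooth_opp; [assumption|].
    apply (Hdet (fun s t => comp1 (F s t)) (fun s t => comp3 (F s t)) (fun s t => comp4 (F s t))
      (fun s t => comp1 (G s t)) (fun s t => comp3 (G s t)) (fun s t => comp4 (G s t))
      (fun s t => comp1 (H s t)) (fun s t => comp3 (H s t)) (fun s t => comp4 (H s t))); assumption.
  - apply (Hdet (fun s t => comp1 (F s t)) (fun s t => comp2 (F s t)) (fun s t => comp4 (F s t))
      (fun s t => comp1 (G s t)) (fun s t => comp2 (G s t)) (fun s t => comp4 (G s t))
      (fun s t => comp1 (H s t)) (fun s t => comp2 (H s t)) (fun s t => comp4 (H s t))); assumption.
  - apply (Hdet (fun s t => comp1 (F s t)) (fun s t => comp2 (F s t)) (fun s t => comp3 (F s t))
      (fun s t => comp1 (G s t)) (fun s t => comp2 (G s t)) (fun s t => comp3 (G s t))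
      (fun s t => comp1 (H s t)) (fun s t => comp2 (H s t)) (fun s t => comp3 (H s t))); assumption.
Qed.

Lemma pd_mink D i F G u v : smooth_vec D F -> smooth_vec D G -> D (u, v) ->
  pd i (fun s t => mink (F s t) (G s t)) u v =
  mink (pdv i F u v) (G u v) + mink (F u v) (pdv i G u v).
Proof.
  intros (F1 & F2 & F3 & F4) (G1 & G2 & G3 & G4) Huv.
  generalize (smooth_pdble D _ u v F1 Huv) (smooth_pdble D _ u v F2 Huv)
    (smooth_pdble D _ u v F3 Huv) (smooth_pdble D _ u v F4 Huv)
    (smooth_pdble D _ u v G1 Huv) (smooth_pdble D _ u v G2 Huv)
    (smooth_pdble D _ u v G3 Huv) (smooth_pdble D _ u v G4 Huv).
  clear. intros f1 f2 f3 f4 g1 g2 g3 g4. unfold mink.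
  pose proof (part_derivable_mult _ _ u v f1 g1) as m1. pose proof (part_derivable_mult _ _ u v f2 g2) as m2.
  pose proof (part_derivable_mult _ _ u v f3 g3) as m3. pose proof (part_derivable_mult _ _ u v f4 g4) as m4.
  pose proof (part_derivable_plus _ _ u v m1 m2) as m12. pose proof (part_derivable_plus _ _ u v m12 m3) as m123.
  rewrite (pd_minus i _ _ u v m123 m4), (pd_plus i _ _ u v m12 m3), (pd_plus i _ _ u v m1 m2).
  rewrite (pd_mult i _ _ u v f1 g1), (pd_mult i _ _ u v f2 g2), (pd_mult i _ _ u v f3 g3),
    (pd_mult i _ _ u v f4 g4).
  cbn [pdv comp1 comp2 comp3 comp4]. ring.
Qed.

Lemma pdv_comm D F u v : open D -> smooth_vec D F -> D (u, v) ->
  pdv cu (pdv cv F) u v = pdv cv (pdv cu F) u v.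
Proof.
  intros HD (H1 & H2 & H3 & H4) Huv.
  apply vec_eq.
  - exact (pd_comm D _ u v HD H1 Huv).
  - exact (pd_comm D _ u v HD H2 Huv).
  - exact (pd_comm D _ u v HD H3 Huv).
  - exact (pd_comm D _ u v HD H4 Huv).
Qed.

Lemma pdv_comp V W i F g h u v : open V -> smooth_vec V F -> smooth W g -> smooth W h ->
  W (u, v) -> V (g u v, h u v) ->
  pdv i (fun s t => F (g s t) (h s t)) u v =
  vadd (vscal (pd i g u v) (pdv cu F (g u v) (h u v)))
       (vscal (pd i h u v) (pdv cv F (g u v) (h u v))).
Proof.
  intros HV (H1 & H2 & H3 & H4) Hg Hh HW Hgh.
  pose proof (smooth_pdble W g u v Hg HW) as Dg. pose proof (smooth_pdble W h u v Hh HW) as Dh.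
  apply vec_eq; comps.
  - rewrite Rmult_comm, (Rmult_comm (pd i h u v)).
    exact (pd_comp i _ g h u v _ _ (smooth_differentiable V _ _ _ HV H1 Hgh) Dg Dh).
  - rewrite Rmult_comm, (Rmult_comm (pd i h u v)).
    exact (pd_comp i _ g h u v _ _ (smooth_differentiable V _ _ _ HV H2 Hgh) Dg Dh).
  - rewrite Rmult_comm, (Rmult_comm (pd i h u v)).
    exact (pd_comp i _ g h u v _ _ (smooth_differentiable V _ _ _ HV H3 Hgh) Dg Dh).
  - rewrite Rmult_comm, (Rmult_comm (pd i h u v)).
    exact (pd_comp i _ g h u v _ _ (smooth_differentiable V _ _ _ HV H4 Hgh) Dg Dh).
Qed.

Lemma smooth_vec_comp V W F g h : open V -> open W -> (forall s t, W (s, t) -> V (g s t, h s t)) ->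
  smooth_vec V F -> smooth W g -> smooth W h -> smooth_vec W (fun s t => F (g s t) (h s t)).
Proof.
  intros HV HW H (H1 & H2 & H3 & H4) Hg Hh. split; [|split; [|split]].
  - exact (smooth_comp V W _ g h HV HW H H1 Hg Hh).
  - exact (smooth_comp V W _ g h HV HW H H2 Hg Hh).
  - exact (smooth_comp V W _ g h HV HW H H3 Hg Hh).
  - exact (smooth_comp V W _ g h HV HW H H4 Hg Hh).
Qed.

(** * Adapted frames and the Gauss equation *)

(** [af_basis] expresses that z_u, z_v, n1, n2 span the whole space: as the metric
    is nondegenerate, only zero is orthogonal to all four. *)
Record adapted_frame (D : R * R -> Prop) (z n1 n2 : R -> R -> R4) : Prop := {
  af_open : open D;
  af_z : smooth_vec D z;
  af_n1 : smooth_vec D n1;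
  af_n2 : smooth_vec D n2;
  af_det : forall u v, D (u, v) -> metric_det z u v <> 0;
  af_n1z : forall i u v, D (u, v) -> mink (n1 u v) (pdv i z u v) = 0;
  af_n2z : forall i u v, D (u, v) -> mink (n2 u v) (pdv i z u v) = 0;
  af_n11 : forall u v, D (u, v) -> mink (n1 u v) (n1 u v) = 1;
  af_n22 : forall u v, D (u, v) -> mink (n2 u v) (n2 u v) = 1;
  af_n12 : forall u v, D (u, v) -> mink (n1 u v) (n2 u v) = 0;
  af_basis : forall u v w, D (u, v) -> mink w (pdv cu z u v) = 0 -> mink w (pdv cv z u v) = 0 ->
    mink w (n1 u v) = 0 -> mink w (n2 u v) = 0 -> w = vzero }.

Lemma adapted_frame_sub (D D' : R * R -> Prop) z n1 n2 : open D' -> (forall q, D' q -> D q) ->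
  adapted_frame D z n1 n2 -> adapted_frame D' z n1 n2.
Proof.
  intros HO HS []. constructor; try assumption; try (eapply smooth_vec_sub; eassumption);
  intros; eauto.
Qed.

(** Up to the identity [shape_second], this is <sigma(z_i, z_j), n>.  The formula
    by first derivatives of the normal field is the one that behaves well under
    a change of parameters. *)
Definition shape (z n : R -> R -> R4) (i j : coord) (u v : R) : R :=
  - mink (pdv i n u v) (pdv j z u v).

Lemma smooth_shape D z n i j : open D -> smooth_vec D z -> smooth_vec D n -> smooth D (shape z n i j).
Proof.
  intros HO Hz Hn. apply (smooth_opp D (fun u v => mink (pdv i n u v) (pdv j z u v))); [assumption|].
  apply smooth_mink; [assumption|apply smooth_vec_pdv; assumption..].
Qed.

Lemma metric_sym z u v : metric z cv cu u v = metric z cu cv u v.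
Proof. apply mink_sym. Qed.

Lemma vsub_zero a b : vadd a (vscal (-1) b) = vzero -> a = b.
Proof.
  intros H.
  apply vec_eq; [apply (f_equal comp1) in H|apply (f_equal comp2) in H|apply (f_equal comp3) in H|
    apply (f_equal comp4) in H]; revert H; comps; simpl; lra.
Qed.

Section Frame.
Variables (D : R * R -> Prop) (z n1 n2 : R -> R -> R4).
Hypothesis A : adapted_frame D z n1 n2.

Lemma shape_second n i j u v : smooth_vec D n ->
  (forall i u v, D (u, v) -> mink (n u v) (pdv i z u v) = 0) -> D (u, v) ->
  mink (pdv i (pdv j z) u v) (n u v) = shape z n i j u v.
Proof.
  intros Hn Hz Huv. unfold shape.
  assert (H : pd i (fun s t => mink (n s t) (pdv j z s t)) u v = 0).
  { rewrite <- (pd_const i 0 u v). apply (pd_ext D); [apply A|assumption|].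
    intros; apply Hz; assumption. }
  rewrite (pd_mink D) in H; [|assumption|apply smooth_vec_pdv, A|assumption].
  rewrite (mink_sym _ (n u v)). lra.
Qed.

Lemma shape_sym n u v : smooth_vec D n ->
  (forall i u v, D (u, v) -> mink (n u v) (pdv i z u v) = 0) -> D (u, v) ->
  shape z n cv cu u v = shape z n cu cv u v.
Proof.
  intros Hn Hz Huv. rewrite <- !shape_second by assumption.
  rewrite (pdv_comm D); [reflexivity|apply A|apply A|assumption].
Qed.

Lemma mink_tangent_part u v a k : D (u, v) ->
  mink (tangent_part z u v a) (pdv k z u v) = mink a (pdv k z u v).
Proof.
  intros Huv. pose proof (af_det _ _ _ _ A u v Huv) as Hd. unfold metric_det in Hd.
  unfold tangent_part, push, csum, metric_inv, metric_det. simpl.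
  mink_lin.
  destruct k; fold (metric z cu cu u v) (metric z cu cv u v) (metric z cv cv u v)
     (metric z cv cu u v); rewrite ?metric_sym; field; simpl; lra.
Qed.

Lemma push_normal n u v X : (forall i, mink n (pdv i z u v) = 0) -> mink n (push z u v X) = 0.
Proof. intros H. unfold push. mink_lin. rewrite !H. ring. Qed.

Lemma frame_decomposition u v a : D (u, v) ->
  a = vadd (tangent_part z u v a)
        (vadd (vscal (mink a (n1 u v)) (n1 u v)) (vscal (mink a (n2 u v)) (n2 u v))).
Proof.
  intros Huv.
  pose proof (fun i => af_n1z _ _ _ _ A i u v Huv) as H1.
  pose proof (fun i => af_n2z _ _ _ _ A i u v Huv) as H2.
  apply vsub_zero. apply (af_basis _ _ _ _ A u v); [assumption|..]; mink_lin.
  - rewrite mink_tangent_part, H1, H2 by assumption. ring.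
  - rewrite mink_tangent_part, H1, H2 by assumption. ring.
  - rewrite (mink_sym (tangent_part _ _ _ _)). unfold tangent_part at 1. rewrite push_normal by assumption.
    rewrite (mink_sym (n2 u v)), (af_n11 _ _ _ _ A), (af_n12 _ _ _ _ A) by assumption. ring.
  - rewrite (mink_sym (tangent_part _ _ _ _)). unfold tangent_part at 1. rewrite push_normal by assumption.
    rewrite (af_n22 _ _ _ _ A), (af_n12 _ _ _ _ A) by assumption. ring.
Qed.

Lemma normal_part_frame u v a : D (u, v) ->
  normal_part z u v a =
  vadd (vscal (mink a (n1 u v)) (n1 u v)) (vscal (mink a (n2 u v)) (n2 u v)).
Proof.
  intros Huv. unfold normal_part. rewrite (frame_decomposition u v a Huv) at 1.
  apply vec_eq; comps; ring.
Qed.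

(** Parseval's identity for the frame.  It turns the structure equations into
    identities between scalars. *)
Lemma mink_frame u v a b : D (u, v) ->
  mink a b =
  (metric z cv cv u v * (mink a (pdv cu z u v) * mink b (pdv cu z u v))
   - metric z cu cv u v * (mink a (pdv cu z u v) * mink b (pdv cv z u v)
                           + mink a (pdv cv z u v) * mink b (pdv cu z u v))
   + metric z cu cu u v * (mink a (pdv cv z u v) * mink b (pdv cv z u v))) / metric_det z u v
  + mink a (n1 u v) * mink b (n1 u v) + mink a (n2 u v) * mink b (n2 u v).
Proof.
  intros Huv. pose proof (af_det _ _ _ _ A u v Huv) as Hd.
  rewrite (frame_decomposition u v a Huv) at 1.
  unfold tangent_part, push, csum, metric_inv. simpl. mink_lin.
  rewrite !(mink_sym _ b). field. assumption.
Qed.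

(** Tensoriality of sigma: a tangent field is orthogonal to n, so that in the
    product with n its derivative can be traded for that of n. *)
Lemma sff_frame X Y u v : D (u, v) ->
  smooth D (fun s t => fst (Y s t)) -> smooth D (fun s t => snd (Y s t)) ->
  let b n := fst (X u v) * (fst (Y u v) * shape z n cu cu u v + snd (Y u v) * shape z n cu cv u v)
    + snd (X u v) * (fst (Y u v) * shape z n cv cu u v + snd (Y u v) * shape z n cv cv u v) in
  sff z X Y u v = vadd (vscal (b n1) (n1 u v)) (vscal (b n2) (n2 u v)).
Proof.
  intros Huv HY1 HY2 b. unfold sff. rewrite normal_part_frame by assumption.
  set (F := fun s t => push z s t (Y s t)).
  assert (HF : smooth_vec D F).
  { apply smooth_vec_add; [apply A|..]; apply smooth_vec_scal; try assumption; try apply A;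
    apply smooth_vec_pdv, A. }
  assert (K : forall n, smooth_vec D n ->
    (forall i u v, D (u, v) -> mink (n u v) (pdv i z u v) = 0) ->
    mink (flat_conn (X u v) F u v) (n u v) = b n).
  { intros n Hn Hz.
    assert (E : forall i, mink (pdv i F u v) (n u v) = - mink (pdv i n u v) (F u v)).
    { intros i.
      assert (H : pd i (fun s t => mink (n s t) (F s t)) u v = 0).
      { rewrite <- (pd_const i 0 u v). apply (pd_ext D); [apply A|assumption|].
        intros s t Hst. unfold F, push. mink_lin. rewrite !Hz by assumption. ring. }
      rewrite (pd_mink D) in H by assumption. rewrite (mink_sym _ (n u v)). lra. }
    unfold flat_conn. mink_lin. rewrite !E. unfold F, push, b, shape. mink_lin. ring. }
  rewrite !K; [reflexivity|apply A|apply A|apply A|apply A].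
Qed.

Lemma sff_at_frame X Y u v : D (u, v) ->
  let b n := fst X * (fst Y * shape z n cu cu u v + snd Y * shape z n cu cv u v)
    + snd X * (fst Y * shape z n cv cu u v + snd Y * shape z n cv cv u v) in
  sff_at z u v X Y = vadd (vscal (b n1) (n1 u v)) (vscal (b n2) (n2 u v)).
Proof.
  intros Huv. apply (sff_frame (fun _ _ => X) (fun _ _ => Y)); [assumption|apply smooth_const..].
Qed.

Definition trace_shape (n : R -> R -> R4) (u v : R) : R :=
  (metric z cv cv u v * shape z n cu cu u v - 2 * metric z cu cv u v * shape z n cu cv u v
   + metric z cu cu u v * shape z n cv cv u v) / metric_det z u v.

Definition det_shape (n : R -> R -> R4) (u v : R) : R :=
  shape z n cu cu u v * shape z n cv cv u v - shape z n cu cv u v ^ 2.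

Lemma mean_curvature_frame u v : D (u, v) ->
  mean_curvature z u v =
  vadd (vscal (trace_shape n1 u v / 2) (n1 u v)) (vscal (trace_shape n2 u v / 2) (n2 u v)).
Proof.
  intros Huv. pose proof (af_det _ _ _ _ A u v Huv) as Hd.
  unfold mean_curvature. rewrite !sff_at_frame by assumption. simpl.
  rewrite (shape_sym n1), (shape_sym n2); try apply A; try assumption.
  unfold trace_shape, metric_inv.
  apply vec_eq; comps; field; assumption.
Qed.

Lemma pd_metric i j k u v : D (u, v) ->
  pd i (metric z j k) u v =
  mink (pdv i (pdv j z) u v) (pdv k z u v) + mink (pdv i (pdv k z) u v) (pdv j z u v).
Proof.
  intros Huv. unfold metric.
  transitivity (pd i (fun s t => mink (pdv j z s t) (pdv k z s t)) u v); [reflexivity|].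
  rewrite (pd_mink D); [|apply smooth_vec_pdv, A|apply smooth_vec_pdv, A|assumption].
  rewrite (mink_sym (pdv j z u v)). reflexivity.
Qed.

Lemma smooth_metric i j : smooth D (metric z i j).
Proof. apply (smooth_mink D (pdv i z) (pdv j z)); [apply A|apply smooth_vec_pdv, A..]. Qed.

Lemma smooth_metric_det : smooth D (metric_det z).
Proof.
  pose proof (af_open _ _ _ _ A).
  apply (smooth_minus D (fun u v => metric z cu cu u v * metric z cv cv u v)
    (fun u v => metric z cu cv u v ^ 2)); [assumption|apply smooth_mult; try assumption; apply smooth_metric|].
  apply smooth_ext with (fun u v => metric z cu cv u v * metric z cu cv u v); [assumption|intros; ring|].
  apply smooth_mult; try assumption; apply smooth_metric.
Qed.

(** The second derivatives of z are symmetric, so that the Koszul formula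
    reduces to the products <z_ij, z_l>. *)
Lemma christoffel_tangent k i j u v : D (u, v) ->
  christoffel z k i j u v =
  csum (fun l => metric_inv z k l u v * mink (pdv i (pdv j z) u v) (pdv l z u v)).
Proof.
  intros Huv. pose proof (af_det _ _ _ _ A u v Huv) as Hd.
  assert (C : pdv cu (pdv cv z) u v = pdv cv (pdv cu z) u v) by (apply (pdv_comm D); [apply A|apply A|assumption]).
  unfold christoffel, csum. rewrite !pd_metric by assumption.
  destruct i, j; rewrite ?C; field.
Qed.

Lemma smooth_christoffel k i j : smooth D (christoffel z k i j).
Proof.
  pose proof (af_open _ _ _ _ A) as HO.
  assert (HI : forall l, smooth D (metric_inv z k l)).
  { intros l. unfold metric_inv.
    destruct k, l; (apply smooth_div; [assumption|apply A| |apply smooth_metric_det]);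
     first [apply smooth_metric | apply smooth_opp; [assumption|apply smooth_metric]]. }
  apply smooth_ext with (fun u v => csum (fun l => metric_inv z k l u v * mink (pdv i (pdv j z) u v) (pdv l z u v)));
    [assumption|intros; symmetry; apply christoffel_tangent; assumption|].
  unfold csum.
  apply smooth_plus; [assumption|..]; (apply smooth_mult; [assumption|apply HI|]);
  (apply smooth_mink; [assumption|apply smooth_vec_pdv, smooth_vec_pdv, A|apply smooth_vec_pdv, A]).
Qed.

Lemma christoffel_lower i j k u v : D (u, v) ->
  mink (pdv i (pdv j z) u v) (pdv k z u v) =
  christoffel z cu i j u v * metric z cu k u v + christoffel z cv i j u v * metric z cv k u v.
Proof.
  intros Huv. pose proof (af_det _ _ _ _ A u v Huv) as Hd.
  rewrite !christoffel_tangent by assumption. unfold csum, metric_inv.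
  unfold metric_det in *. destruct k; rewrite ?metric_sym; field; lra.
Qed.

(** Differentiate Gamma^l_ij g_l1 = <z_ij, z_u> for z_vv in u and for z_uv in v:
    in the difference the third derivatives of z cancel.  Of the remaining
    <z_uu, z_vv> - <z_uv, z_uv>, the tangent part enters the curvature and the
    normal part is the right-hand side. *)
Lemma gauss_equation u v : D (u, v) ->
  gauss_curvature z u v = (det_shape n1 u v + det_shape n2 u v) / metric_det z u v.
Proof.
  intros Huv. pose proof (af_open _ _ _ _ A) as HO. pose proof (af_z _ _ _ _ A) as HZ.
  assert (P1 : forall i, smooth_vec D (pdv i z)) by (intros; apply smooth_vec_pdv; assumption).
  assert (P2 : forall i j, smooth_vec D (pdv i (pdv j z))) by (intros; apply smooth_vec_pdv, P1).
  unfold gauss_curvature. f_equal.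
  (* The derivative in direction m of Gamma^l_ij g_l1 = <z_ij, z_u>. *)
  assert (Q : forall m i j,
    mink (pdv m (pdv i (pdv j z)) u v) (pdv cu z u v) + mink (pdv i (pdv j z) u v) (pdv m (pdv cu z) u v) =
    (pd m (christoffel z cu i j) u v * metric z cu cu u v
      + christoffel z cu i j u v * pd m (metric z cu cu) u v)
    + (pd m (christoffel z cv i j) u v * metric z cv cu u v
      + christoffel z cv i j u v * pd m (metric z cv cu) u v)).
  { intros m i j. rewrite <- (pd_mink D) by (try assumption; auto).
    pose proof (fun k => smooth_pdble D _ u v (smooth_christoffel k i j) Huv) as Dc.
    pose proof (fun k => smooth_pdble D _ u v (smooth_metric k cu) Huv) as Dm.
    rewrite <- (pd_mult m _ _ u v (Dc cu) (Dm cu)), <- (pd_mult m _ _ u v (Dc cv) (Dm cv)).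
    rewrite <- (pd_plus m _ _ u v (part_derivable_mult _ _ _ _ (Dc cu) (Dm cu)) (part_derivable_mult _ _ _ _ (Dc cv) (Dm cv))).
    apply (pd_ext D); [assumption|assumption|]. intros s t Hst.
    apply christoffel_lower; assumption. }
  assert (C3 : pdv cu (pdv cv (pdv cv z)) u v = pdv cv (pdv cu (pdv cv z)) u v)
    by (apply (pdv_comm D); auto).
  assert (C : pdv cv (pdv cu z) u v = pdv cu (pdv cv z) u v) by (symmetry; apply (pdv_comm D); auto).
  pose proof (Q cu cv cv) as Q1. pose proof (Q cv cu cv) as Q2. rewrite C3 in Q1.
  rewrite !pd_metric in Q1, Q2 by assumption. rewrite C in Q2.
  (* Parseval for second derivatives, with the tangent part in terms of Gamma. *)
  assert (N : forall a b c d,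
     mink (pdv a (pdv b z) u v) (pdv c (pdv d z) u v) =
     christoffel z cu a b u v * mink (pdv c (pdv d z) u v) (pdv cu z u v)
     + christoffel z cv a b u v * mink (pdv c (pdv d z) u v) (pdv cv z u v)
     + shape z n1 a b u v * shape z n1 c d u v + shape z n2 a b u v * shape z n2 c d u v).
  { intros a b c d. rewrite (mink_frame u v) by assumption.
    rewrite !(shape_second n1) by (try apply A; assumption).
    rewrite !(shape_second n2) by (try apply A; assumption).
    rewrite !(christoffel_tangent _ a b) by assumption. unfold csum, metric_inv.
    pose proof (af_det _ _ _ _ A u v Huv) as Hd. field. assumption. }
  pose proof (N cv cv cu cu) as N1. pose proof (N cu cv cu cv) as N2.
  unfold det_shape, curvature_uvv, csum.
  pose proof (christoffel_lower cu cu cu u v Huv) as L1.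
  pose proof (christoffel_lower cu cv cu u v Huv) as L2.
  pose proof (christoffel_lower cv cv cu u v Huv) as L3.
  assert (S : forall k, christoffel z k cv cu u v = christoffel z k cu cv u v).
  { intros k. rewrite !christoffel_tangent, C by assumption. reflexivity. }
  rewrite !metric_sym in *. rewrite !S in *.
  rewrite L1, L2 in *. rewrite L3 in *. lra.
Qed.

End Frame.

Lemma mink_push z u v X Y :
  mink (push z u v X) (push z u v Y) =
  fst X * fst Y * metric z cu cu u v + (fst X * snd Y + snd X * fst Y) * metric z cu cv u v
  + snd X * snd Y * metric z cv cv u v.
Proof.
  unfold push. mink_lin. fold (metric z cu cu u v) (metric z cu cv u v) (metric z cv cv u v)
     (metric z cv cu u v). rewrite metric_sym. ring.
Qed.

(** The Gram determinant of an orthonormal pair of signature (1,1) is -1, and it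
    is [metric_det] times the square of a determinant. *)
Lemma lorentzian_metric_det z u v : lorentzian_at z u v -> metric_det z u v < 0.
Proof.
  intros (X & Y & H1 & H2 & H3). rewrite mink_push in *. unfold metric_det.
  set (E := metric z cu cu u v) in *. set (F := metric z cu cv u v) in *.
  set (G := metric z cv cv u v) in *. destruct X as [x1 x2], Y as [y1 y2]; simpl in *.
  assert (H : (E * G - F ^ 2) * (x1 * y2 - x2 * y1) ^ 2 = -1).
  { transitivity ((x1 * x1 * E + (x1 * x2 + x2 * x1) * F + x2 * x2 * G) *
      (y1 * y1 * E + (y1 * y2 + y2 * y1) * F + y2 * y2 * G) -
      (x1 * y1 * E + (x1 * y2 + x2 * y1) * F + x2 * y2 * G) ^ 2); [ring|].
    rewrite H1, H2, H3. ring. }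
  apply Rnot_le_lt. intros Hle.
  generalize (Rmult_le_pos _ _ Hle (pow2_ge_0 (x1 * y2 - x2 * y1))). lra.
Qed.

(** [n2] is the normalized cross product of z_u, z_v and [n1], whose square is
    minus their Gram determinant, namely [- metric_det]. *)
Lemma adapted_frame_exists D z n1 : open D -> smooth_vec D z -> unit_normal_field D z n1 ->
  (forall u v, D (u, v) -> metric_det z u v < 0) ->
  exists n2, adapted_frame D z n1 n2.
Proof.
  intros HO Hz [[Hn Hnz] Hn1] Hd.
  assert (N1z : forall i u v, D (u, v) -> mink (n1 u v) (pdv i z u v) = 0).
  { intros i u v Huv. destruct i.
    - rewrite <- (Hnz u v Huv (1, 0)). unfold push; mink_lin; simpl; ring.
    - rewrite <- (Hnz u v Huv (0, 1)). unfold push; mink_lin; simpl; ring. }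
  set (w := fun u v => cross (pdv cu z u v) (pdv cv z u v) (n1 u v)).
  set (k := fun u v => / sqrt (- metric_det z u v)).
  assert (Hw : smooth_vec D w) by (apply smooth_cross; try assumption; apply smooth_vec_pdv; assumption).
  assert (SM : forall i j, smooth D (metric z i j))
    by (intros; apply (smooth_mink D (pdv i z) (pdv j z)); [assumption|apply smooth_vec_pdv; assumption..]).
  assert (Hpos : forall u v, D (u, v) -> 0 < sqrt (- metric_det z u v)).
  { intros u v Huv. apply sqrt_lt_R0. generalize (Hd u v Huv). lra. }
  assert (Hk : smooth D k).
  { apply smooth_inv; [assumption| |].
    - intros u v Huv. generalize (Hpos u v Huv). lra.
    - apply smooth_sqrt; [assumption| |].
      + intros u v Huv. generalize (Hd u v Huv). lra.
      + apply smooth_opp; [assumption|].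
        apply smooth_ext with (fun u v => metric z cu cu u v * metric z cv cv u v
           - metric z cu cv u v * metric z cu cv u v); [assumption|intros; unfold metric_det; ring|].
        apply smooth_minus; [assumption|..]; apply smooth_mult; auto. }
  assert (Kw : forall u v, D (u, v) -> mink (w u v) (w u v) = - metric_det z u v).
  { intros u v Huv. unfold w. rewrite cross_norm.
    rewrite !(mink_sym (pdv _ z u v) (n1 u v)), !N1z, Hn1 by assumption.
    unfold det3, metric_det, metric. ring. }
  assert (Kk : forall u v, D (u, v) -> k u v * (k u v * - metric_det z u v) = 1).
  { intros u v Huv. unfold k. generalize (Hpos u v Huv). intros Hp.
    rewrite <- (sqrt_sqrt (- metric_det z u v)) at 3 by (generalize (Hd u v Huv); lra). field. lra. }
  exists (fun u v => vscal (k u v) (w u v)).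
  constructor; try assumption.
  - apply smooth_vec_scal; assumption.
  - intros u v Huv. generalize (Hd u v Huv). lra.
  - intros i u v Huv. mink_lin. destruct (cross_orth (pdv cu z u v) (pdv cv z u v) (n1 u v)) as (C1 & C2 & C3).
    destruct i; unfold w; rewrite ?C1, ?C2; ring.
  - intros u v Huv. mink_lin. rewrite Kw by assumption. apply Kk; assumption.
  - intros u v Huv. mink_lin. destruct (cross_orth (pdv cu z u v) (pdv cv z u v) (n1 u v)) as (C1 & C2 & C3).
    unfold w. rewrite mink_sym, C3. ring.
  - intros u v x Huv. apply cross_nondegenerate. mink_lin. fold (w u v). rewrite Kw by assumption.
    intros H. generalize (Kk u v Huv). rewrite H. lra.
Qed.

(** * Parallel normal frames and the Ricci equation *)

Section Parallel.
Variables (D : R * R -> Prop) (z n1 n2 : R -> R -> R4).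
Hypothesis A : adapted_frame D z n1 n2.
Hypothesis Hpar : parallel D z n1.

Lemma unit_derivative n i u v : smooth_vec D n -> 
  (forall u v, D (u, v) -> mink (n u v) (n u v) = 1) -> D (u, v) ->
  mink (pdv i n u v) (n u v) = 0.
Proof.
  intros Hn H Huv.
  assert (E : pd i (fun s t => mink (n s t) (n s t)) u v = 0).
  { rewrite <- (pd_const i 1 u v). apply (pd_ext D); [apply A|assumption|assumption]. }
  rewrite (pd_mink D), (mink_sym (n u v)) in E by assumption. lra.
Qed.

Lemma parallel_n1 i u v : D (u, v) ->
  mink (pdv i n1 u v) (n1 u v) = 0 /\ mink (pdv i n1 u v) (n2 u v) = 0.
Proof.
  intros Huv. split; [apply unit_derivative; [apply A|apply A|assumption]|].
  generalize (Hpar u v Huv (basis_vec i)). unfold normal_conn.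
  rewrite (normal_part_frame _ _ _ _ A) by assumption. intros H.
  apply (f_equal (fun w => mink w (n2 u v))) in H. revert H. mink_lin.
  rewrite (af_n12 _ _ _ _ A), (af_n22 _ _ _ _ A), mink_zero_l by assumption.
  unfold flat_conn. mink_lin. destruct i; simpl; lra.
Qed.

(** In a normal plane, a unit field orthogonal to a parallel one is parallel. *)
Lemma parallel_n2 i u v : D (u, v) ->
  mink (pdv i n2 u v) (n1 u v) = 0 /\ mink (pdv i n2 u v) (n2 u v) = 0.
Proof.
  intros Huv. split; [|apply unit_derivative; [apply A|apply A|assumption]].
  assert (E : pd i (fun s t => mink (n1 s t) (n2 s t)) u v = 0).
  { rewrite <- (pd_const i 0 u v). apply (pd_ext D); [apply A|assumption|apply A]. }
  rewrite (pd_mink D) in E; [|apply A|apply A|assumption].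
  rewrite (proj2 (parallel_n1 i u v Huv)), (mink_sym (n1 u v)) in E. lra.
Qed.

(** The derivatives of n1 and n2 are tangent.  Differentiating <n1_u, n2> = 0 in v
    and <n1_v, n2> = 0 in u gives <n1_u, n2_v> = <n1_v, n2_u>, as n1_uv = n1_vu;
    in the frame this says that the two shape operators commute. *)
Lemma ricci_equation u v : D (u, v) ->
  let L1 := shape z n1 cu cu u v in let M1 := shape z n1 cu cv u v in let N1 := shape z n1 cv cv u v in
  let L2 := shape z n2 cu cu u v in let M2 := shape z n2 cu cv u v in let N2 := shape z n2 cv cv u v in
  metric z cv cv u v * (L1 * M2 - M1 * L2) - metric z cu cv u v * (L1 * N2 - N1 * L2)
  + metric z cu cu u v * (M1 * N2 - N1 * M2) = 0.
Proof.
  intros Huv L1 M1 N1 L2 M2 N2. pose proof (af_open _ _ _ _ A) as HO.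
  pose proof (af_n1 _ _ _ _ A) as S1. pose proof (af_n2 _ _ _ _ A) as S2.
  assert (Q : forall i j, mink (pdv j (pdv i n1) u v) (n2 u v) + mink (pdv i n1 u v) (pdv j n2 u v) = 0).
  { intros i j. rewrite <- (pd_mink D); [|apply smooth_vec_pdv; assumption|assumption|assumption].
    rewrite <- (pd_const j 0 u v). apply (pd_ext D); [assumption|assumption|].
    intros s t Hst. apply parallel_n1; assumption. }
  pose proof (Q cu cv) as Q1. pose proof (Q cv cu) as Q2.
  rewrite (pdv_comm D) in Q2 by assumption.
  assert (R : mink (pdv cu n1 u v) (pdv cv n2 u v) = mink (pdv cv n1 u v) (pdv cu n2 u v)) by lra.
  rewrite (mink_frame _ _ _ _ A u v (pdv cu n1 u v)), (mink_frame _ _ _ _ A u v (pdv cv n1 u v)) in R by assumption.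
  rewrite !(proj1 (parallel_n1 _ u v Huv)), !(proj1 (parallel_n2 _ u v Huv)),
   !(proj2 (parallel_n1 _ u v Huv)), !(proj2 (parallel_n2 _ u v Huv)) in R.
  assert (X1 := shape_sym _ _ _ _ A n1 u v S1 (af_n1z _ _ _ _ A) Huv).
  assert (X2 := shape_sym _ _ _ _ A n2 u v S2 (af_n2z _ _ _ _ A) Huv).
  unfold L1, M1, N1, L2, M2, N2. unfold shape in *.
  pose proof (af_det _ _ _ _ A u v Huv) as Hd. 
  assert (X1' : mink (pdv cv n1 u v) (pdv cu z u v) = mink (pdv cu n1 u v) (pdv cv z u v)) by lra.
  assert (X2' : mink (pdv cv n2 u v) (pdv cu z u v) = mink (pdv cu n2 u v) (pdv cv z u v)) by lra.
  rewrite X1', X2' in R. apply (Rmult_eq_compat_r (metric_det z u v)) in R.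
  field_simplify in R; [|assumption|assumption]. lra.
Qed.

Lemma trace_shape_n2 : collinear_with_H D z n1 -> forall u v, D (u, v) -> trace_shape z n2 u v = 0.
Proof.
  intros H u v Huv. destruct (H u v Huv) as [k Hk].
  rewrite (mean_curvature_frame _ _ _ _ A) in Hk by assumption.
  apply (f_equal (fun w => mink w (n2 u v))) in Hk. revert Hk. mink_lin.
  rewrite (af_n12 _ _ _ _ A), (af_n22 _ _ _ _ A) by assumption. lra.
Qed.

Lemma inflection_of_shape u v : D (u, v) ->
  shape z n2 cu cu u v = 0 -> shape z n2 cu cv u v = 0 -> shape z n2 cv cv u v = 0 ->
  inflection_point z u v.
Proof.
  intros Huv H1 H2 H3. exists (n1 u v). intros a Ha. induction Ha as [X Y|a b _ [k Hk] _ [l Hl]|k a _ [l Hl]].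
  - rewrite (sff_at_frame _ _ _ _ A) by assumption.
    rewrite (shape_sym _ _ _ _ A n2), H1, H2, H3 by (try apply A; assumption).
    match goal with |- exists k, vadd (vscal ?b _) _ = _ => exists b end.
    apply vec_eq; comps; ring.
  - exists (k + l). subst. apply vec_eq; comps; ring.
  - exists (k * l). subst. apply vec_eq; comps; ring.
Qed.

Lemma K_minus_H2_frame u v : D (u, v) ->
  K_minus_H2 z u v = (det_shape z n1 u v + det_shape z n2 u v) / metric_det z u v
    - (trace_shape z n1 u v / 2) ^ 2 - (trace_shape z n2 u v / 2) ^ 2.
Proof.
  intros Huv. unfold K_minus_H2. rewrite (gauss_equation _ _ _ _ A), (mean_curvature_frame _ _ _ _ A) by assumption.
  mink_lin. rewrite (mink_sym (n2 u v)), (af_n11 _ _ _ _ A), (af_n12 _ _ _ _ A), (af_n22 _ _ _ _ A) by assumption.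
  field. apply A. assumption.
Qed.

End Parallel.

(** * Null coframes *)

(** With [q12] and [q22]: the coefficients of the form
    L du^2 + 2 M du dv + N dv^2 on alpha^2, 2 alpha beta and beta^2, for the
    coframe alpha = a du + b dv, beta = c du + d dv; see [coframe_expand]. *)
Definition q11 (a b c d L M N : R) := (d * d * L - 2 * c * d * M + c * c * N) / (a * d - b * c) ^ 2.

Definition q12 (a b c d L M N : R) :=
  (- b * d * L + (a * d + b * c) * M - a * c * N) / (a * d - b * c) ^ 2.

Definition q22 (a b c d L M N : R) := (b * b * L - 2 * a * b * M + a * a * N) / (a * d - b * c) ^ 2.

Lemma coframe_expand a b c d L M N : a * d - b * c <> 0 ->
  let l := q11 a b c d L M N in let n := q12 a b c d L M N in let r := q22 a b c d L M N in
  L = l * a * a + 2 * n * a * c + r * c * c /\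
  M = l * a * b + n * (a * d + b * c) + r * c * d /\
  N = l * b * b + 2 * n * b * d + r * d * d.
Proof. intros H l n r; unfold l, n, r, q11, q12, q22; repeat split; field; assumption. Qed.

(** The metric is 2 m (a du + b dv) (c du + d dv); requiring m < 0 orients the two
    null directions as isotropic parameters demand. *)
Record null_coframe (D : R * R -> Prop) (z : R -> R -> R4) (a b c d m : R -> R -> R) : Prop := {
  nc_a : smooth D a; nc_b : smooth D b; nc_c : smooth D c; nc_d : smooth D d; nc_m : smooth D m;
  nc_jac : forall u v, D (u, v) -> a u v * d u v - b u v * c u v <> 0;
  nc_neg : forall u v, D (u, v) -> m u v < 0;
  nc_E : forall u v, D (u, v) -> metric z cu cu u v = 2 * m u v * a u v * c u v;
  nc_F : forall u v, D (u, v) -> metric z cu cv u v = m u v * (a u v * d u v + b u v * c u v);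
  nc_G : forall u v, D (u, v) -> metric z cv cv u v = 2 * m u v * b u v * d u v }.

Definition coframe_comp (q : R -> R -> R -> R -> R -> R -> R -> R) (a b c d : R -> R -> R)
    (z n : R -> R -> R4) (u v : R) : R :=
  q (a u v) (b u v) (c u v) (d u v) (shape z n cu cu u v) (shape z n cu cv u v) (shape z n cv cv u v).

Section NullCoframe.
Variables (D : R * R -> Prop) (z n1 n2 : R -> R -> R4) (a b c d m : R -> R -> R).
Hypothesis A : adapted_frame D z n1 n2.
Hypothesis Hpar : parallel D z n1.
Hypothesis Hcol : collinear_with_H D z n1.
Hypothesis C : null_coframe D z a b c d m.

(** For the metric 2 m alpha beta, the trace of a quadratic form is a multiple of
    its coefficient on alpha beta. *)
Lemma coframe_n2_diagonal u v : D (u, v) -> coframe_comp q12 a b c d z n2 u v = 0.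
Proof.
  intros Huv. pose proof (trace_shape_n2 _ _ _ _ A Hcol u v Huv) as H. unfold trace_shape in H.
  pose proof (af_det _ _ _ _ A u v Huv) as Hd. pose proof (nc_neg _ _ _ _ _ _ _ C u v Huv) as Hm.
  pose proof (nc_jac _ _ _ _ _ _ _ C u v Huv) as HJ.
  unfold coframe_comp, q12. apply (Rmult_eq_compat_r (metric_det z u v)) in H.
  field_simplify in H; [|assumption].
  rewrite (nc_E _ _ _ _ _ _ _ C), (nc_F _ _ _ _ _ _ _ C), (nc_G _ _ _ _ _ _ _ C) in H by assumption.
  apply (Rmult_eq_reg_l (-2 * m u v * (a u v * d u v - b u v * c u v) ^ 2)).
  - field_simplify; [|assumption]. rewrite <- H. ring.
  - apply Rmult_integral_contrapositive. split; [lra|apply pow_nonzero; assumption].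
Qed.

Lemma coframe_metric_det u v : D (u, v) ->
  metric_det z u v = - (m u v * (a u v * d u v - b u v * c u v)) ^ 2.
Proof.
  intros Huv. unfold metric_det.
  rewrite (nc_E _ _ _ _ _ _ _ C), (nc_F _ _ _ _ _ _ _ C), (nc_G _ _ _ _ _ _ _ C) by assumption. ring.
Qed.

Lemma coframe_ricci u v : D (u, v) ->
  coframe_comp q11 a b c d z n1 u v * coframe_comp q22 a b c d z n2 u v =
  coframe_comp q22 a b c d z n1 u v * coframe_comp q11 a b c d z n2 u v.
Proof.
  intros Huv. pose proof (ricci_equation _ _ _ _ A Hpar u v Huv) as H. cbv zeta in H.
  pose proof (coframe_n2_diagonal u v Huv) as H2.
  pose proof (nc_neg _ _ _ _ _ _ _ C u v Huv) as Hm.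
  pose proof (nc_jac _ _ _ _ _ _ _ C u v Huv) as HJ.
  rewrite (nc_E _ _ _ _ _ _ _ C), (nc_F _ _ _ _ _ _ _ C), (nc_G _ _ _ _ _ _ _ C) in H by assumption.
  destruct (coframe_expand _ _ _ _ (shape z n1 cu cu u v) (shape z n1 cu cv u v) (shape z n1 cv cv u v) HJ) as (E1 & E2 & E3).
  destruct (coframe_expand _ _ _ _ (shape z n2 cu cu u v) (shape z n2 cu cv u v) (shape z n2 cv cv u v) HJ) as (F1 & F2 & F3).
  fold (coframe_comp q11 a b c d z n1 u v) (coframe_comp q12 a b c d z n1 u v) (coframe_comp q22 a b c d z n1 u v) in E1, E2, E3.
  fold (coframe_comp q11 a b c d z n2 u v) (coframe_comp q12 a b c d z n2 u v) (coframe_comp q22 a b c d z n2 u v) in F1, F2, F3.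
  rewrite H2 in F1, F2, F3. rewrite E1, E2, E3, F1, F2, F3 in H. clear - H Hm HJ.
  revert H Hm HJ. generalize (coframe_comp q11 a b c d z n1 u v) (coframe_comp q12 a b c d z n1 u v) (coframe_comp q22 a b c d z n1 u v)
   (coframe_comp q11 a b c d z n2 u v) (coframe_comp q22 a b c d z n2 u v) (a u v) (b u v) (c u v) (d u v) (m u v).
  clear. intros l n r p q a b c d m H Hm HJ.
  assert (H' : m * (a * d - b * c) ^ 3 * (r * p - l * q) = 0) by (rewrite <- H; ring).
  apply Rmult_integral in H'. destruct H' as [H'|H']; [|lra].
  apply Rmult_integral in H'. destruct H' as [H'|H']; [lra|].
  exfalso. apply (pow_nonzero _ 3 HJ H').
Qed.

Lemma coframe_K_minus_H2 u v : D (u, v) ->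
  K_minus_H2 z u v = - (coframe_comp q11 a b c d z n1 u v * coframe_comp q22 a b c d z n1 u v
    + coframe_comp q11 a b c d z n2 u v * coframe_comp q22 a b c d z n2 u v) / m u v ^ 2.
Proof.
  intros Huv. rewrite (K_minus_H2_frame _ _ _ _ A) by assumption.
  rewrite (trace_shape_n2 _ _ _ _ A Hcol) by assumption.
  unfold trace_shape, det_shape.
  rewrite coframe_metric_det by assumption.
  pose proof (coframe_n2_diagonal u v Huv) as H2.
  pose proof (nc_neg _ _ _ _ _ _ _ C u v Huv) as Hm.
  pose proof (nc_jac _ _ _ _ _ _ _ C u v Huv) as HJ.
  rewrite (nc_E _ _ _ _ _ _ _ C), (nc_F _ _ _ _ _ _ _ C), (nc_G _ _ _ _ _ _ _ C) by assumption.
  destruct (coframe_expand _ _ _ _ (shape z n1 cu cu u v) (shape z n1 cu cv u v) (shape z n1 cv cv u v) HJ) as (E1 & E2 & E3).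
  destruct (coframe_expand _ _ _ _ (shape z n2 cu cu u v) (shape z n2 cu cv u v) (shape z n2 cv cv u v) HJ) as (F1 & F2 & F3).
  fold (coframe_comp q11 a b c d z n1 u v) (coframe_comp q12 a b c d z n1 u v) (coframe_comp q22 a b c d z n1 u v) in E1, E2, E3.
  fold (coframe_comp q11 a b c d z n2 u v) (coframe_comp q12 a b c d z n2 u v) (coframe_comp q22 a b c d z n2 u v) in F1, F2, F3.
  rewrite H2 in F1, F2, F3. rewrite E1, E2, E3, F1, F2, F3. clear - Hm HJ.
  field. split; intro Hz; [lra|apply HJ; lra].
Qed.

(** Let l, r and p, q be the coefficients of h1 and h2.  If p = 0, then l q = r p
    leaves q = 0 or l = 0; in the latter case l r + p q = 0, against
    K - H^2 <> 0, and in the former h2 = 0, against the absence of inflection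
    points. *)
Lemma coframe_n2_nonzero u v : D (u, v) -> ~ inflection_point z u v -> K_minus_H2 z u v <> 0 ->
  coframe_comp q11 a b c d z n2 u v <> 0 /\ coframe_comp q22 a b c d z n2 u v <> 0.
Proof.
  intros Huv Hinf HK. rewrite coframe_K_minus_H2 in HK by assumption.
  pose proof (coframe_ricci u v Huv) as HR. pose proof (coframe_n2_diagonal u v Huv) as H2.
  pose proof (nc_jac _ _ _ _ _ _ _ C u v Huv) as HJ.
  pose proof (nc_neg _ _ _ _ _ _ _ C u v Huv) as Hm.
  destruct (coframe_expand _ _ _ _ (shape z n2 cu cu u v) (shape z n2 cu cv u v) (shape z n2 cv cv u v) HJ) as (F1 & F2 & F3).
  fold (coframe_comp q11 a b c d z n2 u v) (coframe_comp q12 a b c d z n2 u v) (coframe_comp q22 a b c d z n2 u v) in F1, F2, F3.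
  rewrite H2 in F1, F2, F3.
  assert (B : ~ (coframe_comp q11 a b c d z n2 u v = 0 /\ coframe_comp q22 a b c d z n2 u v = 0)).
  { intros [B1 B2]. apply Hinf. apply (inflection_of_shape _ _ _ _ A); [assumption|..].
    - rewrite F1, B1, B2. ring.
    - rewrite F2, B1, B2. ring.
    - rewrite F3, B1, B2. ring. }
  revert HR B HK. generalize (coframe_comp q11 a b c d z n1 u v) (coframe_comp q22 a b c d z n1 u v)
   (coframe_comp q11 a b c d z n2 u v) (coframe_comp q22 a b c d z n2 u v). intros l r p q HR B HK.
  assert (HK' : l * r + p * q <> 0).
  { intros E. apply HK. rewrite E. field. lra. }
  split; intros E; subst.
  - assert (q = 0 \/ l = 0) by (apply Rmult_integral; lra). 
    destruct H as [H|H]; [tauto|]. subst. apply HK'. ring.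
  - assert (p = 0 \/ r = 0) by (apply Rmult_integral; lra). 
    destruct H as [H|H]; [tauto|]. subst. apply HK'. ring.
Qed.

End NullCoframe.

Lemma sign_cases x : x <> 0 -> exists e, (e = 1 \/ e = -1) /\ 0 < e * x.
Proof.
  intros Hx. destruct (Rlt_or_le 0 x) as [H|H]; [exists 1|exists (-1)]; split; auto; lra.
Qed.

(** If rho^2 - 2 F rho + E G = 0, then rho (E du^2 + 2 F du dv + G dv^2) is the
    product (rho du + G dv) (E du + rho dv).  The root rho = F + s sqrt (F^2 - E G),
    with s the sign of F at the centre, does not vanish nearby, even at points
    where E or G does. *)
Lemma null_coframe_exists D z u0 v0 : open D -> smooth_vec D z ->
  (forall u v, D (u, v) -> metric_det z u v < 0) -> D (u0, v0) ->
  exists r a b c d m, 0 < r /\ (forall q, box u0 v0 r q -> D q) /\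
    null_coframe (box u0 v0 r) z a b c d m.
Proof.
  intros HO Hz Hdet H0.
  assert (SM : forall i j, smooth D (metric z i j))
    by (intros; apply (smooth_mink D (pdv i z) (pdv j z)); [assumption|apply smooth_vec_pdv; assumption..]).
  set (E := metric z cu cu) in *. set (F := metric z cu cv) in *. set (G := metric z cv cv) in *.
  assert (SE : smooth D E) by apply SM. assert (SF : smooth D F) by apply SM.
  assert (SG : smooth D G) by apply SM.
  assert (Hs : exists s, (s = 1 \/ s = -1) /\ 0 <= s * F u0 v0).
  { destruct (Rle_or_lt 0 (F u0 v0)); [exists 1|exists (-1)]; split; auto; lra. }
  destruct Hs as (s & Hs & HsF).
  set (w := fun u v => sqrt (F u v ^ 2 - E u v * G u v)).
  assert (Hw0 : forall u v, D (u, v) -> 0 < F u v ^ 2 - E u v * G u v).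
  { intros u v Huv. generalize (Hdet u v Huv). unfold metric_det. fold (E u v) (F u v) (G u v). lra. }
  assert (Hw : forall u v, D (u, v) -> 0 < w u v /\ w u v * w u v = F u v ^ 2 - E u v * G u v).
  { intros u v Huv. split; [apply sqrt_lt_R0; auto|apply sqrt_sqrt; left; auto]. }
  assert (Sw : smooth D w) by (unfold w; smooth_tac; exact Hw0).
  set (rho := fun u v => F u v + s * w u v).
  assert (Sr : smooth D rho) by (unfold rho; smooth_tac).
  assert (Hr0 : 0 < s * rho u0 v0).
  { unfold rho. destruct (Hw u0 v0 H0) as [Hw1 _]. destruct Hs; subst; lra. }
  assert (Hloc : locally_2d (fun u v => D (u, v) /\ 0 < s * rho u v) u0 v0).
  { apply locally_2d_and; [apply open_locally_2d; assumption|].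
    apply (smooth_positive_locally D (fun u v => s * rho u v)); [smooth_tac|assumption|assumption]. }
  apply locally_2d_box in Hloc. destruct Hloc as (r & Hr & Hbox).
  assert (HB : forall q, box u0 v0 r q -> D q) by (intros [u v] Hq; apply (Hbox u v Hq)).
  pose proof (box_open u0 v0 r) as HBo.
  assert (SE' := smooth_sub _ _ _ HB SE). assert (SG' := smooth_sub _ _ _ HB SG).
  assert (Sr' := smooth_sub _ _ _ HB Sr).
  assert (Hrn : forall u v, box u0 v0 r (u, v) -> 0 < s * rho u v /\ rho u v <> 0).
  { intros u v Hq. split; [apply Hbox; assumption|]. intros Hz'. generalize (proj2 (Hbox u v Hq)). rewrite Hz'. lra. }
  assert (Hq : forall u v, box u0 v0 r (u, v) -> rho u v * rho u v + E u v * G u v = 2 * F u v * rho u v).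
  { intros u v Hq. destruct (Hw u v (HB _ Hq)) as [_ Hw2].
    assert (E u v * G u v = F u v ^ 2 - w u v * w u v) by lra. rewrite H. unfold rho.
    assert (s * s = 1) by (destruct Hs; subst; lra).
    replace ((F u v + s * w u v) * (F u v + s * w u v))
      with (F u v ^ 2 + 2 * s * F u v * w u v + (s * s) * (w u v * w u v)) by ring.
    rewrite H1. ring. }
  exists r, (fun u v => - s * rho u v), (fun u v => - s * G u v), E, rho, (fun u v => - s / (2 * rho u v)).
  split; [assumption|split; [assumption|]].
  constructor; try assumption; try smooth_tac.
  - intros u v Huv. generalize (Hrn u v Huv). lra.
  - intros u v Huv. destruct (Hrn u v Huv) as [P1 P2]. destruct (Hw u v (HB _ Huv)) as [Hw1 _].
    specialize (Hq u v Huv).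
    replace (- s * rho u v * rho u v - - s * G u v * E u v) with (-2 * (w u v) * rho u v * (s * s)).
    + replace (s * s) with 1 by (destruct Hs; subst; lra).
      repeat apply Rmult_integral_contrapositive_currified; lra.
    + replace (- s * rho u v * rho u v - - s * G u v * E u v) 
        with (- s * (2 * (rho u v * rho u v) - (rho u v * rho u v + E u v * G u v))) by ring.
      rewrite Hq. unfold rho. ring.
  - intros u v Huv. destruct (Hrn u v Huv) as [P1 P2].
    replace (- s / (2 * rho u v)) with (- / (2 * (s * rho u v))).
    + assert (0 < / (2 * (s * rho u v))) by (apply Rinv_0_lt_compat; lra). lra.
    + destruct Hs; subst; field; lra.
  - intros u v Huv. destruct (Hrn u v Huv) as [P1 P2]. fold E.
    destruct Hs; subst; field; lra.
  - intros u v Huv. destruct (Hrn u v Huv) as [P1 P2]. fold F. specialize (Hq u v Huv).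
    transitivity ((2 * F u v * rho u v) / (2 * rho u v)); [field; assumption|].
    rewrite <- Hq. destruct Hs; subst; field; lra.
  - intros u v Huv. destruct (Hrn u v Huv) as [P1 P2]. fold G.
    destruct Hs; subst; field; lra.
Qed.

(** Multiplying the two forms by s and t divides the coefficients of h2 by s^2
    and t^2, and m by s t; so s and t are the square roots of the absolute values
    of these coefficients, whose signs are locally constant. *)
Lemma null_coframe_normalize D z n1 n2 a b c d m u0 v0 : adapted_frame D z n1 n2 ->
  null_coframe D z a b c d m -> D (u0, v0) ->
  (forall u v, D (u, v) -> coframe_comp q11 a b c d z n2 u v <> 0 /\ coframe_comp q22 a b c d z n2 u v <> 0) ->
  exists r e1 e2 a' b' c' d' m', 0 < r /\ (forall q, box u0 v0 r q -> D q) /\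
    (e1 = 1 \/ e1 = -1) /\ (e2 = 1 \/ e2 = -1) /\
    null_coframe (box u0 v0 r) z a' b' c' d' m' /\
    forall u v, box u0 v0 r (u, v) ->
      coframe_comp q11 a' b' c' d' z n2 u v = e1 /\ coframe_comp q22 a' b' c' d' z n2 u v = e2.
Proof.
  intros A C H0 Hn. pose proof (af_open _ _ _ _ A) as HO.
  pose proof (nc_a _ _ _ _ _ _ _ C) as Sa. pose proof (nc_b _ _ _ _ _ _ _ C) as Sb.
  pose proof (nc_c _ _ _ _ _ _ _ C) as Sc. pose proof (nc_d _ _ _ _ _ _ _ C) as Sd.
  pose proof (nc_m _ _ _ _ _ _ _ C) as Sm.
  set (p := coframe_comp q11 a b c d z n2) in *. set (q := coframe_comp q22 a b c d z n2) in *.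
  assert (SS : forall i j, smooth D (shape z n2 i j)) by (intros; apply smooth_shape; [assumption|apply A..]).
  assert (Sp : smooth D p).
  { pose proof (SS cu cu); pose proof (SS cu cv); pose proof (SS cv cv).
    unfold p, coframe_comp, q11. smooth_tac. intros u v Huv. apply pow_nonzero. apply (nc_jac _ _ _ _ _ _ _ C u v Huv). }
  assert (Sq : smooth D q).
  { pose proof (SS cu cu); pose proof (SS cu cv); pose proof (SS cv cv).
    unfold q, coframe_comp, q22. smooth_tac. intros u v Huv. apply pow_nonzero. apply (nc_jac _ _ _ _ _ _ _ C u v Huv). }
  destruct (sign_cases _ (proj1 (Hn u0 v0 H0))) as (e1 & He1 & Hp1).
  destruct (sign_cases _ (proj2 (Hn u0 v0 H0))) as (e2 & He2 & Hp2).
  assert (Hloc : locally_2d (fun u v => D (u, v) /\ (0 < e1 * p u v /\ 0 < e2 * q u v)) u0 v0).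
  { apply locally_2d_and; [apply open_locally_2d; assumption|apply locally_2d_and].
    - apply (smooth_positive_locally D (fun u v => e1 * p u v)); [smooth_tac|assumption|assumption].
    - apply (smooth_positive_locally D (fun u v => e2 * q u v)); [smooth_tac|assumption|assumption]. }
  apply locally_2d_box in Hloc. destruct Hloc as (r & Hr & Hbox).
  assert (HB : forall q, box u0 v0 r q -> D q) by (intros [u v] Hq; apply (Hbox u v Hq)).
  pose proof (box_open u0 v0 r) as HBo.
  apply (smooth_sub _ _ _ HB) in Sa. apply (smooth_sub _ _ _ HB) in Sb.
  apply (smooth_sub _ _ _ HB) in Sc. apply (smooth_sub _ _ _ HB) in Sd.
  apply (smooth_sub _ _ _ HB) in Sm. apply (smooth_sub _ _ _ HB) in Sp. apply (smooth_sub _ _ _ HB) in Sq.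
  set (s := fun u v => sqrt (e1 * p u v)). set (t := fun u v => sqrt (e2 * q u v)).
  assert (Ss : smooth (box u0 v0 r) s) by (unfold s; smooth_tac; intros u v Huv; apply (Hbox u v Huv)).
  assert (St : smooth (box u0 v0 r) t) by (unfold t; smooth_tac; intros u v Huv; apply (Hbox u v Huv)).
  assert (Hst : forall u v, box u0 v0 r (u, v) -> 0 < s u v /\ 0 < t u v /\
     s u v * s u v = e1 * p u v /\ t u v * t u v = e2 * q u v).
  { intros u v Huv. destruct (Hbox u v Huv) as (_ & P1 & P2).
    repeat split; [apply sqrt_lt_R0|apply sqrt_lt_R0|apply sqrt_sqrt|apply sqrt_sqrt]; lra. }
  exists r, e1, e2, (fun u v => s u v * a u v), (fun u v => s u v * b u v),
    (fun u v => t u v * c u v), (fun u v => t u v * d u v), (fun u v => m u v / (s u v * t u v)).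
  assert (HJ : forall u v, box u0 v0 r (u, v) -> a u v * d u v - b u v * c u v <> 0)
    by (intros u v Huv; apply (nc_jac _ _ _ _ _ _ _ C), HB, Huv).
  split; [assumption|split; [assumption|split; [assumption|split; [assumption|split]]]].
  - constructor; try smooth_tac.
    + intros u v Huv. destruct (Hst u v Huv) as (P1 & P2 & _).
      apply Rmult_integral_contrapositive_currified; lra.
    + intros u v Huv. destruct (Hst u v Huv) as (P1 & P2 & _).
      replace (s u v * a u v * (t u v * d u v) - s u v * b u v * (t u v * c u v))
        with (s u v * t u v * (a u v * d u v - b u v * c u v)) by ring.
      repeat apply Rmult_integral_contrapositive_currified; try lra. apply HJ; assumption.
    + intros u v Huv. destruct (Hst u v Huv) as (P1 & P2 & _).
      generalize (nc_neg _ _ _ _ _ _ _ C u v (HB _ Huv)). intros Hm.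
      assert (0 < / (s u v * t u v)) by (apply Rinv_0_lt_compat, Rmult_lt_0_compat; assumption).
      unfold Rdiv. apply Rmult_neg_pos; assumption.
    + intros u v Huv. destruct (Hst u v Huv) as (P1 & P2 & _).
      rewrite (nc_E _ _ _ _ _ _ _ C) by (apply HB; assumption). field. lra.
    + intros u v Huv. destruct (Hst u v Huv) as (P1 & P2 & _).
      rewrite (nc_F _ _ _ _ _ _ _ C) by (apply HB; assumption). field. lra.
    + intros u v Huv. destruct (Hst u v Huv) as (P1 & P2 & _).
      rewrite (nc_G _ _ _ _ _ _ _ C) by (apply HB; assumption). field. lra.
  - intros u v Huv. destruct (Hst u v Huv) as (P1 & P2 & P3 & P4). pose proof (HJ u v Huv) as HJu.
    split.
    + transitivity (p u v / (s u v * s u v)).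
      * unfold p, coframe_comp, q11. field. repeat split; try lra.
        replace (s u v * a u v * (t u v * d u v) - s u v * b u v * (t u v * c u v))
          with (s u v * t u v * (a u v * d u v - b u v * c u v)) by ring.
        repeat apply Rmult_integral_contrapositive_currified; lra.
      * rewrite P3. assert (p u v <> 0) by (intros Hz; rewrite Hz in P3; nra).
        destruct He1; subst e1; field; assumption.
    + transitivity (q u v / (t u v * t u v)).
      * unfold q, coframe_comp, q22. field. repeat split; try lra.
        replace (s u v * a u v * (t u v * d u v) - s u v * b u v * (t u v * c u v))
          with (s u v * t u v * (a u v * d u v - b u v * c u v)) by ring.
        repeat apply Rmult_integral_contrapositive_currified; lra.
      * rewrite P4. assert (q u v <> 0) by (intros Hz; rewrite Hz in P4; nra).
        destruct He2; subst e2; field; assumption.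
Qed.

(** * The normalized null coframe is closed *)

(** The form h2 = eps1 alpha^2 + eps2 beta^2 makes beta = c du + d dv closed: this is
    the Codazzi equation.  Put x = <e1, e2_v> and y = <e1, e2_u>.  Pairing
    z_uv = z_vu with e1 gives d y - c x = m (c_v - d_u), while pairing n_uv = n_vu
    with e2 gives d y - c x = - m (c_v - d_u). *)
Lemma second_form_closed D z n e1 e2 a b c d m eps1 eps2 :
  open D -> smooth_vec D z -> smooth_vec D n -> smooth_vec D e1 -> smooth_vec D e2 ->
  smooth D c -> smooth D d -> smooth D m -> eps2 <> 0 ->
  (forall u v, D (u, v) ->
    m u v <> 0 /\
    pdv cu z u v = vadd (vscal (a u v) (e1 u v)) (vscal (c u v) (e2 u v)) /\
    pdv cv z u v = vadd (vscal (b u v) (e1 u v)) (vscal (d u v) (e2 u v)) /\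
    mink (e1 u v) (e1 u v) = 0 /\ mink (e2 u v) (e2 u v) = 0 /\ mink (e1 u v) (e2 u v) = m u v /\
    pdv cu n u v = vscal (- / m u v)
      (vadd (vscal (eps2 * c u v) (e1 u v)) (vscal (eps1 * a u v) (e2 u v))) /\
    pdv cv n u v = vscal (- / m u v)
      (vadd (vscal (eps2 * d u v) (e1 u v)) (vscal (eps1 * b u v) (e2 u v)))) ->
  forall u v, D (u, v) -> pd cv c u v = pd cu d u v.
Proof.
  intros HO Hz Hn H1 H2 Sc Sd Sm He H u v Huv.
  assert (K : forall i F G l, smooth_vec D F -> smooth_vec D G ->
     (forall s t, D (s, t) -> mink (F s t) (G s t) = l s t) ->
     mink (pdv i F u v) (G u v) + mink (F u v) (pdv i G u v) = pd i l u v).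
  { intros i F G l HF HG HFG. rewrite <- (pd_mink D) by assumption.
    apply (pd_ext D); assumption. }
  assert (E22 : forall i, mink (e2 u v) (pdv i e2 u v) = 0).
  { intros i. generalize (K i e2 e2 (fun _ _ => 0) H2 H2 ltac:(intros s t Hst; apply (H s t Hst))).
    rewrite pd_const, (mink_sym (pdv i e2 u v)). lra. }
  assert (E11 : forall i, mink (e1 u v) (pdv i e1 u v) = 0).
  { intros i. generalize (K i e1 e1 (fun _ _ => 0) H1 H1 ltac:(intros s t Hst; apply (H s t Hst))).
    rewrite pd_const, (mink_sym (pdv i e1 u v)). lra. }
  assert (E12 : forall i, mink (e2 u v) (pdv i e1 u v) = pd i m u v - mink (e1 u v) (pdv i e2 u v)).
  { intros i. generalize (K i e1 e2 m H1 H2 ltac:(intros s t Hst; apply (H s t Hst))).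
    rewrite (mink_sym (pdv i e1 u v)). lra. }
  pose proof (fun i f (Hf : smooth D f) => pd_scal i (- eps2) f u v (smooth_pdble D f u v Hf Huv)) as PS.
  assert (N1 : mink (pdv cv (pdv cu n) u v) (e2 u v) + mink (pdv cu n u v) (pdv cv e2 u v) = - eps2 * pd cv c u v).
  { rewrite <- PS by assumption. apply K; [apply smooth_vec_pdv; assumption|assumption|].
    intros s t Hst. destruct (H s t Hst) as (P0 & P1 & P2 & P3 & P4 & P5 & P6 & P7).
    rewrite P6. mink_lin. rewrite P4, P5. field. assumption. }
  assert (N2 : mink (pdv cu (pdv cv n) u v) (e2 u v) + mink (pdv cv n u v) (pdv cu e2 u v) = - eps2 * pd cu d u v).
  { rewrite <- PS by assumption. apply K; [apply smooth_vec_pdv; assumption|assumption|].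
    intros s t Hst. destruct (H s t Hst) as (P0 & P1 & P2 & P3 & P4 & P5 & P6 & P7).
    rewrite P7. mink_lin. rewrite P4, P5. field. assumption. }
  assert (Z1 : mink (pdv cv (pdv cu z) u v) (e1 u v) + mink (pdv cu z u v) (pdv cv e1 u v)
     = pd cv c u v * m u v + c u v * pd cv m u v).
  { rewrite <- pd_mult by (apply (smooth_pdble D); assumption).
    apply K; [apply smooth_vec_pdv; assumption|assumption|].
    intros s t Hst. destruct (H s t Hst) as (P0 & P1 & P2 & P3 & P4 & P5 & P6 & P7).
    rewrite P1. mink_lin. rewrite P3, (mink_sym (e2 s t)), P5. ring. }
  assert (Z2 : mink (pdv cu (pdv cv z) u v) (e1 u v) + mink (pdv cv z u v) (pdv cu e1 u v)
     = pd cu d u v * m u v + d u v * pd cu m u v).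
  { rewrite <- pd_mult by (apply (smooth_pdble D); assumption).
    apply K; [apply smooth_vec_pdv; assumption|assumption|].
    intros s t Hst. destruct (H s t Hst) as (P0 & P1 & P2 & P3 & P4 & P5 & P6 & P7).
    rewrite P2. mink_lin. rewrite P3, (mink_sym (e2 s t)), P5. ring. }
  rewrite (pdv_comm D n) in N2 by assumption. rewrite (pdv_comm D z) in Z2 by assumption.
  destruct (H u v Huv) as (P0 & P1 & P2 & P3 & P4 & P5 & P6 & P7).
  rewrite P6 in N1. rewrite P7 in N2. rewrite P1 in Z1. rewrite P2 in Z2.
  revert N1 N2 Z1 Z2. mink_lin. rewrite ?E22, ?E11, ?E12. intros N1 N2 Z1 Z2.
  set (x := mink (e1 u v) (pdv cv e2 u v)) in *. set (y := mink (e1 u v) (pdv cu e2 u v)) in *.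
  assert (Q1 : (pd cv c u v - pd cu d u v) * m u v = d u v * y - c u v * x) by lra.
  assert (Q2 : eps2 * (- / m u v * (d u v * y - c u v * x)) = eps2 * (pd cv c u v - pd cu d u v)) by lra.
  apply Rmult_eq_reg_l in Q2; [|assumption]. rewrite <- Q1 in Q2.
  replace (- / m u v * ((pd cv c u v - pd cu d u v) * m u v)) with (- (pd cv c u v - pd cu d u v)) in Q2
    by (field; assumption).
  lra.
Qed.

(** [dual1] and [dual2] are the images in space of the frame dual to the coframe. *)
Definition dual1 (z : R -> R -> R4) (a b c d : R -> R -> R) (u v : R) : R4 :=
  push z u v (d u v / (a u v * d u v - b u v * c u v), - c u v / (a u v * d u v - b u v * c u v)).

Definition dual2 (z : R -> R -> R4) (a b c d : R -> R -> R) (u v : R) : R4 :=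
  push z u v (- b u v / (a u v * d u v - b u v * c u v), a u v / (a u v * d u v - b u v * c u v)).

Section NormalizedCoframe.
Variables (D : R * R -> Prop) (z n1 n2 : R -> R -> R4) (a b c d m : R -> R -> R) (eps1 eps2 : R).
Hypothesis A : adapted_frame D z n1 n2.
Hypothesis Hpar : parallel D z n1.
Hypothesis Hcol : collinear_with_H D z n1.
Hypothesis C : null_coframe D z a b c d m.
Hypothesis Heps1 : eps1 <> 0.
Hypothesis Heps2 : eps2 <> 0.
Hypothesis Hq : forall u v, D (u, v) ->
      coframe_comp q11 a b c d z n2 u v = eps1 /\ coframe_comp q22 a b c d z n2 u v = eps2.

Lemma smooth_push X : smooth D (fun u v => fst (X u v)) -> smooth D (fun u v => snd (X u v)) ->
  smooth_vec D (fun u v => push z u v (X u v)).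
Proof.
  intros H1 H2. pose proof (af_open _ _ _ _ A). pose proof (af_z _ _ _ _ A).
  apply smooth_vec_add; [assumption|..]; apply smooth_vec_scal; try assumption;
    apply smooth_vec_pdv; assumption.
Qed.

Lemma smooth_dual1 : smooth_vec D (dual1 z a b c d).
Proof.
  pose proof (af_open _ _ _ _ A) as HO. destruct C as [Sa Sb Sc Sd _ HJ _ _ _ _].
  apply (smooth_push (fun u v => (d u v / (a u v * d u v - b u v * c u v),
    - c u v / (a u v * d u v - b u v * c u v)))); cbn [fst snd]; smooth_tac; exact HJ.
Qed.

Lemma smooth_dual2 : smooth_vec D (dual2 z a b c d).
Proof.
  pose proof (af_open _ _ _ _ A) as HO. destruct C as [Sa Sb Sc Sd _ HJ _ _ _ _].
  apply (smooth_push (fun u v => (- b u v / (a u v * d u v - b u v * c u v),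
    a u v / (a u v * d u v - b u v * c u v)))); cbn [fst snd]; smooth_tac; exact HJ.
Qed.

Lemma dual_expand u v : D (u, v) ->
  pdv cu z u v = vadd (vscal (a u v) (dual1 z a b c d u v)) (vscal (c u v) (dual2 z a b c d u v)) /\
  pdv cv z u v = vadd (vscal (b u v) (dual1 z a b c d u v)) (vscal (d u v) (dual2 z a b c d u v)).
Proof.
  intros Huv. pose proof (nc_jac _ _ _ _ _ _ _ C u v Huv) as HJ.
  unfold dual1, dual2, push. cbn [fst snd]. split; apply vec_eq; comps; field; assumption.
Qed.

Lemma dual_metric u v : D (u, v) ->
  let e1 := dual1 z a b c d u v in let e2 := dual2 z a b c d u v in
  mink e1 e1 = 0 /\ mink e2 e2 = 0 /\ mink e1 e2 = m u v.
Proof.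
  intros Huv e1 e2. pose proof (nc_jac _ _ _ _ _ _ _ C u v Huv) as HJ.
  unfold e1, e2, dual1, dual2. rewrite !mink_push. cbn [fst snd].
  rewrite (nc_E _ _ _ _ _ _ _ C), (nc_F _ _ _ _ _ _ _ C), (nc_G _ _ _ _ _ _ _ C) by assumption.
  repeat split; field; assumption.
Qed.

Lemma n2_derivatives u v : D (u, v) ->
  let e1 := dual1 z a b c d u v in let e2 := dual2 z a b c d u v in
  pdv cu n2 u v = vscal (- / m u v) (vadd (vscal (eps2 * c u v) e1) (vscal (eps1 * a u v) e2)) /\
  pdv cv n2 u v = vscal (- / m u v) (vadd (vscal (eps2 * d u v) e1) (vscal (eps1 * b u v) e2)).
Proof.
  intros Huv e1 e2. pose proof (nc_jac _ _ _ _ _ _ _ C u v Huv) as HJ.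
  pose proof (nc_neg _ _ _ _ _ _ _ C u v Huv) as Hm.
  destruct (coframe_expand _ _ _ _ (shape z n2 cu cu u v) (shape z n2 cu cv u v) (shape z n2 cv cv u v) HJ) as (F1 & F2 & F3).
  fold (coframe_comp q11 a b c d z n2 u v) (coframe_comp q12 a b c d z n2 u v) (coframe_comp q22 a b c d z n2 u v) in F1, F2, F3.
  rewrite (coframe_n2_diagonal _ _ _ _ _ _ _ _ _ A Hcol C u v Huv) in F1, F2, F3.
  destruct (Hq u v Huv) as [Q1 Q2]. rewrite Q1, Q2 in F1, F2, F3.
  pose proof (shape_sym _ _ _ _ A n2 u v (af_n2 _ _ _ _ A) (af_n2z _ _ _ _ A) Huv) as F4.
  destruct (dual_metric u v Huv) as (M1 & M2 & M3). destruct (dual_expand u v Huv) as (X1 & X2).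
  fold e1 in M1, M3, X1, X2. fold e2 in M2, M3, X1, X2.
  assert (Ne1 : mink e1 (n1 u v) = 0 /\ mink e2 (n1 u v) = 0).
  { split; rewrite mink_sym; apply push_normal; intros; apply A; assumption. }
  assert (Ne2 : mink e1 (n2 u v) = 0 /\ mink e2 (n2 u v) = 0).
  { split; rewrite mink_sym; apply push_normal; intros; apply A; assumption. }
  destruct Ne1 as [Ne1 Ne1'], Ne2 as [Ne2 Ne2'].
  rewrite F2 in F4. unfold shape in F1, F2, F3, F4.
  split; apply vsub_zero; apply (af_basis _ _ _ _ A u v); try assumption; mink_lin;
    rewrite ?(proj1 (parallel_n2 _ _ _ _ A Hpar _ u v Huv)), ?(proj2 (parallel_n2 _ _ _ _ A Hpar _ u v Huv)),
     ?Ne1, ?Ne1', ?Ne2, ?Ne2'; try ring.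
  - replace (mink (pdv cu n2 u v) (pdv cu z u v)) with (- (eps1 * a u v * a u v + 2 * 0 * a u v * c u v + eps2 * c u v * c u v)) by lra.
    rewrite X1. mink_lin. rewrite (mink_sym e2 e1), M1, M2, M3. field. lra.
  - replace (mink (pdv cu n2 u v) (pdv cv z u v)) with (- (eps1 * a u v * b u v + eps2 * c u v * d u v)) by lra.
    rewrite X2. mink_lin. rewrite (mink_sym e2 e1), M1, M2, M3. field. lra.
  - replace (mink (pdv cv n2 u v) (pdv cu z u v)) with (- (eps1 * a u v * b u v + eps2 * c u v * d u v)) by lra.
    rewrite X1. mink_lin. rewrite (mink_sym e2 e1), M1, M2, M3. field. lra.
  - replace (mink (pdv cv n2 u v) (pdv cv z u v)) with (- (eps1 * b u v * b u v + eps2 * d u v * d u v)) by lra.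
    rewrite X2. mink_lin. rewrite (mink_sym e2 e1), M1, M2, M3. field. lra.
Qed.

(** The statement for a du + b dv follows from the one for c du + d dv by
    exchanging the two null directions. *)
Lemma coframe_closed u v : D (u, v) -> pd cv a u v = pd cu b u v /\ pd cv c u v = pd cu d u v.
Proof.
  pose proof smooth_dual1 as S1. pose proof smooth_dual2 as S2.
  pose proof C as [Sa Sb Sc Sd Sm HJ Hm _ _ _].
  intros Huv. split; revert u v Huv.
  - apply (second_form_closed D z n2 (dual2 z a b c d) (dual1 z a b c d) c d a b m eps2 eps1);
      try assumption; try apply A.
    intros u v Huv. specialize (Hm u v Huv).
    destruct (dual_metric u v Huv) as (M1 & M2 & M3). destruct (dual_expand u v Huv) as (X1 & X2).
    destruct (n2_derivatives u v Huv) as (Y1 & Y2).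
    repeat split; try assumption; try lra.
    + rewrite X1. apply vec_eq; comps; ring.
    + rewrite X2. apply vec_eq; comps; ring.
    + rewrite mink_sym; assumption.
    + rewrite Y1. apply vec_eq; comps; ring.
    + rewrite Y2. apply vec_eq; comps; ring.
  - apply (second_form_closed D z n2 (dual1 z a b c d) (dual2 z a b c d) a b c d m eps1 eps2);
      try assumption; try apply A.
    intros u v Huv. specialize (Hm u v Huv).
    destruct (dual_metric u v Huv) as (M1 & M2 & M3). destruct (dual_expand u v Huv) as (X1 & X2).
    destruct (n2_derivatives u v Huv) as (Y1 & Y2).
    repeat split; try assumption; try lra.
Qed.

End NormalizedCoframe.

(** * Canonical parameters *)

(** In isotropic parameters, with k the component of sigma(z_u, z_u) along [n1],
    the Gauss equation gives K - H^2 = - eps1 eps2 (k^2 + 1) / f^4; this is where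
    the sign in the definition of canonical parameters comes from. *)
Lemma canonical_of_adapted_frame W Z n1 n2 f eps1 eps2 :
  adapted_frame W Z n1 n2 -> isotropic W Z f ->
  (eps1 = 1 \/ eps1 = -1) -> (eps2 = 1 \/ eps2 = -1) ->
  (forall u v, W (u, v) ->
     shape Z n2 cu cu u v = eps1 /\ shape Z n2 cu cv u v = 0 /\ shape Z n2 cv cv u v = eps2 /\
     shape Z n1 cv cv u v = eps1 * eps2 * shape Z n1 cu cu u v) ->
  canonical W Z.
Proof.
  intros A Hf He1 He2 HS. pose proof (af_open _ _ _ _ A) as HO.
  pose proof (af_z _ _ _ _ A) as SZ. pose proof (af_n1 _ _ _ _ A) as S1. pose proof (af_n2 _ _ _ _ A) as S2.
  destruct Hf as [Sf Hm].
  assert (He11 : eps1 * eps1 = 1) by (destruct He1; subst; lra).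
  assert (He22 : eps2 * eps2 = 1) by (destruct He2; subst; lra).
  assert (Hdet : forall u v, W (u, v) -> metric_det Z u v = - (f u v) ^ 4).
  { intros u v Huv. destruct (Hm u v Huv) as (F0 & F1 & F2 & F3). unfold metric_det. rewrite F1, F2, F3. ring. }
  assert (HT2 : forall u v, W (u, v) -> trace_shape Z n2 u v = 0).
  { intros u v Huv. destruct (Hm u v Huv) as (F0 & F1 & F2 & F3). destruct (HS u v Huv) as (_ & G & _).
    unfold trace_shape. rewrite Hdet, F1, F2, F3, G by assumption. field. lra. }
  assert (HT1 : forall u v, W (u, v) -> trace_shape Z n1 u v = - 2 * shape Z n1 cu cv u v / f u v ^ 2).
  { intros u v Huv. destruct (Hm u v Huv) as (F0 & F1 & F2 & F3).
    unfold trace_shape. rewrite Hdet, F1, F2, F3 by assumption. field. lra. }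
  exists f. split; [split; assumption|]. exists n1, n2.
  split; [split; [split; [assumption|]|apply A]; intros; apply push_normal; intros; apply A; assumption|].
  split.
  { intros u v Huv. exists (trace_shape Z n1 u v / 2). rewrite (mean_curvature_frame _ _ _ _ A) by assumption.
    rewrite HT2 by assumption. apply vec_eq; comps; field. }
  split; [split; [split; [assumption|]|apply A]; intros; apply push_normal; intros; apply A; assumption|].
  split; [apply A|].
  assert (Sh : forall n i j, smooth_vec W n -> smooth W (shape Z n i j)) by (intros; apply smooth_shape; assumption).
  assert (Hf2 : forall u v, W (u, v) -> f u v ^ 2 <> 0).
  { intros u v Huv. apply pow_nonzero. destruct (Hm u v Huv). lra. }
  assert (Hfn : forall u v, W (u, v) -> f u v <> 0) by (intros u v Huv; destruct (Hm u v Huv); lra).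
  exists (fun u v => shape Z n1 cu cu u v / f u v ^ 2), (fun u v => eps1 / f u v ^ 2),
    (fun u v => - shape Z n1 cu cv u v / f u v ^ 2).
  split; [smooth_tac; [exact Hf2|apply (Sh n1 cu cu S1)]|].
  split; [smooth_tac; exact Hf2|].
  split; [smooth_tac; [exact Hf2|apply (Sh n1 cu cv S1)]|].
  intros x y u v Huv eps w.
  assert (Si : smooth W (fun u v => / f u v)) by (apply smooth_inv; assumption).
  destruct (Hm u v Huv) as (F0 & F1 & F2 & F3). destruct (HS u v Huv) as (G1 & G2 & G3 & G4).
  assert (Hsign : eps = - (eps1 * eps2)).
  { unfold eps. rewrite (K_minus_H2_frame _ _ _ _ A) by assumption.
    rewrite HT1, HT2, Hdet by assumption. unfold det_shape. rewrite G1, G2, G3, G4.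
    set (k := shape Z n1 cu cu u v). set (l := shape Z n1 cu cv u v).
    assert (Hp : 0 < (k ^ 2 + 1) / f u v ^ 4).
    { apply Rdiv_lt_0_compat; [generalize (pow2_ge_0 k); lra|apply pow_lt; assumption]. }
    match goal with |- sign ?e = _ => replace e with (- (eps1 * eps2) * ((k ^ 2 + 1) / f u v ^ 4)) by (field; lra) end.
    assert (Hee : eps1 * eps2 = 1 \/ eps1 * eps2 = -1) by (destruct He1, He2; subst; lra).
    destruct Hee as [Hee|Hee]; rewrite Hee.
    - apply sign_eq_m1. lra.
    - rewrite sign_eq_1; lra. }
  split; [|split; [|split; [|split]]].
  - rewrite (sff_frame _ _ _ _ A x x u v Huv Si (smooth_const W 0)). unfold x, w. cbn [fst snd].
    rewrite G1. apply vec_eq; comps; field; lra.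
  - rewrite (sff_frame _ _ _ _ A x y u v Huv (smooth_const W 0) Si). unfold x, y. cbn [fst snd].
    rewrite G2. apply vec_eq; comps; field; lra.
  - rewrite (sff_frame _ _ _ _ A y y u v Huv (smooth_const W 0) Si). unfold y, w. cbn [fst snd].
    rewrite G3, G4, Hsign.
    apply vec_eq; comps; destruct He1, He2; subst eps1 eps2; field; lra.
  - intros H. apply (Rmult_eq_compat_r (f u v ^ 2)) in H. field_simplify in H; [|lra].
    destruct He1; lra.
  - replace (Rabs (eps1 / f u v ^ 2)) with ((/ f u v) * (/ f u v)).
    + rewrite sqrt_square; [field; lra|]. left. apply Rinv_0_lt_compat. assumption.
    + rewrite Rabs_div by (apply Hf2; assumption). rewrite (Rabs_right (f u v ^ 2)) by (apply Rle_ge, pow2_ge_0).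
      replace (Rabs eps1) with 1; [field; lra|]. destruct He1; subst eps1; unfold Rabs; destruct Rcase_abs; lra.
Qed.

Theorem proposition3p6 (U : R * R -> Prop) (z : R -> R -> R4)
    (Hz : timelike_surface U z)
    (Hpar : parallel_normalized_mean_curvature U z)
    (Hinf : forall u v : R, U (u, v) -> ~ inflection_point z u v)
    (HK : forall u v : R, U (u, v) -> K_minus_H2 z u v <> 0) :
  forall p : R * R, U p ->
    exists (W V : R * R -> Prop) (phi psi : R -> R -> R * R),
      planar_domain W /\ open V /\ V p /\ (forall q : R * R, V q -> U q) /\
      diffeo W V phi psi /\
      canonical W (reparam z phi).
Proof.
  destruct Hz as ((HO & _) & (Sz & _) & Hlor). destruct Hpar as (_ & _ & n1 & Hn1 & Hcol & Hp1).
  intros [u0 v0] H0.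
  assert (Hdet : forall u v, U (u, v) -> metric_det z u v < 0)
    by (intros u v Huv; apply lorentzian_metric_det, Hlor, Huv).
  destruct (adapted_frame_exists U z n1 HO Sz Hn1 Hdet) as [n2 A0].
  destruct (null_coframe_exists U z u0 v0 HO Sz Hdet H0) as (r1 & a1 & b1 & c1 & d1 & m1 & Hr1 & HB1 & C1).
  pose proof (adapted_frame_sub _ _ _ _ _ (box_open u0 v0 r1) HB1 A0) as A1.
  destruct (null_coframe_normalize _ _ _ _ _ _ _ _ _ u0 v0 A1 C1 (box_center u0 v0 r1 Hr1))
    as (r & e1 & e2 & a & b & c & d & m & Hr & HBB & He1 & He2 & C & Hq).
  { intros u v Huv. apply (coframe_n2_nonzero _ _ _ _ _ _ _ _ _ A1
      (fun u v H => Hp1 u v (HB1 _ H)) (fun u v H => Hcol u v (HB1 _ H)) C1 u v Huv);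
      [apply Hinf|apply HK]; apply HB1; assumption. }
  set (B := box u0 v0 r) in *.
  assert (HBU : forall q, B q -> U q) by (intros q Hq'; apply HB1, HBB, Hq').
  pose proof (adapted_frame_sub _ _ _ _ _ (box_open u0 v0 r) HBU A0) as A.
  assert (HpB : parallel B z n1) by (intros u v Huv; apply Hp1, HBU, Huv).
  assert (HcB : collinear_with_H B z n1) by (intros u v Huv; apply Hcol, HBU, Huv).
  assert (He1n : e1 <> 0) by (destruct He1; lra). assert (He2n : e2 <> 0) by (destruct He2; lra).
  pose proof (coframe_closed _ _ _ _ _ _ _ _ _ _ _ A HpB HcB C He1n He2n Hq) as Hcl.
  destruct (poincare u0 v0 r a b (nc_a _ _ _ _ _ _ _ C) (nc_b _ _ _ _ _ _ _ C) (fun u v Huv => proj1 (Hcl u v Huv)))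
    as (P & SP & HP).
  destruct (poincare u0 v0 r c d (nc_c _ _ _ _ _ _ _ C) (nc_d _ _ _ _ _ _ _ C) (fun u v Huv => proj2 (Hcl u v Huv)))
    as (Q & SQ & HQ).
  fold B in SP, HP, SQ, HQ.
  destruct (local_inverse B P Q u0 v0 (box_open u0 v0 r) (box_center u0 v0 r Hr) SP SQ) as
    (W & V & phi & HW & HV & HV0 & HVB & Hdiff).
  { intros u v Huv. destruct (HP u v Huv) as [-> ->]. destruct (HQ u v Huv) as [-> ->].
    apply (nc_jac _ _ _ _ _ _ _ C u v Huv). }
  exists W, V, phi, (fun u v => (P u v, Q u v)).
  split; [assumption|split; [assumption|split; [assumption|split; [intros q Hq'; apply HBU, HVB, Hq'|split; [assumption|]]]]].
  destruct HW as [HWo _]. destruct Hdiff as ((Sg & Sh) & _ & Hinv & _).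
  set (g := fun s t => fst (phi s t)) in *. set (h := fun s t => snd (phi s t)) in *.
  assert (Hgh : forall s t, W (s, t) -> B (g s t, h s t)).
  { intros s t Hst. apply HVB. unfold g, h. rewrite <- surjective_pairing. apply Hinv; assumption. }
  assert (HPQ : forall s t, W (s, t) -> B (g s t, h s t) /\ P (g s t) (h s t) = s /\ Q (g s t) (h s t) = t).
  { intros s t Hst. split; [apply Hgh; assumption|]. destruct (Hinv s t Hst) as [_ E]. injection E. auto. }
  pose proof (box_open u0 v0 r) as HBo. fold B in HBo.
  (* The coordinate vectors of the new chart are dual to (dP, dQ). *)
  set (jac := fun s t => a (g s t) (h s t) * d (g s t) (h s t) - b (g s t) (h s t) * c (g s t) (h s t)).
  assert (Dgh : forall s t, W (s, t) -> jac s t <> 0 /\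
    (pd cu g s t = d (g s t) (h s t) / jac s t /\ pd cu h s t = - c (g s t) (h s t) / jac s t) /\
    (pd cv g s t = - b (g s t) (h s t) / jac s t /\ pd cv h s t = a (g s t) (h s t) / jac s t)).
  { intros s t Hst. pose proof (Hgh s t Hst) as HB. pose proof (nc_jac _ _ _ _ _ _ _ C _ _ HB) as HJ.
    destruct (HP _ _ HB) as [P1 P2]. destruct (HQ _ _ HB) as [Q1 Q2].
    pose proof (fun i => inverse_derivatives B W P Q g h i s t HBo HWo HPQ SP SQ Sg Sh Hst) as X.
    rewrite P1, P2, Q1, Q2 in X. split; [exact HJ|]. split; [apply (X cu HJ)|apply (X cv HJ)]. }
  change (reparam z phi) with (fun s t => z (g s t) (h s t)).
  set (Z := fun s t => z (g s t) (h s t)).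
  set (N1 := fun s t => n1 (g s t) (h s t)). set (N2 := fun s t => n2 (g s t) (h s t)).
  pose proof (af_z _ _ _ _ A) as SzB. pose proof (af_n1 _ _ _ _ A) as Sn1. pose proof (af_n2 _ _ _ _ A) as Sn2.
  assert (HF : forall F s t, smooth_vec B F -> W (s, t) ->
    pdv cu (fun s t => F (g s t) (h s t)) s t =
      vadd (vscal (d (g s t) (h s t) / jac s t) (pdv cu F (g s t) (h s t)))
           (vscal (- c (g s t) (h s t) / jac s t) (pdv cv F (g s t) (h s t))) /\
    pdv cv (fun s t => F (g s t) (h s t)) s t =
      vadd (vscal (- b (g s t) (h s t) / jac s t) (pdv cu F (g s t) (h s t)))
           (vscal (a (g s t) (h s t) / jac s t) (pdv cv F (g s t) (h s t)))).
  { intros F s t SF Hst. destruct (Dgh s t Hst) as (_ & (<- & <-) & (<- & <-)).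
    split; apply (pdv_comp B W); try assumption; apply Hgh; assumption. }
  assert (Zd : forall s t, W (s, t) -> pdv cu Z s t = dual1 z a b c d (g s t) (h s t) /\
     pdv cv Z s t = dual2 z a b c d (g s t) (h s t)) by (intros s t Hst; exact (HF z s t SzB Hst)).
  assert (MZ : forall s t, W (s, t) -> metric Z cu cu s t = 0 /\ metric Z cv cv s t = 0 /\
     metric Z cu cv s t = m (g s t) (h s t)).
  { intros s t Hst. unfold metric. destruct (Zd s t Hst) as [-> ->].
    apply (dual_metric _ _ _ _ _ _ _ C). apply Hgh; assumption. }
  (* In the new parameters the second fundamental forms have the components of
     the old ones in the coframe. *)
  assert (SH : forall n s t, smooth_vec B n -> (forall i u v, B (u, v) -> mink (n u v) (pdv i z u v) = 0) -> W (s, t) ->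
    let N := fun s t => n (g s t) (h s t) in
    shape Z N cu cu s t = coframe_comp q11 a b c d z n (g s t) (h s t) /\
    shape Z N cu cv s t = coframe_comp q12 a b c d z n (g s t) (h s t) /\
    shape Z N cv cv s t = coframe_comp q22 a b c d z n (g s t) (h s t)).
  { intros n s t Sn Hn Hst N. unfold shape at 1 2 3. unfold N, Z.
    destruct (HF n s t Sn Hst) as [-> ->]. destruct (HF z s t SzB Hst) as [-> ->].
    pose proof (shape_sym _ _ _ _ A n (g s t) (h s t) Sn Hn (Hgh s t Hst)) as E.
    destruct (Dgh s t Hst) as (HJ & _). unfold jac in *. mink_lin.
    unfold coframe_comp, q11, q12, q22. unfold shape in *.
    assert (E' : mink (pdv cv n (g s t) (h s t)) (pdv cu z (g s t) (h s t)) = mink (pdv cu n (g s t) (h s t)) (pdv cv z (g s t) (h s t))) by lra.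
    rewrite E'. repeat split; field; assumption. }
  assert (AZ : adapted_frame W Z N1 N2).
  { constructor; try assumption.
    - exact (smooth_vec_comp B W z g h HBo HWo Hgh SzB Sg Sh).
    - exact (smooth_vec_comp B W n1 g h HBo HWo Hgh Sn1 Sg Sh).
    - exact (smooth_vec_comp B W n2 g h HBo HWo Hgh Sn2 Sg Sh).
    - intros s t Hst. unfold metric_det. destruct (MZ s t Hst) as (-> & -> & ->).
      generalize (nc_neg _ _ _ _ _ _ _ C _ _ (Hgh s t Hst)). nra.
    - intros i s t Hst. destruct (Zd s t Hst) as [E1 E2].
      destruct i; rewrite ?E1, ?E2; apply push_normal; intros; apply A; apply Hgh; assumption.
    - intros i s t Hst. destruct (Zd s t Hst) as [E1 E2].
      destruct i; rewrite ?E1, ?E2; apply push_normal; intros; apply A; apply Hgh; assumption.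
    - intros s t Hst. apply A, Hgh, Hst.
    - intros s t Hst. apply A, Hgh, Hst.
    - intros s t Hst. apply A, Hgh, Hst.
    - intros s t w Hst. destruct (Zd s t Hst) as [-> ->]. intros W1 W2 W3 W4.
      destruct (dual_expand _ _ _ _ _ _ _ C _ _ (Hgh s t Hst)) as (X1 & X2).
      apply (af_basis _ _ _ _ A (g s t) (h s t)); [apply Hgh; assumption| | |assumption|assumption].
      + rewrite X1. mink_lin. rewrite W1, W2. ring.
      + rewrite X2. mink_lin. rewrite W1, W2. ring. }
  assert (Hmpos : forall s t, W (s, t) -> 0 < - m (g s t) (h s t)).
  { intros s t Hst. generalize (nc_neg _ _ _ _ _ _ _ C _ _ (Hgh s t Hst)). lra. }
  apply (canonical_of_adapted_frame W Z N1 N2 (fun s t => sqrt (- m (g s t) (h s t))) e1 e2 AZ); try assumption.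
  - split.
    + apply smooth_sqrt; [assumption|exact Hmpos|]. apply smooth_opp; [assumption|].
      exact (smooth_comp B W m g h HBo HWo Hgh (nc_m _ _ _ _ _ _ _ C) Sg Sh).
    + intros s t Hst. destruct (MZ s t Hst) as (M1 & M2 & M3). specialize (Hmpos s t Hst).
      split; [apply sqrt_lt_R0; assumption|]. split; [assumption|split; [assumption|]].
      rewrite pow2_sqrt by lra. lra.
  - intros s t Hst. pose proof (Hgh s t Hst) as HB.
    destruct (SH n1 s t Sn1 (af_n1z _ _ _ _ A) Hst) as (L1 & _ & L3).
    destruct (SH n2 s t Sn2 (af_n2z _ _ _ _ A) Hst) as (K1 & K2 & K3).
    fold N1 in L1, L3. fold N2 in K1, K2, K3. destruct (Hq _ _ HB) as [Q1 Q2].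
    pose proof (coframe_ricci _ _ _ _ _ _ _ _ _ A HpB HcB C _ _ HB) as HR.
    pose proof (coframe_n2_diagonal _ _ _ _ _ _ _ _ _ A HcB C _ _ HB) as HD.
    rewrite Q1, Q2 in HR. rewrite K1, K2, K3, L1, L3.
    split; [assumption|split; [assumption|split; [assumption|]]].
    clear - HR He1 He2. destruct He1, He2; subst; lra.
Qed.
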